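(* There is an algorithm that, given a finite domain $D$ and a $\beta$-acyclic instance $I$ of $\#\mathrm{CSP}_{\mathrm{def}}$ on domain $D$ (all weights and default values given as non-negative rationals in binary), computes the partition function $w(I)$ in time polynomial in the size of the input.
   Context: For sets $D,X$, $D^X$ is the set of maps $X\to D$ (assignments); for $a\in D^X$ and $Y\subseteq X$, $a|_Y$ is the restriction. A weighted constraint with default value $c$ on a finite (possibly empty) variable set $\mathrm{var}(c)=X$ and domain $D$ is a pair $(f,\delta)$ with $f:S\to\mathbb{Q}_{\ge 0}$, $S\subseteq D^X$ (the support $\mathrm{supp}(c)$), and $\delta\in\mathbb{Q}_{\ge0}$ (the default value); it induces the total function $c:D^X\to\mathbb{Q}_{\ge0}$ with $c(a)=f(a)$ for $a\in S$ and $c(a)=\delta$ otherwise. Its size is $|c|=|S|\cdot|X|$. An instance $I$ of $\#\mathrm{CSP}_{\mathrm{def}}$ is a finite set of such constraints over a common domain $D$; $\mathrm{var}(I)=\bigcup_{c\in I}\mathrm{var}(c)$, $\|I\|=\sum_{c\in I}|c|$, and the partition function is $w(I)=\sum_{a\in D^{\mathrm{var}(I)}}\prod_{c\in I}c(a|_{\mathrm{var}(c)})$. The hypergraph of $I$ is $\mathcal H(I)=(\mathrm{var}(I),\{\mathrm{var}(c)\mid c\in I\})$. For a hypergraph $\mathcal H$ and vertex set $S$, $\mathcal H\setminus S$ is the hypergraph on $V(\mathcal H)\setminus S$ with edges $\{e\setminus S\mid e\in E(\mathcal H)\}\setminus\{\emptyset\}$. A vertex $x$ is a nest point of $\mathcal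 H$ if the edges containing $x$ are totally ordered by inclusion. A $\beta$-elimination order of $\mathcal H$ is a sequence $(x_1,\dots,x_n)$ enumerating $V(\mathcal H)$ such that $x_1$ is a nest point of $\mathcal H$ and $(x_2,\dots,x_n)$ is a $\beta$-elimination order of $\mathcal H\setminus x_1$ (the empty sequence for the empty hypergraph). $\mathcal H$ (and an instance $I$ with $\mathcal H(I)=\mathcal H$) is $\beta$-acyclic if it has a $\beta$-elimination order. *)

(* Defs.v *)
From HB Require Import structures.
From mathcomp Require Import all_boot all_order all_algebra.
Set Implicit Arguments. Unset Strict Implicit. Unset Printing Implicit Defensive.
Import Order.TTheory GRing.Theory Num.Theory.
Local Open Scope ring_scope.

(* The domain D is {0, ..., d-1} (a finite set of size d).
   Variables are natural numbers.
   A constraint is (vars, support, default): [vars] lists var(c) (without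
   repetition); [support] lists pairs (a, f a) where the assignment
   a : var(c) -> D is given as the list of values of the variables of [vars]
   in that order; [default] is delta. *)
Definition constraint : Type := (seq nat * seq (seq nat * rat) * rat)%type.
Definition cvars (c : constraint) : seq nat := c.1.1.
Definition csupp (c : constraint) : seq (seq nat * rat) := c.1.2.
Definition cdef (c : constraint) : rat := c.2.

Definition instance : Type := seq constraint.

Definition wf_constraint (d : nat) (c : constraint) : bool :=
  [&& uniq (cvars c),
      all (fun p : seq nat * rat =>
             [&& size p.1 == size (cvars c),
                 all (fun v => (v < d)%N) p.1 & 0 <= p.2]) (csupp c),
      uniq (map fst (csupp c)) & 0 <= cdef c].

Definition wf_instance (d : nat) (I : instance) : bool :=
  all (wf_constraint d) I.

Definition eval_constraint (c : constraint) (asg : nat -> nat) : rat :=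
  let t := map asg (cvars c) in
  let i := find (fun p : seq nat * rat => p.1 == t) (csupp c) in
  if (i < size (csupp c))%N then (nth ([::], 0) (csupp c) i).2 else cdef c.

Definition ivars (I : instance) : seq nat := undup (flatten (map cvars I)).

(* global assignment D^{var(I)} represented as a finite function on the
   positions of var(I) *)
Definition asg_of (V : seq nat) (d : nat) (a : {ffun 'I_(size V) -> 'I_d})
  (x : nat) : nat :=
  if insub (index x V) is Some i then nat_of_ord (a i) else 0%N.

Definition partition_fn (d : nat) (I : instance) : rat :=
  \sum_(a : {ffun 'I_(size (ivars I)) -> 'I_d})
     \prod_(c <- I) eval_constraint c (asg_of a).

(* A hypergraph is given by its list of edges; its vertex set is the   *)
(* union of its edges (this is the case for H(I), whose vertex set is  *)
(* var(I), and is preserved by vertex deletion).                       *)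

Definition hvertices (E : seq (seq nat)) : seq nat := undup (flatten E).

Definition subedge (e1 e2 : seq nat) : bool := all (fun v => v \in e2) e1.

Definition nest_point (E : seq (seq nat)) (x : nat) : bool :=
  all (fun e1 => all (fun e2 =>
        (x \in e1) ==> (x \in e2) ==> (subedge e1 e2 || subedge e2 e1)) E) E.

Definition del_vertex (x : nat) (E : seq (seq nat)) : seq (seq nat) :=
  filter (fun e => ~~ nilp e) (map (filter (fun v => v != x)) E).

Fixpoint beta_elim_order (E : seq (seq nat)) (s : seq nat) : bool :=
  match s with
  | [::] => nilp (hvertices E)
  | x :: s' => [&& x \in hvertices E, nest_point E x &
                   beta_elim_order (del_vertex x E) s']
  end.

Definition beta_acyclic (E : seq (seq nat)) : Prop :=
  exists s, beta_elim_order E s.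

Definition hypergraph_of (I : instance) : seq (seq nat) := map cvars I.

Fixpoint nbits (fuel n : nat) : seq bool :=
  match fuel with
  | 0 => [::]
  | f.+1 => if n == 0%N then [::] else odd n :: nbits f n./2
  end.
Definition bin (n : nat) : seq bool := nbits n n.   (* LSB first *)

(* self-delimiting binary code of a natural number *)
Definition enc_nat (n : nat) : seq bool :=
  flatten (map (fun b => [:: true; b]) (bin n)) ++ [:: false].

Definition enc_list (T : Type) (f : T -> seq bool) (s : seq T) : seq bool :=
  enc_nat (size s) ++ flatten (map f s).

(* non-negative rational in binary: numerator, denominator *)
Definition enc_rat (q : rat) : seq bool :=
  enc_nat `|numq q|%N ++ enc_nat `|denq q|%N.

Definition enc_constraint (c : constraint) : seq bool :=
  enc_list enc_nat (cvars c)
  ++ enc_list (fun p : seq nat * rat => enc_list enc_nat p.1 ++ enc_rat p.2)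
              (csupp c)
  ++ enc_rat (cdef c).

(* the input: the domain D (listing its elements) and the instance I *)
Definition enc_input (d : nat) (I : instance) : seq bool :=
  enc_list enc_nat (iota 0 d) ++ enc_list enc_constraint I.

(* Machine model: RAM with logarithmic cost (polynomially equivalent   *)
(* to Turing machines).  Registers R[0], R[1], ... hold naturals.      *)

Inductive instr : Type :=
| Iconst (r n : nat)
| Iadd (r a b : nat)
| Isub (r a b : nat)          (* R[r] := R[a] - R[b]  (truncated) *)
| Imul (r a b : nat)
| Idiv (r a b : nat)          (* R[r] := R[a] / R[b]  (0 if R[b] = 0) *)
| Iload (r a : nat)
| Istore (a b : nat)
| Ijz (r l : nat)
| Ihalt.

Definition program := seq instr.
Definition memory := nat -> nat.

Definition blen (n : nat) : nat := (trunc_log 2 n).+1.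

Definition upd (m : memory) (r v : nat) : memory :=
  fun i => if i == r then v else m i.

Definition step (p : program) (pc : nat) (m : memory)
  : option (nat * memory * nat) :=
  match nth Ihalt p pc with
  | Ihalt => None
  | Iconst r n => Some (pc.+1, upd m r n, (1 + blen r + blen n)%N)
  | Iadd r a b => Some (pc.+1, upd m r (m a + m b)%N,
                        (1 + blen r + blen a + blen b + blen (m a) + blen (m b))%N)
  | Isub r a b => Some (pc.+1, upd m r (m a - m b)%N,
                        (1 + blen r + blen a + blen b + blen (m a) + blen (m b))%N)
  | Imul r a b => Some (pc.+1, upd m r (m a * m b)%N,
                        (1 + blen r + blen a + blen b + blen (m a) + blen (m b))%N)
  | Idiv r a b => Some (pc.+1, upd m r (m a %/ m b)%N,
                        (1 + blen r + blen a + blen b + blen (m a) + blen (m b))%N)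
  | Iload r a => Some (pc.+1, upd m r (m (m a)),
                       (1 + blen r + blen a + blen (m a) + blen (m (m a)))%N)
  | Istore a b => Some (pc.+1, upd m (m a) (m b),
                        (1 + blen a + blen b + blen (m a) + blen (m b))%N)
  | Ijz r l => Some (if m r == 0%N then l else pc.+1, m,
                     (1 + blen r + blen l + blen (m r))%N)
  end.

Fixpoint run (p : program) (fuel : nat) (pc : nat) (m : memory)
  : option (memory * nat) :=
  match step p pc m with
  | None => Some (m, 0%N)
  | Some (pc', m', c) =>
      match fuel with
      | 0 => None
      | f.+1 => omap (fun r => (r.1, (c + r.2)%N)) (run p f pc' m')
      end
  end.

(* input bit string x: R[0] = |x|, R[i+1] = i-th bit of x, others 0 *)
Definition init_mem (x : seq bool) : memory :=
  fun i => if i == 0%N then size x else nth 0%N (map nat_of_bool x) i.-1.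

(* Main.v *)
Require Import Defs.
From HB Require Import structures.
From mathcomp Require Import all_boot all_order all_algebra.
From mathcomp Require Import zify.
Set Implicit Arguments. Unset Strict Implicit. Unset Printing Implicit Defensive.
Import Order.TTheory GRing.Theory Num.Theory.

(* The variables are eliminated along a beta-elimination order. The constraints
   containing a nest point x form a chain c_1, ..., c_k by inclusion of their
   variable sets; with P_i(a) the sum over the value of x of c_1 ... c_i, each c_i
   is replaced by c_i' = P_i / P_(i-1), so that c_1' ... c_k' = P_k up to the
   factor |D| = P_0. An assignment that extends to no element of supp(c_i) gets
   the default value of c_i, so neither supports nor defaults grow.

   The weights stay small for the following reason. Sort the constraints
   lexicographically by their variables, the last eliminated variable being the
   most significant: this is one linear order that refines all the chains. Then
   after t eliminations the product of the first i constraints is, up to |D|^t,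
   the partition function of the first i original constraints with the t
   variables summed out, and every weight is a quotient of two such numbers.
   To have nonzero denominators, weights are first scaled to integers N and
   replaced by N * B + 1 for a large B; the true value is recovered by rounding
   down a division by a power of B.

   Polynomial time is established by a class FP of functions on heap-allocated
   data, closed under composition, pairing, conditionals and loops whose states
   stay of polynomial size, whose members are compiled to the RAM. *)

(** * Bit length *)

Lemma blen_gt0 n : 0 < blen n.
Proof. by []. Qed.

Lemma leq_blen m n : m <= n -> blen m <= blen n.
Proof. by move=> le_mn; rewrite /blen ltnS leq_trunc_log. Qed.

Lemma ltn_blen n : n < 2 ^ blen n.
Proof. by rewrite /blen trunc_log_ltn. Qed.

Lemma blen_ltn n b : n < 2 ^ b -> blen n <= maxn b 1.
Proof.
case: (posnP n) => [-> _|n_gt0 n_lt]; first by rewrite /blen trunc_log0 leq_maxr.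
rewrite leq_max /blen -(ltn_exp2l _ _ (isT : 1 < 2)).
by rewrite (leq_ltn_trans (trunc_logP _ n_gt0)).
Qed.

Lemma blen_leS n : blen n <= n.+1.
Proof.
have lt_n : n < 2 ^ n by exact: ltn_expl.
by apply: leq_trans (blen_ltn lt_n) _; rewrite geq_max leqnSn.
Qed.

Lemma blenD m n : blen (m + n) <= blen m + blen n.
Proof.
have bound k l : m < 2 ^ k.+1 -> n < 2 ^ l.+1 -> m + n < 2 ^ (k.+1 + l.+1).
  rewrite addSn addnS !expnS expnD => lt_m lt_n.
  have := expn_gt0 2 k; have := expn_gt0 2 l; nia.
have := blen_ltn (bound _ _ (ltn_blen m) (ltn_blen n)).
by rewrite /blen; lia.
Qed.

Lemma blenM m n : blen (m * n) <= blen m + blen n.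
Proof.
have bound : m * n < 2 ^ (blen m + blen n).
  by rewrite expnD; have := ltn_blen m; have := ltn_blen n; nia.
by have := blen_ltn bound; have := blen_gt0 m; lia.
Qed.

Lemma blen_add_leS m n : blen (m + n) <= blen m + n.+1.
Proof. by rewrite (leq_trans (blenD m n)) // leq_add2l blen_leS. Qed.

Lemma blen0 : blen 0 = 1. Proof. by []. Qed.
Lemma blen1 : blen 1 = 1. Proof. by []. Qed.
Lemma blen2 : blen 2 = 2. Proof. by []. Qed.

(** * A structured language compiled to the RAM *)

(* Register 1 is the scratch register of unconditional jumps: the code of a
   conditional or a loop sets it to 0 and then uses [Ijz 1]. *)
Inductive cmd : Type :=
| Cskip
| Cbasic of instr
| Cseq of cmd & cmd
| Cif of nat & cmd & cmd
| Cwhile of nat & cmd.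

Definition basic (i : instr) : bool :=
  match i with Ijz _ _ | Ihalt => false | _ => true end.

Definition effect (i : instr) (m : memory) : memory * nat :=
  if step [:: i] 0 m is Some (_, m', t) then (m', t) else (m, 0).

Inductive exec : cmd -> memory -> memory -> nat -> Prop :=
| Exec_skip m : exec Cskip m m 0
| Exec_basic i m : basic i -> exec (Cbasic i) m (effect i m).1 (effect i m).2
| Exec_seq c1 c2 m m1 m2 t1 t2 : exec c1 m m1 t1 -> exec c2 m1 m2 t2 ->
    exec (Cseq c1 c2) m m2 (t1 + t2)
| Exec_then r c1 c2 m m' t : m r != 0 -> exec c1 m m' t ->
    exec (Cif r c1 c2) m (upd m' 1 0) (1 + blen r + blen (m r) + t)
| Exec_else r c1 c2 m m' t : m r = 0 -> exec c2 m m' t ->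
    exec (Cif r c1 c2) m m' (1 + blen r + blen (m r) + t)
| Exec_stop r c m : m r = 0 ->
    exec (Cwhile r c) m m (1 + blen r + blen (m r))
| Exec_loop r c m m1 m2 t1 t2 : m r != 0 -> exec c m m1 t1 ->
    exec (Cwhile r c) (upd m1 1 0) m2 t2 ->
    exec (Cwhile r c) m m2 (1 + blen r + blen (m r) + t1 + t2).

Fixpoint code_size (c : cmd) : nat :=
  match c with
  | Cskip => 0
  | Cbasic _ => 1
  | Cseq c1 c2 => code_size c1 + code_size c2
  | Cif _ c1 c2 => code_size c1 + code_size c2 + 3
  | Cwhile _ c => code_size c + 3
  end.

Definition goto (l : nat) : program := [:: Iconst 1 0; Ijz 1 l].

Fixpoint compile (pc : nat) (c : cmd) : program :=
  match c with
  | Cskip => [::]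
  | Cbasic i => [:: i]
  | Cseq c1 c2 => compile pc c1 ++ compile (pc + code_size c1) c2
  | Cif r c1 c2 =>
      let else_pc := pc + code_size c1 + 3 in
      Ijz r else_pc ::
        compile pc.+1 c1 ++ goto (else_pc + code_size c2) ++ compile else_pc c2
  | Cwhile r c =>
      Ijz r (pc + code_size c + 3) :: compile pc.+1 c ++ goto pc
  end.

Lemma size_compile pc c : size (compile pc c) = code_size c.
Proof.
elim: c pc => //= [c1 IH1 c2 IH2|r c1 IH1 c2 IH2|r c IH] pc.
- by rewrite size_cat IH1 IH2.
- by rewrite size_cat IH1 /= IH2; lia.
- by rewrite size_cat IH /=; lia.
Qed.

Inductive steps (p : program) : nat -> memory -> nat -> nat -> memory -> Prop :=
| Steps_refl pc m : steps p pc m 0 pc m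
| Steps_cons pc m pc1 m1 t1 pc2 m2 t2 : step p pc m = Some (pc1, m1, t1) ->
    steps p pc1 m1 t2 pc2 m2 -> steps p pc m (t1 + t2) pc2 m2.

Lemma steps_trans p pc m t pc1 m1 t1 pc2 m2 :
  steps p pc m t pc1 m1 -> steps p pc1 m1 t1 pc2 m2 -> steps p pc m (t + t1) pc2 m2.
Proof.
elim=> // {}pc {}m pca ma ta pcb mb tb st _ IH /IH sts.
by rewrite -addnA; apply: Steps_cons st sts.
Qed.

Lemma steps_run p pc m t pc' m' : steps p pc m t pc' m' ->
  step p pc' m' = None -> exists fuel, run p fuel pc m = Some (m', t).
Proof.
elim=> {pc m t pc' m'} [pc m st|pc m pc1 m1 t1 pc2 m2 t2 st _ IH /IH[f run_f]].
  by exists 0; rewrite /= st.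
by exists f.+1; rewrite /= st run_f.
Qed.

Definition code_at (p : program) (pc : nat) (s : program) : Prop :=
  exists p1 p2, p = p1 ++ s ++ p2 /\ size p1 = pc.

Lemma code_at_catl p pc s1 s2 : code_at p pc (s1 ++ s2) -> code_at p pc s1.
Proof.
by case=> p1 [p2 [-> <-]]; exists p1, (s2 ++ p2); split; rewrite // -!catA.
Qed.

Lemma code_at_catr p pc s1 s2 :
  code_at p pc (s1 ++ s2) -> code_at p (pc + size s1) s2.
Proof.
case=> p1 [p2 [-> <-]]; exists (p1 ++ s1), p2.
by rewrite -!catA size_cat.
Qed.

Lemma code_at_cons p pc i s : code_at p pc (i :: s) ->
  nth Ihalt p pc = i /\ code_at p pc.+1 s.
Proof.
move=> at_is; split; last by rewrite -addn1; apply: (@code_at_catr _ _ [:: i]).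
by case: at_is => p1 [p2 [-> <-]]; rewrite nth_cat ltnn subnn.
Qed.

Lemma code_at_goto p pc s1 l s2 : code_at p pc (s1 ++ goto l ++ s2) ->
  code_at p (pc + size s1) (goto l) /\ code_at p (pc + size s1 + 2) s2.
Proof.
by move=> /code_at_catr at_goto; split;
  [apply: code_at_catl at_goto | apply: code_at_catr at_goto].
Qed.

Lemma code_at_size p pc s : code_at p pc s -> pc + size s <= size p.
Proof. by case=> p1 [p2 [-> <-]]; rewrite !size_cat addnA leq_addr. Qed.

Section Simulation.
Variable p : program.

(* The factor pays for the jump instructions, whose labels have cost at most
   [blen (size p)]. *)
Definition slowdown : nat := 7 + 2 * blen (size p).

Definition simulates (c : cmd) (m m' : memory) (t : nat) : Prop :=
  forall pc, code_at p pc (compile pc c) ->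
  exists2 t', steps p pc m t' (pc + code_size c) m' & t' <= slowdown * t.

Lemma steps_basic pc m i : code_at p pc [:: i] -> basic i ->
  steps p pc m (effect i m).2 pc.+1 (effect i m).1.
Proof.
move=> /code_at_cons[at_pc _] basic_i; rewrite -[(effect i m).2]addn0.
apply: Steps_cons (Steps_refl _ _ _).
by rewrite /step /effect /step /= at_pc; case: i basic_i {at_pc}.
Qed.

Lemma steps_jump pc m r l : nth Ihalt p pc = Ijz r l -> m r = 0 ->
  steps p pc m (1 + blen r + blen l + blen (m r)) l m.
Proof.
move=> at_pc mr0; rewrite -[X in steps _ _ _ X]addn0.
by apply: Steps_cons (Steps_refl _ _ _); rewrite /step at_pc mr0.
Qed.

Lemma steps_fallthrough pc m r l : nth Ihalt p pc = Ijz r l -> m r != 0 ->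
  steps p pc m (1 + blen r + blen l + blen (m r)) pc.+1 m.
Proof.
move=> at_pc mr_neq0; rewrite -[X in steps _ _ _ X]addn0.
by apply: Steps_cons (Steps_refl _ _ _); rewrite /step at_pc (negbTE mr_neq0).
Qed.

Lemma steps_goto pc m l : code_at p pc (goto l) ->
  steps p pc m (6 + blen l) l (upd m 1 0).
Proof.
move=> at_goto; have /code_at_cons[at_jump _] := (code_at_cons at_goto).2.
have -> : 6 + blen l = 3 + (1 + blen 1 + blen l + blen (upd m 1 0 1)).
  by rewrite (_ : upd m 1 0 1 = 0) // blen0 blen1; lia.
apply: steps_trans (steps_jump at_jump erefl).
exact: (@steps_basic _ _ (Iconst 1 0) (@code_at_catl _ _ [:: _] _ at_goto)).
Qed.

Lemma leq_slowdown a j t t' : j <= slowdown -> t' <= slowdown * t ->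
  a + j + t' <= slowdown * (1 + a + t).
Proof. by rewrite /slowdown; nia. Qed.

Lemma simulates_seq c1 c2 m m1 m2 t1 t2 :
  simulates c1 m m1 t1 -> simulates c2 m1 m2 t2 ->
  simulates (Cseq c1 c2) m m2 (t1 + t2).
Proof.
move=> sim1 sim2 pc /= at_pc.
have [t1' steps1 le1] := sim1 _ (code_at_catl at_pc).
have [|t2' steps2 le2] := sim2 (pc + code_size c1).
  by have := code_at_catr at_pc; rewrite size_compile.
exists (t1' + t2'); last by rewrite mulnDr leq_add.
by rewrite addnA; apply: steps_trans steps1 steps2.
Qed.

Lemma simulates_then r c1 c2 m m' t : m r != 0 -> simulates c1 m m' t ->
  simulates (Cif r c1 c2) m (upd m' 1 0) (1 + blen r + blen (m r) + t).
Proof.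
move=> mr_neq0 sim1 pc at_pc; have := code_at_size at_pc;
rewrite size_compile /= => le_size.
move: at_pc; rewrite /=; set else_pc := pc + code_size c1 + 3 => at_pc.
have [at_jump at_rest] := code_at_cons at_pc.
have [t' steps1 le1] := sim1 _ (code_at_catl at_rest).
have [at_goto _] := code_at_goto at_rest; rewrite size_compile in at_goto.
rewrite (_ : pc + _ = else_pc + code_size c2); last by rewrite /else_pc; lia.
eexists.
  apply: steps_trans (steps_fallthrough at_jump mr_neq0) _.
  exact: steps_trans steps1 (steps_goto _ at_goto).
apply: leq_trans (leq_slowdown (blen r + blen (m r)) (leqnn _) le1).
have := @leq_blen else_pc (size p); have := @leq_blen (else_pc + code_size c2) (size p).
by rewrite /slowdown /else_pc; lia.
Qed.

Lemma simulates_else r c1 c2 m m' t : m r = 0 -> simulates c2 m m' t ->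
  simulates (Cif r c1 c2) m m' (1 + blen r + blen (m r) + t).
Proof.
move=> mr0 sim2 pc at_pc; have := code_at_size at_pc; rewrite size_compile /= => le_size.
move: at_pc; rewrite /=; set else_pc := pc + code_size c1 + 3 => at_pc.
have [at_jump at_rest] := code_at_cons at_pc.
have [_] := code_at_goto at_rest; rewrite size_compile.
rewrite (_ : _ + 2 = else_pc) => [at_else|]; last by rewrite /else_pc; lia.
have [t' steps2 le2] := sim2 _ at_else.
rewrite (_ : pc + _ = else_pc + code_size c2); last by rewrite /else_pc; lia.
eexists; first exact: steps_trans (steps_jump at_jump mr0) steps2.
apply: leq_trans (leq_slowdown (blen r + blen (m r)) (leqnn _) le2).
by have := @leq_blen else_pc (size p); rewrite /slowdown /else_pc; lia.
Qed.

Lemma simulates_stop r c m : m r = 0 ->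
  simulates (Cwhile r c) m m (1 + blen r + blen (m r)).
Proof.
move=> mr0 pc at_pc.
have := code_at_size at_pc; rewrite size_compile /= => le_size.
have [at_jump _] := code_at_cons at_pc.
rewrite addnA; eexists; first exact: steps_jump at_jump mr0.
have le0 : 0 <= slowdown * 0 by []; rewrite -[X in _ * X]addn0.
apply: leq_trans (leq_slowdown (blen r + blen (m r)) (leqnn _) le0).
by have := @leq_blen (pc + code_size c + 3) (size p); rewrite /slowdown; lia.
Qed.

Lemma simulates_loop r c m m1 m2 t1 t2 : m r != 0 -> simulates c m m1 t1 ->
  simulates (Cwhile r c) (upd m1 1 0) m2 t2 ->
  simulates (Cwhile r c) m m2 (1 + blen r + blen (m r) + t1 + t2).
Proof.
move=> mr_neq0 sim_body sim_loop pc at_pc; have [t2' steps2 le2] := sim_loop pc at_pc.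
have := code_at_size at_pc; rewrite size_compile /= => le_size.
have [at_jump at_rest] := code_at_cons at_pc.
have [t1' steps1 le1] := sim_body _ (code_at_catl at_rest).
have := code_at_catr at_rest; rewrite size_compile => at_goto.
eexists.
  apply: steps_trans (steps_fallthrough at_jump mr_neq0) _.
  exact: steps_trans steps1 (steps_trans (steps_goto _ at_goto) steps2).
have le12 : t1' + t2' <= slowdown * (t1 + t2) by rewrite mulnDr leq_add.
rewrite -[X in _ * X]addnA.
apply: leq_trans (leq_slowdown (blen r + blen (m r)) (leqnn _) le12).
have := @leq_blen (pc + code_size c + 3) (size p); have := @leq_blen pc (size p).
by rewrite /slowdown; lia.
Qed.

Lemma exec_simulates c m m' t : exec c m m' t -> simulates c m m' t.
Proof.
elim=> {c m m' t} [m pc _|i m basic_i pc at_i|c1 c2 m m1 m2 t1 t2 _ sim1 _|||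
  |r c m m1 m2 t1 t2 mr_neq0 _ sim1 _].
- by exists 0; rewrite // addn0; apply: Steps_refl.
- exists (effect i m).2; last by rewrite leq_pmull.
  by rewrite addn1; apply: steps_basic.
- exact: simulates_seq sim1.
- by move=> r c1 c2 m m' t mr_neq0 _; apply: simulates_then.
- by move=> r c1 c2 m m' t mr0 _; apply: simulates_else.
- exact: simulates_stop.
- exact: simulates_loop sim1.
Qed.
End Simulation.

Lemma run_compile c m m' t : exec c m m' t ->
  let p := compile 0 c in
  exists fuel t', run p fuel 0 m = Some (m', t') /\ t' <= slowdown p * t.
Proof.
move=> exec_c p; have at_0 : code_at p 0 p by exists [::], [::]; rewrite cats0.
have [t' steps_p le_t'] := exec_simulates exec_c at_0.
have halt : step p (0 + code_size c) m' = None.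
  by rewrite /step nth_default // size_compile.
by have [fuel run_p] := steps_run steps_p halt; exists fuel, t'.
Qed.

(** * Polynomially bounded functions *)

Definition poly_bounded (P : nat -> nat) : Prop :=
  {homo P : m n / m <= n} /\ exists b, forall n, P n <= n.+2 ^ b.

Lemma leq_pow2 n a b : a <= b -> n.+2 ^ a <= n.+2 ^ b.
Proof. by move=> le_ab; rewrite leq_exp2l. Qed.

Lemma poly_const c : poly_bounded (fun=> c).
Proof.
split=> //; exists c => n; apply: leq_trans (ltnW (ltn_expl c (isT : 1 < 2))) _.
by case: c => // c; rewrite leq_exp2r.
Qed.

Lemma poly_id : poly_bounded id.
Proof. by split=> //; exists 1 => n; rewrite expn1; lia. Qed.

Lemma poly_add P Q : poly_bounded P -> poly_bounded Q ->
  poly_bounded (fun n => P n + Q n).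
Proof.
case=> homP [a leP] [homQ [b leQ]].
split=> [m n le_mn|]; first by rewrite leq_add ?homP ?homQ.
exists (maxn a b).+1 => n.
have := leq_pow2 n (leq_maxl a b); have := leq_pow2 n (leq_maxr a b).
by have := leP n; have := leQ n; rewrite expnS; nia.
Qed.

Lemma poly_mul P Q : poly_bounded P -> poly_bounded Q ->
  poly_bounded (fun n => P n * Q n).
Proof.
case=> homP [a leP] [homQ [b leQ]].
split=> [m n le_mn|]; first by rewrite leq_mul ?homP ?homQ.
by exists (a + b) => n; rewrite expnD leq_mul.
Qed.

Lemma poly_comp P Q : poly_bounded P -> poly_bounded Q ->
  poly_bounded (fun n => P (Q n)).
Proof.
case=> homP [a leP] [homQ [b leQ]].
split=> [m n le_mn|]; first by rewrite homP ?homQ.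
exists (b.+2 * a) => n; apply: leq_trans (leP _) _.
rewrite expnM; case: a {leP} => // a; rewrite leq_exp2r //.
by have := leQ n; have := expn_gt0 n.+2 b; rewrite !expnS; nia.
Qed.

Lemma poly_succ P : poly_bounded P -> poly_bounded (fun n => (P n).+1).
Proof. by move=> polyP; have := poly_add (poly_const 1) polyP. Qed.

Ltac poly := cbv beta;
  lazymatch goal with
  | |- poly_bounded id => exact poly_id
  | |- poly_bounded (fun n => n) => exact poly_id
  | |- poly_bounded (fun _ => ?c) => exact (poly_const c)
  | |- poly_bounded (fun n => addn (@?f n) (@?g n)) => apply (@poly_add f g); poly
  | |- poly_bounded (fun n => muln (@?f n) (@?g n)) => apply (@poly_mul f g); poly
  | |- poly_bounded (fun n => S (@?f n)) => apply (@poly_succ f); poly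
  | H : poly_bounded ?P |- poly_bounded ?P => exact H
  | H : poly_bounded ?P |- poly_bounded (fun n => ?P (@?Q n)) =>
      apply (@poly_comp P Q H); poly
  end.

(** * Heap representation of data *)

(* [represents m lo hi w x]: in memory [m] the word [w] represents [x], all cells
   of the representation being at addresses in [lo, hi). *)
Class Data (T : Type) := {
  dsize : T -> nat;
  represents : memory -> nat -> nat -> nat -> T -> Prop;
  represents_mono : forall m m' lo hi hi' w x,
    (forall i, lo <= i < hi -> m' i = m i) -> hi <= hi' ->
    represents m lo hi w x -> represents m' lo hi' w x;
  represents_word : forall m lo hi w x,
    represents m lo hi w x -> blen w <= dsize x + blen hi;
  dsize_gt0 : forall x, 0 < dsize x
}.

#[global, refine] Instance Data_nat : Data nat :=
  {| dsize := blen; represents := fun _ _ _ w x => w = x |}.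
Proof. by []. by move=> m lo hi w x ->; apply: leq_addr. by []. Defined.

#[global, refine] Instance Data_bool : Data bool :=
  {| dsize := fun=> 1; represents := fun _ _ _ w x => w = nat_of_bool x |}.
Proof. by []. by move=> m lo hi w [] ->. by []. Defined.

Section DataPair.
Context {A B : Type} {DA : Data A} {DB : Data B}.

Definition pair_represents m lo hi w (x : A * B) :=
  [/\ lo <= w, w.+1 < hi, represents m lo hi (m w) x.1
    & represents m lo hi (m w.+1) x.2].

#[global, refine] Instance Data_pair : Data (A * B) :=
  {| dsize := fun x => dsize x.1 + dsize x.2 + 1; represents := pair_represents |}.
Proof.
- move=> m m' lo hi hi' w x agree le_hi [lw wh ra rb]; split => //=; first lia.
    by rewrite agree; [apply: represents_mono ra | lia].
  by rewrite agree; [apply: represents_mono rb | lia].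
- by move=> m lo hi w x [lw wh _ _]; have := @leq_blen w hi; lia.
- by move=> x; rewrite addn1.
Defined.
End DataPair.

Section DataSeq.
Context {A : Type} {DA : Data A}.

Fixpoint seq_represents m lo hi w (s : seq A) : Prop :=
  if s is x :: s' then
    [/\ lo <= w, w.+1 < hi, 0 < w, represents m lo hi (m w) x
      & seq_represents m lo hi (m w.+1) s']
  else w = 0.

Definition seq_dsize (s : seq A) := foldr (fun x n => dsize x + n + 1) 1 s.

#[global, refine] Instance Data_seq : Data (seq A) :=
  {| dsize := seq_dsize; represents := seq_represents |}.
Proof.
- move=> m m' lo hi hi' w x agree le_hi; elim: x w => [|x s IH] w //= [lw wh w0 rx rs].
  have e1 : m' w = m w by apply: agree; lia.
  have e2 : m' w.+1 = m w.+1 by apply: agree; lia.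
  split=> //; first lia.
    by rewrite e1; apply: represents_mono rx.
  by rewrite e2; apply: IH.
- move=> m lo hi w [|x s] /=; first by move=> ->.
  by case=> lw wh _ _ _; have := @leq_blen w hi; lia.
- by case=> //= x s; rewrite addn1.
Defined.
End DataSeq.

(* Two types may share representations: a nonempty list is stored as the pair of
   its head and its tail. *)
Definition casts_to {A B : Type} {DA : Data A} {DB : Data B} (x : A) (y : B) : Prop :=
  dsize y <= dsize x /\
  forall m lo hi w, 0 < lo -> represents m lo hi w x -> represents m lo hi w y.

Lemma casts_to_refl {A : Type} {DA : Data A} (x : A) : casts_to x x.
Proof. by []. Qed.

Lemma casts_pair_cons {E : Type} {DE : Data E} (e : E) s : casts_to (e, s) (e :: s).
Proof. by split=> // m lo hi w lo0 [lw wh re rs]; split=> //; lia. Qed.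

Lemma casts_cons_pair {E : Type} {DE : Data E} (e : E) s : casts_to (e :: s) (e, s).
Proof. by split=> // m lo hi w lo0 [lw wh w0 re rs]. Qed.

Lemma casts_pair_snd {A B C : Type} {DA : Data A} {DB : Data B} {DC : Data C}
  (a : A) (b : B) (c : C) : casts_to b c -> casts_to (a, b) (a, c).
Proof.
case=> le_size cast; split=> /= [|m lo hi w lo0 [lw wh ra rb]];
  first by rewrite leq_add2r leq_add2l.
by split=> //=; apply: cast.
Qed.

(** * Execution within space and time bounds *)

(* Calling convention: register 0 is the heap pointer, register 1 is scratch, and
   code for frame [k] reads its argument from register [k], leaves its result
   there, and otherwise touches only registers above [k] and fresh heap cells. *)
Definition frame (k lo : nat) (m m' : memory) : Prop :=
  [/\ forall i, 2 <= i < k -> m' i = m i,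
      forall i, lo <= i < m 0 -> m' i = m i & m 0 <= m' 0].

Lemma frame_trans k lo m1 m2 m3 :
  frame k lo m1 m2 -> frame k lo m2 m3 -> frame k lo m1 m3.
Proof.
move=> [a1 b1 c1] [a2 b2 c2]; split; last lia.
  by move=> i ri; rewrite a2 // a1.
by move=> i ri; rewrite b2; [apply: b1 | lia].
Qed.

Lemma frame_le k k' lo m m' : k <= k' -> frame k' lo m m' -> frame k lo m m'.
Proof. by move=> le_k [agree ? ?]; split=> // i ri; apply: agree; lia. Qed.

Lemma frame_scratch k lo m v : 1 < lo -> frame k lo m (upd m 1 v).
Proof. by move=> lo_gt1; split=> // i ri; rewrite /upd ifF //; lia. Qed.

Section Holds.
Context {A : Type} {DA : Data A}.

Definition holds (lo r : nat) (x : A) (m : memory) : Prop :=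
  represents m lo (m 0) (m r) x.

Lemma frame_holds k lo m m' r (x : A) : frame k lo m m' -> 2 <= r < k ->
  holds lo r x m -> holds lo r x m'.
Proof.
by case=> regs heap heap_le r_k; rewrite /holds (regs r) //; apply: represents_mono.
Qed.

Lemma holds_scratch lo r (x : A) m v : 1 < lo -> 2 <= r ->
  holds lo r x m -> holds lo r x (upd m 1 v).
Proof.
by move=> lo_gt1 r_ge2; apply: (@frame_holds r.+1); [apply: frame_scratch | lia].
Qed.

Lemma holds_word lo r (x : A) m : holds lo r x m -> blen (m r) <= dsize x + blen (m 0).
Proof. exact: represents_word. Qed.
End Holds.

Definition runs (c : cmd) (k lo : nat) (m : memory) (h t : nat)
    (Q : memory -> Prop) : Prop :=
  exists m' t',
    [/\ exec c m m' t', frame k lo m m', m' 0 <= m 0 + h, t' <= t & Q m'].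

Lemma runs_le c k lo m h t h' t' Q : runs c k lo m h' t' Q ->
  h' <= h -> t' <= t -> runs c k lo m h t Q.
Proof.
by case=> m' [u [ex fr heap time Qm']] le_h le_t; exists m', u; split=> //; lia.
Qed.

Lemma runs_post c k k' lo m h t (Q Q' : memory -> Prop) : runs c k' lo m h t Q' ->
  k <= k' -> (forall m', frame k' lo m m' -> m' 0 <= m 0 + h -> Q' m' -> Q m') ->
  runs c k lo m h t Q.
Proof.
case=> m' [u [ex fr heap time Qm']] le_k post; exists m', u; split=> //.
  exact: frame_le fr.
exact: post.
Qed.

Lemma runs_seq c1 c2 k k1 lo m h1 t1 h2 t2 (Q1 Q : memory -> Prop) :
  runs c1 k1 lo m h1 t1 Q1 -> k <= k1 ->
  (forall m1, frame k1 lo m m1 -> m1 0 <= m 0 + h1 -> Q1 m1 ->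
     runs c2 k lo m1 h2 t2 Q) ->
  runs (Cseq c1 c2) k lo m (h1 + h2) (t1 + t2) Q.
Proof.
case=> m1 [u1 [ex1 fr1 heap1 time1 Qm1]] le_k run2.
have [m2 [u2 [ex2 fr2 heap2 time2 Qm2]]] := run2 _ fr1 heap1 Qm1.
exists m2, (u1 + u2); split=> //; try lia.
  exact: Exec_seq ex1 ex2.
exact: frame_trans (frame_le le_k fr1) fr2.
Qed.

Lemma runs_skip k lo m (Q : memory -> Prop) : Q m -> runs Cskip k lo m 0 0 Q.
Proof. by exists m, 0; split=> //; first exact: Exec_skip; rewrite addn0. Qed.

Lemma runs_if {B : Type} {DB : Data B} (b : bool) r c1 c2 k lo m h t (y : B) :
  1 < lo -> 2 <= k -> holds lo r b m ->
  runs (if b then c1 else c2) k lo m h t (holds lo k y) ->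
  runs (Cif r c1 c2) k lo m h (2 + blen r + t) (holds lo k y).
Proof.
rewrite /holds /= => lo1 k2; case: b => mr [m' [u [ex fr heap time hy]]].
  exists (upd m' 1 0), (1 + blen r + blen (m r) + u); split=> //.
  - by apply: Exec_then; rewrite ?mr.
  - by apply: frame_trans fr _; apply: frame_scratch.
  - by rewrite mr blen1; lia.
  - exact: holds_scratch.
exists m', (1 + blen r + blen (m r) + u); split=> //; first exact: Exec_else.
by rewrite mr blen0; lia.
Qed.

Lemma runs_stop r c k lo m (Q : memory -> Prop) : m r = 0 -> Q m ->
  runs (Cwhile r c) k lo m 0 (2 + blen r) Q.
Proof.
move=> mr Qm; exists m, (1 + blen r + blen (m r)); split=> //.
- exact: Exec_stop.
- by rewrite addn0.
- by rewrite mr blen0; lia.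
Qed.

Lemma runs_loop r c k lo m h1 t1 h2 t2 (Q1 Q : memory -> Prop) :
  1 < lo -> m r != 0 -> runs c k lo m h1 t1 Q1 ->
  (forall m1, frame k lo m (upd m1 1 0) -> m1 0 <= m 0 + h1 -> Q1 m1 ->
     runs (Cwhile r c) k lo (upd m1 1 0) h2 t2 Q) ->
  runs (Cwhile r c) k lo m (h1 + h2) (1 + blen r + blen (m r) + t1 + t2) Q.
Proof.
move=> lo1 mr [m1 [u1 [ex1 fr1 heap1 time1 Qm1]]] run2.
have fr1' : frame k lo m (upd m1 1 0) := frame_trans fr1 (frame_scratch _ _ _ lo1).
have [m2 [u2 [ex2 fr2 heap2 time2 Qm2]]] := run2 _ fr1' heap1 Qm1.
exists m2, (1 + blen r + blen (m r) + u1 + u2); split=> //; try lia.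
- exact: Exec_loop ex1 ex2.
- exact: frame_trans fr1' fr2.
- by move: heap2; rewrite {1}/upd /=; lia.
Qed.

Definition block (s : seq instr) : cmd := foldr (fun i => Cseq (Cbasic i)) Cskip s.

Fixpoint block_effect (s : seq instr) (m : memory) : memory * nat :=
  if s is i :: s' then
    let r := block_effect s' (effect i m).1 in (r.1, (effect i m).2 + r.2)
  else (m, 0).

Lemma exec_block s m : all basic s ->
  exec (block s) m (block_effect s m).1 (block_effect s m).2.
Proof.
elim: s m => [|i s IH] m /=; first by move=> _; apply: Exec_skip.
by case/andP=> basic_i basic_s; apply: Exec_seq (Exec_basic _ _) (IH _ _).
Qed.

Lemma runs_block s k lo m h t (Q : memory -> Prop) : all basic s ->
  let r := block_effect s m in
  frame k lo m r.1 -> r.1 0 <= m 0 + h -> r.2 <= t -> Q r.1 ->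
  runs (block s) k lo m h t Q.
Proof. by move=> basic_s r; exists r.1, r.2; split=> //; apply: exec_block. Qed.

Lemma updE m r v i : upd m r v i = if i == r then v else m i.
Proof. by []. Qed.

Ltac simpl_upd := rewrite /= ?updE; repeat
  match goal with
  | |- context [?a == ?b :> nat] =>
      first [ rewrite (_ : (a == b) = true); last by lia
            | rewrite (_ : (a == b) = false); last by lia ]
  end.

Definition copy (r a : nat) : cmd := block [:: Iconst 1 0; Iadd r a 1].

Definition alloc (r a b : nat) : cmd :=
  block [:: Istore 0 a; Iconst 1 1; Iadd 0 0 1; Istore 0 b; Isub r 0 1; Iadd 0 0 1].

Lemma runs_copy {A : Type} {DA : Data A} r a lo m (x : A) n :
  2 <= r < lo -> 2 <= a < lo -> lo <= m 0 -> holds lo a x m ->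
  dsize x + blen (m 0) <= n -> runs (copy r a) r lo m 0 (10 + 3 * n) (holds lo r x).
Proof.
move=> r_lo a_lo lom hx budget; have wx := holds_word hx.
have fr : frame r lo m (block_effect [:: Iconst 1 0; Iadd r a 1] m).1.
  by split; [move=> i ? | move=> i ? |]; simpl_upd.
apply: runs_block => //.
- by simpl_upd; rewrite addn0.
- simpl_upd; rewrite blen0 blen1.
  by have := @leq_blen r (m 0); have := @leq_blen a (m 0); lia.
case: fr => _ heap heap_le; move: hx; rewrite /holds; set m' := _.1 in heap heap_le *.
have -> : m' r = m a by rewrite /m'; simpl_upd; rewrite addn0.
exact: represents_mono.
Qed.

Lemma runs_alloc {A B : Type} {DA : Data A} {DB : Data B} r a b lo m (x : A) (y : B) n :
  2 <= r < lo -> 2 <= a < lo -> 2 <= b < lo -> lo <= m 0 ->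
  holds lo a x m -> holds lo b y m -> dsize x + dsize y + blen (m 0) <= n ->
  runs (alloc r a b) r lo m 2 (30 + 14 * n) (holds lo r (x, y)).
Proof.
move=> r_lo a_lo b_lo lom hx hy budget; have wx := holds_word hx;
have wy := holds_word hy.
set s := [:: Istore 0 a; Iconst 1 1; Iadd 0 0 1; Istore 0 b; Isub r 0 1; Iadd 0 0 1].
have fr : frame r lo m (block_effect s m).1.
  by split; [move=> i ? | move=> i ? |]; simpl_upd; lia.
apply: runs_block => //.
- by simpl_upd; lia.
- simpl_upd; have := @leq_blen r (m 0); have := @leq_blen a (m 0);
  have := @leq_blen b (m 0).
  have := blenD (m 0) 1; have := blenD (m 0 + 1) 1; rewrite blen1 blen0; lia.
case: fr => _ heap heap_le; move: hx hy; rewrite /holds; set m' := _.1 in heap heap_le *.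
have [-> m'0 w1 w2] : [/\ m' r = m 0, m' 0 = (m 0).+2, m' (m 0) = m a
    & m' (m 0).+1 = m b] by split; rewrite /m'; simpl_upd; lia.
move=> hx hy; split; rewrite ?w1 ?w2 ?m'0 //; rewrite -m'0.
  exact: represents_mono hx.
exact: represents_mono hy.
Qed.

(** * Polynomial-time computable functions *)

(* The heap grows by a function of the argument alone, whereas the time may
   depend on the length of addresses; this is what makes loops composable. *)
Definition computes {A B : Type} {DA : Data A} {DB : Data B} (f : A -> B) (nr : nat)
    (code : nat -> cmd) (H T : nat -> nat) : Prop :=
  forall k lo m x n, 2 <= k -> k + nr <= lo -> lo <= m 0 ->
    holds lo k x m -> dsize x + blen (m 0) <= n ->
  runs (code k) k lo m (H (dsize x)) (T n) (holds lo k (f x)).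

Definition FP {A B : Type} {DA : Data A} {DB : Data B} (f : A -> B) : Prop :=
  exists nr code P, [/\ poly_bounded P, computes f nr code P P
                      & forall x, dsize (f x) <= P (dsize x)].

Lemma fp_intro {A B : Type} {DA : Data A} {DB : Data B} (f : A -> B) nr code H T S :
  poly_bounded H -> poly_bounded T -> poly_bounded S ->
  computes f nr code H T -> (forall x, dsize (f x) <= S (dsize x)) -> FP f.
Proof.
move=> polyH polyT polyS comp_f size_f; exists nr, code, (fun n => H n + T n + S n).
split=> [|k lo m x n k2 lek lom hx budget|x]; first by poly.
  by apply: runs_le (comp_f _ _ _ _ n k2 lek lom hx budget) _ _; lia.
by apply: leq_trans (size_f x) _; lia.
Qed.

Lemma fp_ext {A B : Type} {DA : Data A} {DB : Data B} (f g : A -> B) :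
  f =1 g -> FP f -> FP g.
Proof.
move=> fg [nr [code [P [polyP comp_f size_f]]]]; exists nr, code, P.
by split=> // [k lo m x n|x]; rewrite -fg //; apply: comp_f.
Qed.

Lemma fp_size_bound {A B : Type} {DA : Data A} {DB : Data B} (f : A -> B) :
  FP f -> exists2 P, poly_bounded P & forall x, dsize (f x) <= P (dsize x).
Proof. by case=> _ [_ [P [polyP _ size_f]]]; exists P. Qed.

Lemma blen_heap (m m1 : memory) h : m1 0 <= m 0 + h -> blen (m1 0) <= blen (m 0) + h.+1.
Proof. by move=> heap_le; apply: leq_trans (leq_blen heap_le) (blen_add_leS _ _). Qed.

(** ** Composition, pairing, branching and iteration *)

Section Sequencing.
Context {A B C : Type} {DA : Data A} {DB : Data B} {DC : Data C}.

Lemma fp_cast (f : A -> B) : (forall x, casts_to x (f x)) -> FP f.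
Proof.
move=> cast; apply: (@fp_intro _ _ _ _ f 0 (fun=> Cskip) (fun=> 0) (fun=> 0) id);
  [by poly..| |by move=> x; case: (cast x)].
move=> k lo m x n k2 lek lom hx budget; apply: runs_skip.
by case: (cast x) => _; apply=> //; lia.
Qed.

Lemma fp_comp (f : A -> B) (g : B -> C) : FP f -> FP g -> FP (fun x => g (f x)).
Proof.
move=> [nf [cf [P [polyP comp_f size_f]]]] [ng [cg [Q [polyQ comp_g size_g]]]].
apply: (@fp_intro _ _ _ _ _ (maxn nf ng) (fun k => Cseq (cf k) (cg k))
  (fun s => P s + Q (P s)) (fun n => P n + Q (n + 2 * P n + 1)) (fun s => Q (P s)));
    [by poly..| |by move=> x; apply: leq_trans (size_g _) (polyQ.1 _ _ (size_f x))].
move=> k lo m x n k2 lek lom hx budget.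
have P_n : P (dsize x) <= P n by apply: polyP.1; lia.
have size_fx := size_f x.
have knf : k + nf <= lo by lia.
apply: runs_le (runs_seq (comp_f k lo m x n k2 knf lom hx budget) (leqnn k) _)
  (_ : P _ + Q _ <= _) _ => [m1 fr1 heap1 hold1||].
- have blen1 := blen_heap heap1.
  by apply: (comp_g _ _ _ _ (n + 2 * P n + 1)) hold1 _; case: fr1; lia.
- by rewrite leq_add2l polyQ.1.
- lia.
Qed.

Lemma fp_pair (f : A -> B) (g : A -> C) :
  FP f -> FP g -> FP (fun x => (f x, g x)).
Proof.
move=> [nf [cf [P [polyP comp_f size_f]]]] [ng [cg [Q [polyQ comp_g size_g]]]].
apply: (@fp_intro _ _ _ _ _ (nf + ng + 4)
  (fun k => Cseq (copy k.+1 k) (Cseq (cf k.+1) (Cseq (copy k.+2 k)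
     (Cseq (cg k.+2) (alloc k k.+1 k.+2)))))
  (fun s => 0 + (P s + (0 + (Q s + 2))))
  (fun n => 10 + 3 * n + (P n + (10 + 3 * (n + P n + 1) + (Q (n + P n + 1) +
     (30 + 14 * (n + 2 * P n + 2 * Q n + 2))))))
  (fun s => P s + Q s + 1)); [by poly..| |]; last first.
  by move=> x /=; have := size_f x; have := size_g x; lia.
move=> k lo m x n k2 lek lom hx budget; set s := dsize x.
have le_s : s <= n by lia.
have P_s := polyP.1 _ _ le_s; have Q_s := polyQ.1 _ _ le_s.
apply: runs_seq (leqnSn k) _; first by apply: runs_copy hx budget; lia.
move=> m1 fr1; rewrite addn0 => heap1 hold1; have blen1 := leq_blen heap1.
have hx1 : holds lo k x m1 by apply: frame_holds fr1 _ hx; lia.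
have lom1 : lo <= m1 0 by case: fr1; lia.
apply: runs_seq (leqnSn k) _; first by apply: (comp_f _ _ _ _ n) hold1 _; lia.
move=> m2 fr2 heap2 hold2; have blen2 := blen_heap heap2.
have hx2 : holds lo k x m2 by apply: frame_holds fr2 _ hx1; lia.
have lom2 : lo <= m2 0 by case: fr2; lia.
apply: runs_seq (leqW (leqnSn k)) _;
  first by apply: (runs_copy (n := n + P n + 1)) hx2 _; lia.
move=> m3 fr3; rewrite addn0 => heap3 hold3; have blen3 := leq_blen heap3.
have hf3 : holds lo k.+1 (f x) m3 by apply: frame_holds fr3 _ hold2; lia.
have lom3 : lo <= m3 0 by case: fr3; lia.
apply: runs_seq (leqW (leqnSn k)) _;
  first by apply: (comp_g _ _ _ _ (n + P n + 1)) hold3 _; lia.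
move=> m4 fr4 heap4 hold4; have blen4 := blen_heap heap4.
have hf4 : holds lo k.+1 (f x) m4 by apply: frame_holds fr4 _ hf3; lia.
have lom4 : lo <= m4 0 by case: fr4; lia.
have size_fx : dsize (f x) <= P s := size_f x.
have size_gx : dsize (g x) <= Q s := size_g x.
by apply: (runs_alloc (n := n + 2 * P n + 2 * Q n + 2)) hf4 hold4 _; lia.
Qed.
End Sequencing.

Section Branching.
Context {A A1 A2 B : Type} {DA : Data A} {DA1 : Data A1} {DA2 : Data A2} {DB : Data B}.

Definition test (code : nat -> cmd) (k : nat) : cmd := Cseq (copy k.+1 k) (code k.+1).

Lemma runs_test (c : A -> bool) nc cc R k lo m x n : computes c nc cc R R ->
  2 <= k -> k + nc + 1 < lo -> lo <= m 0 -> holds lo k x m -> dsize x + blen (m 0) <= n ->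
  runs (test cc k) k.+1 lo m (R (dsize x)) (10 + 3 * n + R n) (holds lo k.+1 (c x)).
Proof.
move=> comp_c k2 lek lom hx budget.
apply: (@runs_le _ _ _ _ _ _ (0 + R (dsize x)) (10 + 3 * n + R n)) => //.
apply: runs_seq (leqnn _) _; first by apply: runs_copy hx budget; lia.
move=> m1 fr1; rewrite addn0 => heap1 hold1; have blen1 := leq_blen heap1.
by apply: (comp_c _ _ _ _ n) hold1 _; case: fr1; lia.
Qed.

Lemma fp_branch (c : A -> bool) (F : A -> B) (f : A1 -> B) (g : A2 -> B) :
  FP c -> FP f -> FP g ->
  (forall x, if c x then exists2 y, casts_to x y & F x = f y
             else exists2 y, casts_to x y & F x = g y) -> FP F.
Proof.
move=> [nc [cc [R [polyR comp_c _]]]] [nf [cf [P [polyP comp_f size_f]]]].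
move=> [ng [cg [Q [polyQ comp_g size_g]]]] case_x.
apply: (@fp_intro _ _ _ _ _ (nc + nf + ng + 4)
  (fun k => Cseq (test cc k) (Cif k.+1 (cf k) (cg k)))
  (fun s => R s + (P s + Q s))
  (fun n => (10 + 3 * n + R n) + (2 + (n + R n + 1) +
      (P (n + R n + 1) + Q (n + R n + 1))))
  (fun s => P s + Q s)); [by poly..| |]; last first.
  move=> x; have := case_x x; case: (c x) => -[y [le_y _] ->].
    by have := size_f y; have := polyP.1 _ _ le_y; lia.
  by have := size_g y; have := polyQ.1 _ _ le_y; lia.
move=> k lo m x n k2 lek lom hx budget.
have le_n : dsize x <= n by lia.
have R_n := polyR.1 _ _ le_n.
apply: runs_seq (leqnSn k) _; first by apply: (runs_test comp_c k2 _ lom hx budget); lia.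
move=> m1 fr1 heap1 hold1; have blen1 := blen_heap heap1.
have hx1 : holds lo k x m1 by apply: frame_holds fr1 _ hx; lia.
have lom1 : lo <= m1 0 by case: fr1; lia.
have blen_k : blen k.+1 <= blen (m1 0) by apply: leq_blen; lia.
apply: (@runs_le _ _ _ _ _ _ (P (dsize x) + Q (dsize x))
  (2 + blen k.+1 + (P (n + R n + 1) + Q (n + R n + 1)))) => //; last lia.
apply: runs_if hold1 _; [lia | lia |].
have lo0 : 0 < lo by lia.
have := case_x x; case: (c x) => -[y [le_y cast] ->].
- have P_y := polyP.1 _ _ le_y; have hy : holds lo k y m1 by apply: cast.
  by apply: runs_le (comp_f k lo m1 y (n + R n + 1) k2 _ lom1 hy _) _ _; lia.
- have Q_y := polyQ.1 _ _ le_y; have hy : holds lo k y m1 by apply: cast.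
  by apply: runs_le (comp_g k lo m1 y (n + R n + 1) k2 _ lom1 hy _) _ _; lia.
Qed.
End Branching.

Lemma fp_if {A B : Type} {DA : Data A} {DB : Data B} (c : A -> bool) (f g : A -> B) :
  FP c -> FP f -> FP g -> FP (fun x => if c x then f x else g x).
Proof.
move=> fp_c fp_f fp_g; apply: fp_branch fp_c fp_f fp_g _ => x.
by case: (c x); exists x => //; apply: casts_to_refl.
Qed.

Section Iteration.
Context {X S : Type} {DX : Data X} {DS : Data S}.

Definition while_code (cc cg : nat -> cmd) (k : nat) : cmd :=
  Cwhile k.+1 (Cseq (cg k) (test cc k)).

Lemma runs_while (c : S -> bool) (g : S -> S) nc cc R ng cg P k lo q b :
  poly_bounded R -> poly_bounded P -> computes c nc cc R R -> computes g ng cg P P ->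
  2 <= k -> k + nc + ng + 1 < lo -> forall j a m, lo <= m 0 ->
  (forall i, i <= j -> c (iter i g a) = (i < j)) ->
  (forall i, i <= j -> dsize (iter i g a) <= q) ->
  holds lo k a m -> holds lo k.+1 (c a) m -> q + blen (m 0 + j * (P q + R q)) <= b ->
  runs (while_code cc cg k) k lo m (j * (P q + R q))
    (j.+1 * (2 + b + P b + (10 + 3 * b + R b))) (holds lo k (iter j g a)).
Proof.
move=> polyR polyP comp_c comp_g k2 lek.
elim=> [|j IH] a m lom guard size_q ha hc budget.
  have := guard 0 isT => /= guard0; rewrite /holds guard0 in hc.
  have blen_k : blen k.+1 <= blen (m 0) by apply: leq_blen; lia.
  apply: (@runs_le _ _ _ _ _ _ 0 (2 + blen k.+1)) => //;
    last by rewrite mul0n addn0 in budget; lia.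
  exact: runs_stop.
have guard0 : c a = true := guard 0 isT.
have mk1 : m k.+1 = 1 by move: hc; rewrite /holds guard0.
have q_a : dsize a <= q := size_q 0 isT.
have q_ga : dsize (g a) <= q := size_q 1 isT.
have P_a := polyP.1 _ _ q_a; have R_ga := polyR.1 _ _ q_ga.
have le_b : forall h, h <= j.+1 * (P q + R q) -> q + blen (m 0 + h) <= b.
  move=> h le_h; apply: leq_trans budget; rewrite leq_add2l; apply: leq_blen; lia.
have := le_b 0 isT; rewrite addn0 => b0.
have blen_k : blen k.+1 <= blen (m 0) by apply: leq_blen; lia.
apply: (@runs_le _ _ _ _ _ _ ((P (dsize a) + R (dsize (g a))) + j * (P q + R q))
  (1 + blen k.+1 + blen (m k.+1) + (P b + (10 + 3 * b + R b)) +
     j.+1 * (2 + b + P b + (10 + 3 * b + R b)))); [|lia|by rewrite mk1 blen1 mulSn; lia].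
rewrite iterSr.
apply: (runs_loop (Q1 := fun m' => holds lo k (g a) m' /\ holds lo k.+1 (c (g a)) m'));
  [lia | by rewrite mk1 | |].
  apply: runs_seq (leqnn k) _; first by apply: (comp_g _ _ _ _ b) ha _; lia.
  move=> m1 fr1 heap1 hold1.
  have b1 : q + blen (m 0 + P (dsize a)) <= b by apply: le_b; rewrite mulSn; lia.
  have blen1 := leq_blen heap1.
  apply: runs_post _ (leqnSn k) _.
    by apply: (runs_test (n := b) comp_c k2 _ _ hold1); case: fr1; lia.
  by move=> m2 fr2 _ hold2; split=> //; apply: frame_holds fr2 _ hold1; lia.
move=> m1 fr1 heap1 [hg hcg].
apply: IH => [|i le_i|i le_i|||].
- by case: fr1; lia.
- by rewrite -iterSr guard.
- by rewrite -iterSr size_q.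
- by apply: holds_scratch hg; lia.
- by apply: holds_scratch hcg; lia.
- apply: leq_trans budget; rewrite leq_add2l /upd /= mulSn; apply: leq_blen; lia.
Qed.

(* The test is required to fail exactly at the last of the iterates, and all
   iterates have to be of polynomial size. *)
Lemma fp_while (i : X -> S) (c : S -> bool) (g : S -> S) (f : X -> S) N Q :
  FP i -> FP c -> FP g -> poly_bounded N -> poly_bounded Q ->
  (forall x, exists n,
     [/\ n <= N (dsize x), f x = iter n g (i x),
         forall j, j <= n -> c (iter j g (i x)) = (j < n)
       & forall j, j <= n -> dsize (iter j g (i x)) <= Q (dsize x)]) ->
  FP f.
Proof.
move=> [ni [ci [I [polyI comp_i size_i]]]] [nc [cc [R [polyR comp_c _]]]].
move=> [ng [cg [P [polyP comp_g _]]]] polyN polyQ iterates.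
pose grow s := I s + (R (Q s) + N s * (P (Q s) + R (Q s))).
pose peak n := n + Q n + grow n + 2.
pose time b := 2 + b + P b + (10 + 3 * b + R b).
apply: (@fp_intro _ _ _ _ _ (ni + nc + ng + 2)
  (fun k => Cseq (ci k) (Cseq (test cc k) (while_code cc cg k)))
  grow (fun n => I n + ((10 + 3 * peak n + R (peak n)) + (N n).+1 * time (peak n))) Q);
    [by rewrite /time /peak /grow; poly..| |]; last first.
  by move=> x; have [n [_ -> _ sizes]] := iterates x; apply: sizes.
move=> k lo m x b k2 lek lom hx budget; have [n [le_n -> guard sizes]] := iterates x.
set s := dsize x in budget le_n sizes *; have le_s : s <= b by lia.
have peak_s : peak s <= peak b.
  have poly_peak : poly_bounded peak by rewrite /peak /grow; poly.
  exact: poly_peak.1.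
have size0 : dsize (i x) <= Q s := sizes 0 (leq0n n).
have R_i := polyR.1 _ _ size0; have N_s := polyN.1 _ _ le_s.
have loops : n * (P (Q s) + R (Q s)) <= N s * (P (Q s) + R (Q s))
  by rewrite leq_mul2r le_n orbT.
have in_peak h : h <= grow s -> Q s + blen (m 0 + h) <= peak b.
  move=> le_h; have := blen_add_leS (m 0) h.
  have poly_Q := polyQ.1 _ _ le_s.
  have poly_grow : grow s <= grow b by apply: (_ : poly_bounded grow).1 => //;
    rewrite /grow; poly.
  by rewrite /peak; lia.
apply: (@runs_le _ _ _ _ _ _ (I s + (R (dsize (i x)) + n * (P (Q s) + R (Q s))))
  (I b + ((10 + 3 * peak b + R (peak b)) + n.+1 * time (peak b)))).
- apply: runs_seq (leqnn k) _; first by apply: comp_i hx budget; lia.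
  move=> m1 fr1 heap1 hold1; have := in_peak (I s); have := leq_blen heap1.
  move=> blen1 peak1; have lom1 : lo <= m1 0 by case: fr1; lia.
  apply: runs_seq (leqnSn k) _.
    by apply: (runs_test (n := peak b) comp_c k2 _ lom1 hold1);
      rewrite /grow in peak1; lia.
  move=> m2 fr2 heap2 hold2; have hold_i : holds lo k (i x) m2
    by apply: frame_holds fr2 _ hold1; lia.
  apply: (runs_while polyR polyP comp_c comp_g) hold_i hold2 _;
    [lia|lia|by case: fr2; lia|exact: guard|exact: sizes|].
  have le_h : I s + R (Q s) + n * (P (Q s) + R (Q s)) <= grow s by rewrite /grow; lia.
  apply: leq_trans (in_peak _ le_h); rewrite leq_add2l; apply: leq_blen; lia.
- by rewrite /grow; lia.
- by rewrite leq_add2l leq_add2l leq_mul2r ltnS (leq_trans le_n N_s) orbT.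
Qed.
End Iteration.

(** ** Primitive functions *)

Lemma fp_block {A B : Type} {DA : Data A} {DB : Data B} (f : A -> B) nr
    (s : nat -> seq instr) T S :
  poly_bounded T -> poly_bounded S -> (forall k, all basic (s k)) ->
  (forall k lo m x, 2 <= k -> k + nr <= lo -> lo <= m 0 -> holds lo k x m ->
     let r := block_effect (s k) m in
     [/\ forall i, 2 <= i -> (i < k) || (lo <= i) -> r.1 i = m i,
         r.1 0 = m 0, represents m lo (m 0) (r.1 k) (f x)
       & r.2 <= T (dsize x + blen (m 0))]) ->
  (forall x, dsize (f x) <= S (dsize x)) -> FP f.
Proof.
move=> polyT polyS basic_s spec size_f.
apply: (@fp_intro _ _ _ _ f nr (fun k => block (s k)) (fun=> 0) T S) => //; first by poly.
move=> k lo m x n k2 lek lom hx budget.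
have [agree heap repr time] := spec k lo m x k2 lek lom hx.
have fr : frame k lo m (block_effect (s k) m).1.
  split; last by rewrite heap.
    by move=> i ri; apply: agree; lia.
  by move=> i ri; apply: agree; lia.
apply: runs_block => //; first by rewrite heap addn0.
  exact: leq_trans time (polyT.1 _ _ budget).
by case: fr => _ same heap_le; apply: represents_mono repr.
Qed.

Lemma fp_const {A B : Type} {DA : Data A} {DB : Data B} (y : B) n :
  (forall m lo hi, represents m lo hi n y) -> FP (fun _ : A => y).
Proof.
move=> repr; apply: (@fp_block _ _ _ _ _ 1 (fun k => [:: Iconst k n])
  (fun s => s + 1 + blen n) (fun=> dsize y)) => //; [by poly | by poly |].
move=> k lo m x k2 lek lom hx; split=> //=.
- by move=> i i2 ri; simpl_upd.
- by simpl_upd.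
- by simpl_upd.
- by have := @leq_blen k (m 0); lia.
Qed.

Lemma fp_nat {A : Type} {DA : Data A} (n : nat) : FP (fun _ : A => n).
Proof. exact: (@fp_const _ _ _ _ n n). Qed.

Lemma fp_bool {A : Type} {DA : Data A} (b : bool) : FP (fun _ : A => b).
Proof. exact: (@fp_const _ _ _ _ b b). Qed.

Lemma fp_nil {A B : Type} {DA : Data A} {DB : Data B} : FP (fun _ : A => [::] : seq B).
Proof. exact: (@fp_const _ _ _ _ [::] 0). Qed.

Lemma fp_id {A : Type} {DA : Data A} : FP (fun x : A => x).
Proof. by apply: fp_cast => x; apply: casts_to_refl. Qed.

Lemma fp_cons {A : Type} {DA : Data A} : FP (fun p : A * seq A => p.1 :: p.2).
Proof. by apply: fp_cast => -[x s]; apply: casts_pair_cons. Qed.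

Section Projections.
Context {A B : Type} {DA : Data A} {DB : Data B}.

Lemma fp_fst : FP (fun p : A * B => p.1).
Proof.
apply: (@fp_block _ _ _ _ _ 1 (fun k => [:: Iload k k]) (fun n => 10 * n.+1) id) => //;
  [by poly | by poly | |by move=> x /=; lia].
move=> k lo m x k2 lek lom [lw wh ra rb]; split=> //=.
- by move=> i i2 ri; simpl_upd.
- by simpl_upd.
- by simpl_upd.
have := @leq_blen k (m 0); have := @leq_blen (m k) (m 0); have := represents_word ra; lia.
Qed.

Lemma fp_snd : FP (fun p : A * B => p.2).
Proof.
apply: (@fp_block _ _ _ _ _ 1 (fun k => [:: Iconst 1 1; Iadd k k 1; Iload k k])
  (fun n => 20 * n.+1) id) => //; [by poly | by poly | |by move=> x /=; lia].
move=> k lo m x k2 lek lom [lw wh ra rb]; split=> //=.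
- by move=> i i2 ri; simpl_upd.
- by simpl_upd.
- by simpl_upd; rewrite addn1; simpl_upd.
simpl_upd; rewrite !addn1; simpl_upd.
have := @leq_blen k (m 0); have := @leq_blen (m k) (m 0); have := represents_word rb.
have := @leq_blen (m k).+1 (m 0); rewrite ?blen1; lia.
Qed.
End Projections.

Lemma fp_word_eq0 {A : Type} {DA : Data A} (c : A -> bool) :
  (forall m lo hi w x, 0 < lo -> represents m lo hi w x -> c x = (w == 0)) -> FP c.
Proof.
move=> word_eq0; apply: (@fp_block _ _ _ _ _ 1 (fun k => [:: Iconst 1 1; Isub k 1 k])
  (fun n => 20 * n.+1) (fun=> 1)) => //; [by poly | by poly |].
move=> k lo m x k2 lek lom hx; have wx := holds_word hx; split=> //=.
- by move=> i i2 ri; simpl_upd.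
- by simpl_upd.
- simpl_upd; rewrite (word_eq0 _ _ _ _ _ _ hx); last lia.
  by case: (m k) => // w; lia.
by simpl_upd; have := @leq_blen k (m 0); rewrite ?blen1; lia.
Qed.

Lemma fp_eq0 : FP (fun n : nat => n == 0).
Proof. by apply: fp_word_eq0 => m lo hi w n _ ->. Qed.

Lemma fp_nilp {A : Type} {DA : Data A} : FP (@nilp A).
Proof.
apply: fp_word_eq0 => m lo hi w [|x s] _ /=; first by move=> ->.
by case=> _ _ w0 _ _; case: w w0.
Qed.

Lemma fp_instr (op : nat -> nat -> nat) (I : nat -> nat -> nat -> instr) :
  (forall r a b, basic (I r a b)) ->
  (forall r a b m, effect (I r a b) m = (upd m r (op (m a) (m b)),
     1 + blen r + blen a + blen b + blen (m a) + blen (m b))) ->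
  (forall a b, blen (op a b) <= blen a + blen b) ->
  FP (fun p : nat * nat => op p.1 p.2).
Proof.
move=> basic_I effect_I size_op.
apply: (@fp_block _ _ _ _ _ 2
  (fun k => [:: Iload k.+1 k; Iconst 1 1; Iadd k k 1; Iload k k; I k k.+1 k])
  (fun n => 60 * n.+1) id) => //; [by poly | by poly | | |].
- by move=> k /=; rewrite basic_I.
- move=> k lo m x k2 lek lom [lw wh /= ra rb]; rewrite /= effect_I /=; split=> //.
  + by move=> i i2 ri; simpl_upd.
  + by simpl_upd.
  + by simpl_upd; rewrite addn1; simpl_upd; rewrite ra rb.
  + simpl_upd; rewrite !addn1; simpl_upd; rewrite -ra -rb.
    have := @leq_blen k (m 0); have := @leq_blen (m k) (m 0).
    have := @leq_blen k.+1 (m 0); have := @leq_blen (m k).+1 (m 0); rewrite ?blen1; lia.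
- by move=> x; apply: leq_trans (size_op _ _) _ => /=; lia.
Qed.

Lemma fp_addn : FP (fun p : nat * nat => p.1 + p.2).
Proof. by apply: (@fp_instr addn Iadd) => // a b; apply: blenD. Qed.

Lemma fp_subn : FP (fun p : nat * nat => p.1 - p.2).
Proof.
apply: (@fp_instr subn Isub) => // a b.
by apply: leq_trans (leq_blen (leq_subr _ _)) _; apply: leq_addr.
Qed.

Lemma fp_muln : FP (fun p : nat * nat => p.1 * p.2).
Proof. by apply: (@fp_instr muln Imul) => // a b; apply: blenM. Qed.

Lemma fp_divn : FP (fun p : nat * nat => p.1 %/ p.2).
Proof.
apply: (@fp_instr divn Idiv) => // a b.
by apply: leq_trans (leq_blen (leq_div _ _)) _; apply: leq_addr.
Qed.

(** ** Closure under application *)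

Section Application.
Context {X A B C D E : Type} {DX : Data X} {DA : Data A} {DB : Data B}
  {DC : Data C} {DD : Data D} {DE : Data E}.

Lemma fp_app (F : A -> B) (f : X -> A) : FP F -> FP f -> FP (fun x => F (f x)).
Proof. by move=> fp_F fp_f; apply: fp_comp. Qed.

Lemma fp_app2 (F : A -> B -> C) (f : X -> A) (g : X -> B) :
  FP (fun p : A * B => F p.1 p.2) -> FP f -> FP g -> FP (fun x => F (f x) (g x)).
Proof.
by move=> fp_F fp_f fp_g; apply: (fp_comp (fp_pair fp_f fp_g) fp_F).
Qed.

Lemma fp_app3 (F : A -> B -> C -> D) (f : X -> A) (g : X -> B) (h : X -> C) :
  FP (fun p : A * (B * C) => F p.1 p.2.1 p.2.2) -> FP f -> FP g -> FP h ->
  FP (fun x => F (f x) (g x) (h x)).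
Proof.
move=> fp_F fp_f fp_g fp_h.
exact: (fp_comp (fp_pair fp_f (fp_pair fp_g fp_h)) fp_F).
Qed.

Lemma fp_app4 (F : A -> B -> C -> D -> E) (f : X -> A) (g : X -> B) (h : X -> C)
    (k : X -> D) :
  FP (fun p : A * (B * (C * D)) => F p.1 p.2.1 p.2.2.1 p.2.2.2) ->
  FP f -> FP g -> FP h -> FP k -> FP (fun x => F (f x) (g x) (h x) (k x)).
Proof.
move=> fp_F fp_f fp_g fp_h fp_k.
exact: (fp_comp (fp_pair fp_f (fp_pair fp_g (fp_pair fp_h fp_k))) fp_F).
Qed.

Lemma fp_app5 {G : Type} {DG : Data G} (F : A -> B -> C -> D -> E -> G) (f : X -> A)
    (g : X -> B) (h : X -> C) (k : X -> D) (l : X -> E) :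
  FP (fun p : A * (B * (C * (D * E))) => F p.1 p.2.1 p.2.2.1 p.2.2.2.1 p.2.2.2.2) ->
  FP f -> FP g -> FP h -> FP k -> FP l ->
  FP (fun x => F (f x) (g x) (h x) (k x) (l x)).
Proof.
move=> fp_F fp_f fp_g fp_h fp_k fp_l.
exact: (fp_comp (fp_pair fp_f (fp_pair fp_g (fp_pair fp_h (fp_pair fp_k fp_l)))) fp_F).
Qed.
End Application.

Create HintDb fpdb.
#[global] Hint Resolve fp_nat fp_bool fp_nil fp_id fp_cons fp_fst fp_snd fp_eq0 fp_nilp
  fp_addn fp_subn fp_muln fp_divn : fpdb.

(* [fp] decomposes a function into applications of functions registered in
   [fpdb], each in uncurried form; higher-order functions are handled by the
   extensible [fp_higher_order]. *)
Ltac fp_higher_order := fail.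

Ltac fp := cbv beta;
  first
  [ solve [auto with fpdb nocore]
  | fp_higher_order
  | lazymatch goal with
    | |- FP (fun x => (@?f x, @?g x)) => refine (fp_pair (f := f) (g := g) _ _); fp
    end
  | lazymatch goal with
    | |- FP (fun x => ?F (@?f x)) =>
      refine (fp_app (F := F) (f := f) _ _);
        [solve [auto with fpdb nocore] | fp]
    end
  | lazymatch goal with
    | |- FP (fun x => ?F (@?f x) (@?g x)) =>
      refine (fp_app2 (F := F) (f := f) (g := g) _ _ _);
        [solve [auto with fpdb nocore] | fp | fp]
    end
  | lazymatch goal with
    | |- FP (fun x => ?F (@?f x) (@?g x) (@?h x)) =>
      refine (fp_app3 (F := F) (f := f) (g := g) (h := h) _ _ _ _);
        [solve [auto with fpdb nocore] | fp | fp | fp]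
    end
  | lazymatch goal with
    | |- FP (fun x => ?F (@?f x) (@?g x) (@?h x) (@?k x)) =>
      refine (fp_app4 (F := F) (f := f) (g := g) (h := h) (k := k) _ _ _ _ _);
        [solve [auto with fpdb nocore] | fp | fp | fp | fp]
    end
  | lazymatch goal with
    | |- FP (fun x => ?F (@?f x) (@?g x) (@?h x) (@?k x) (@?l x)) =>
      refine (fp_app5 (F := F) (f := f) (g := g) (h := h) (k := k) (l := l) _ _ _ _ _ _);
        [solve [auto with fpdb nocore] | fp | fp | fp | fp | fp]
    end
  | refine (fp_if _ _ _); fp
  | idtac ].

(** ** Arithmetic and logic *)

Lemma fp_negb : FP negb.
Proof.
apply: (@fp_ext _ _ _ _ (fun b : bool => if b then false else true)); first by case.
by fp.
Qed.

Lemma fp_leq : FP (fun p : nat * nat => p.1 <= p.2).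
Proof. exact: (fp_comp fp_subn fp_eq0). Qed.

#[global] Hint Resolve fp_leq fp_negb : fpdb.

Lemma fp_eqn : FP (fun p : nat * nat => p.1 == p.2).
Proof.
apply: (@fp_ext _ _ _ _ (fun p => if p.1 <= p.2 then p.2 <= p.1 else false)).
  by move=> p; rewrite eqn_leq; case: leqP.
by fp.
Qed.

Lemma fp_modn : FP (fun p : nat * nat => p.1 %% p.2).
Proof.
apply: (@fp_ext _ _ _ _ (fun p => p.1 - p.1 %/ p.2 * p.2)); last by fp.
by move=> p; rewrite {1}(divn_eq p.1 p.2) addKn.
Qed.

Lemma fp_minn : FP (fun p : nat * nat => minn p.1 p.2).
Proof.
apply: (@fp_ext _ _ _ _ (fun p => if p.1 <= p.2 then p.1 else p.2)); last by fp.
by move=> p; case: (leqP p.1 p.2); lia.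
Qed.

Lemma fp_maxn : FP (fun p : nat * nat => maxn p.1 p.2).
Proof.
apply: (@fp_ext _ _ _ _ (fun p => if p.1 <= p.2 then p.2 else p.1)); last by fp.
by move=> p; case: (leqP p.1 p.2); lia.
Qed.

Lemma fp_andb : FP (fun p : bool * bool => p.1 && p.2).
Proof. by apply: (@fp_ext _ _ _ _ (fun p => if p.1 then p.2 else false)) => //; fp. Qed.

Lemma fp_orb : FP (fun p : bool * bool => p.1 || p.2).
Proof. by apply: (@fp_ext _ _ _ _ (fun p => if p.1 then true else p.2)) => //; fp. Qed.

Lemma fp_implb : FP (fun p : bool * bool => p.1 ==> p.2).
Proof. by apply: (@fp_ext _ _ _ _ (fun p => if p.1 then p.2 else true)) => //; fp. Qed.

#[global] Hint Resolve fp_eqn fp_modn fp_minn fp_maxn fp_andb fp_orb fp_implb : fpdb.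

(** ** Folds *)

Arguments dsize {T Data} x : simpl never.

Lemma dsize_pair {A B : Type} {DA : Data A} {DB : Data B} (a : A) (b : B) :
  dsize (a, b) = dsize a + dsize b + 1.
Proof. by []. Qed.

Section ListSize.
Context {E : Type} {DE : Data E}.
Implicit Types (s : seq E) (p : pred E).

Lemma dsize_nil : dsize ([::] : seq E) = 1.
Proof. by []. Qed.

Lemma dsize_cons e s : dsize (e :: s) = dsize e + dsize s + 1.
Proof. by []. Qed.

Lemma dsize_cat s1 s2 : (dsize (s1 ++ s2)).+1 = dsize s1 + dsize s2.
Proof. by elim: s1 => [|e s1 IH] //; rewrite cat_cons !dsize_cons; lia. Qed.

Lemma dsize_catl s1 s2 : dsize s1 <= dsize (s1 ++ s2).
Proof. by rewrite -ltnS dsize_cat -[X in X < _]addn0 ltn_add2l dsize_gt0. Qed.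

Lemma dsize_catr s1 s2 : dsize s2 <= dsize (s1 ++ s2).
Proof. by rewrite -ltnS dsize_cat -[X in X < _]add0n ltn_add2r dsize_gt0. Qed.

Lemma dsize_elem s1 e s2 : dsize e <= dsize (s1 ++ e :: s2).
Proof. by apply: leq_trans (dsize_catr _ _); rewrite dsize_cons -addnA leq_addr. Qed.

Lemma dsize_take n s : dsize (take n s) <= dsize s.
Proof. by rewrite -{2}(cat_take_drop n s) dsize_catl. Qed.

Lemma dsize_drop n s : dsize (drop n s) <= dsize s.
Proof. by rewrite -{2}(cat_take_drop n s) dsize_catr. Qed.

Lemma dsize_behead s : dsize (behead s) <= dsize s.
Proof. by rewrite -drop1 dsize_drop. Qed.

Lemma dsize_filter p s : dsize (filter p s) <= dsize s.
Proof. by elim: s => //= e s IH; case: ifP => _; rewrite !dsize_cons; lia. Qed.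

Lemma dsize_filterC p s :
  dsize (filter (fun e => ~~ p e) s ++ filter p s) = dsize s.
Proof.
apply/succn_inj; rewrite dsize_cat.
by elim: s => //= e s IH; case: (p e); rewrite /= !dsize_cons; lia.
Qed.

Lemma ltn_size_dsize s : size s < dsize s.
Proof. by elim: s => // e s; rewrite dsize_cons /=; lia. Qed.

Lemma leq_dsize_all B s : all (fun e => dsize e <= B) s ->
  dsize s <= 1 + size s * B.+1.
Proof. by elim: s => //= e s IH /andP[le_e /IH]; rewrite dsize_cons; lia. Qed.
End ListSize.

Lemma fp_case_seq {X E B : Type} {DX : Data X} {DE : Data E} {DB : Data B}
    (f : X * (E * seq E) -> B) (g : X -> B) : FP f -> FP g ->
  FP (fun p : X * seq E => if p.2 is e :: s then f (p.1, (e, s)) else g p.1).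
Proof.
move=> fp_f fp_g; have fp_c : FP (fun p : X * seq E => nilp p.2) by fp.
have fp_g' : FP (fun p : X * seq E => g p.1) by fp.
apply: fp_branch fp_c fp_g' fp_f _ => -[x [|e s]] /=.
  by exists (x, [::]) => //; apply: casts_to_refl.
by exists (x, (e, s)) => //; apply/casts_pair_snd/casts_cons_pair.
Qed.

Section Fold.
Context {X A E : Type} {DX : Data X} {DA : Data A} {DE : Data E}.
Variables (b : X -> A -> E -> A) (i : X -> A) (l : X -> seq E).
Hypotheses (fp_b : FP (fun p : X * (A * E) => b p.1 p.2.1 p.2.2))
  (fp_i : FP i) (fp_l : FP l).

Definition fold_step (p : X * (A * seq E)) : X * (A * seq E) :=
  if p.2.2 is e :: s then (p.1, (b p.1 p.2.1 e, s)) else p.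

Lemma fp_fold_step : FP fold_step.
Proof.
have fp_tail : FP (fun p : (X * A) * (E * seq E) =>
  (p.1.1, (b p.1.1 p.1.2 p.2.1, p.2.2))) by fp.
have fp_stop : FP (fun p : X * A => (p.1, (p.2, [::] : seq E))) by fp.
have fp_assoc : FP (fun p : X * (A * seq E) => ((p.1, p.2.1), p.2.2)) by fp.
apply: fp_ext (fp_comp fp_assoc (fp_case_seq fp_tail fp_stop)).
by case=> x [a [|e s]].
Qed.

Lemma iter_fold_step x j a s : j <= size s ->
  iter j fold_step (x, (a, s)) = (x, (foldl (b x) a (take j s), drop j s)).
Proof.
elim: j a s => [|j IH] a s; first by rewrite take0 drop0.
by case: s => // e s le_j; rewrite iterSr IH.
Qed.

Lemma fp_foldl (Inv : X -> nat -> A -> Prop) Q :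
  poly_bounded Q -> (forall x, Inv x 0 (i x)) ->
  (forall x j a e, dsize e <= dsize (l x) -> Inv x j a -> Inv x j.+1 (b x a e)) ->
  (forall x j a, j <= size (l x) -> Inv x j a -> dsize a <= Q (dsize x)) ->
  FP (fun x => foldl (b x) (i x) (l x)).
Proof.
move=> polyQ inv0 invS size_inv; have [L polyL size_l] := fp_size_bound fp_l.
have inv_prefix x l1 l2 : l1 ++ l2 = l x -> Inv x (size l1) (foldl (b x) (i x) l1).
  elim/last_ind: l1 l2 => [|l1 e IH] l2 lx; first exact: inv0.
  rewrite -cats1 foldl_cat size_cat addn1 /=; rewrite cat_rcons in lx.
  by apply: invS (IH _ lx); rewrite -lx dsize_elem.
pose f x := (x, (foldl (b x) (i x) (l x), [::] : seq E)).
have fp_f : FP f; last by apply: (fp_ext (f := fun x => (f x).2.1)) => //; fp.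
have fp_init : FP (fun x => (x, (i x, l x))) by fp.
have fp_more : FP (fun p : X * (A * seq E) => ~~ nilp p.2.2) by fp.
apply: (fp_while fp_init fp_more fp_fold_step polyL
  (Q := fun n => n + (Q n + L n + 1) + 1)) => [|x]; first by poly.
exists (size (l x)); split=> [||j le_j|j le_j].
- exact/ltnW/(leq_trans (ltn_size_dsize _))/size_l.
- by rewrite iter_fold_step // take_size drop_size.
- by rewrite iter_fold_step //= /nilp size_drop; lia.
rewrite iter_fold_step // !dsize_pair leq_add2r leq_add2l leq_add2r; apply: leq_add.
  have split_l := cat_take_drop j (l x);
  apply: (size_inv _ _ _ _ (inv_prefix _ _ _ split_l)).
  by rewrite size_take_min geq_minr.
exact: leq_trans (dsize_drop _ _) (size_l x).
Qed.

Lemma fp_foldl_add R : poly_bounded R ->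
  (forall x a e, dsize (b x a e) <= dsize a + R (dsize x + dsize e)) ->
  FP (fun x => foldl (b x) (i x) (l x)).
Proof.
move=> polyR size_b; have [I polyI size_i] := fp_size_bound fp_i.
have [L polyL size_l] := fp_size_bound fp_l.
apply: (fp_foldl
  (Inv := fun x j a => dsize a <= I (dsize x) + j * R (dsize x + L (dsize x)))
  (Q := fun n => I n + L n * R (n + L n))); first by poly.
- by move=> x; rewrite addn0.
- move=> x j a e size_e inv; apply: leq_trans (size_b _ _ _) _.
  have le_R : R (dsize x + dsize e) <= R (dsize x + L (dsize x)).
    by apply: polyR.1; have := size_l x; lia.
  by rewrite mulSn; lia.
- move=> x j a le_j inv; apply: leq_trans inv _; rewrite leq_add2l.
  have le_L : j <= L (dsize x).
    exact: leq_trans le_j (ltnW (leq_trans (ltn_size_dsize _) (size_l x))).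
  by rewrite leq_mul2r le_L orbT.
Qed.
End Fold.

(* The binary prefixes of [n], from the shortest to [n] itself. *)
Definition halves (n : nat) : seq nat :=
  [seq n %/ 2 ^ i | i <- rev (iota 0 (up_log 2 n.+1))].

Lemma ltn_up_log2 j n : (j < up_log 2 n.+1) = (2 ^ j <= n).
Proof.
rewrite [LHS]ltnNge [RHS]leqNgt; congr (~~ _); apply/idP/idP; last exact: up_log_min.
by move=> le_j; apply: leq_trans (@up_logP 2 n.+1 isT) _; rewrite leq_pexp2l.
Qed.

Lemma up_log2_le_blen n : up_log 2 n.+1 <= blen n.
Proof. by apply: up_log_min => //; apply: ltn_blen. Qed.

Lemma fp_halves : FP halves.
Proof.
pose halve (p : nat * seq nat) := (p.1 %/ 2, p.1 :: p.2).
have iter_halve n j :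
    iter j halve (n, [::]) = (n %/ 2 ^ j, [seq n %/ 2 ^ i | i <- rev (iota 0 j)]).
  elim: j => [|j IH]; first by rewrite divn1.
  by rewrite iterS IH -[in RHS](addn1 j) iotaD rev_cat /halve /= -divnMA -expnSr addn1.
pose f n := (0, halves n).
have fp_f : FP f; last by apply: (fp_ext (f := fun n => (f n).2)) => //; fp.
have fp_init : FP (fun n : nat => (n, [::] : seq nat)) by fp.
have fp_more : FP (fun p : nat * seq nat => ~~ (p.1 == 0)) by fp.
have fp_halve : FP halve by rewrite /halve; fp.
apply: (fp_while fp_init fp_more fp_halve poly_id (Q := fun n => n + (1 + n * n.+1) + 1))
  => [|n]; first by poly.
have le_blen := up_log2_le_blen n.
exists (up_log 2 n.+1); split=> [|| j _ | j le_j]; first exact: le_blen.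
- by rewrite iter_halve divn_small // up_logP.
- by rewrite iter_halve ltn_up_log2 /= -lt0n divn_gt0 ?expn_gt0.
have size_div k : dsize (n %/ k) <= dsize n by apply: leq_blen; apply: leq_div.
rewrite iter_halve dsize_pair leq_add2r leq_add ?size_div //.
apply: leq_trans (leq_dsize_all (B := dsize n) _) _.
  by rewrite all_map; apply/allP => i _ /=.
by rewrite size_map size_rev size_iota leq_add2l leq_mul2r (leq_trans le_j) ?orbT.
Qed.

#[global] Hint Resolve fp_halves : fpdb.

(** ** List functions *)

Lemma fp_rev {E : Type} {DE : Data E} : FP (@rev E).
Proof.
apply: (@fp_ext _ _ _ _ (fun s : seq E => foldl (fun acc e => e :: acc) [::] s)).
  by move=> s; rewrite -[RHS]cats0 -catrevE; elim: s [::] => [|e s IH] acc //=.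
apply: (fp_foldl_add _ _ _ (R := fun n => n + 1)); [by fp | by fp | by fp | by poly |].
by move=> x acc e; rewrite dsize_cons; lia.
Qed.
#[global] Hint Resolve fp_rev : fpdb.

Lemma fp_foldr_add {X A E : Type} {DX : Data X} {DA : Data A} {DE : Data E}
    (b : X -> E -> A -> A) (i : X -> A) (l : X -> seq E) R :
  FP (fun p : X * (E * A) => b p.1 p.2.1 p.2.2) -> FP i -> FP l ->
  poly_bounded R ->
  (forall x e acc, dsize (b x e acc) <= dsize acc + R (dsize x + dsize e)) ->
  FP (fun x => foldr (b x) (i x) (l x)).
Proof.
move=> fp_b fp_i fp_l polyR size_b.
apply: (@fp_ext _ _ _ _ (fun x => foldl (fun acc e => b x e acc) (i x) (rev (l x)))).
  by move=> x; rewrite foldl_rev.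
by apply: (fp_foldl_add _ _ _ (R := R)) => //; fp.
Qed.

Lemma fp_map {X A E : Type} {DX : Data X} {DA : Data A} {DE : Data E}
    (b : X -> E -> A) (l : X -> seq E) :
  FP (fun p : X * E => b p.1 p.2) -> FP l -> FP (fun x => map (b x) (l x)).
Proof.
move=> fp_b fp_l; have [P polyP size_b] := fp_size_bound fp_b.
apply: (@fp_foldr_add _ _ _ _ _ _ (fun x e acc => b x e :: acc) (fun=> [::]) l
          (fun n => P n.+1 + 1)); [by fp | by fp | by [] | by poly |].
move=> x e acc; rewrite dsize_cons.
by have := size_b (x, e); rewrite dsize_pair addn1 /=; lia.
Qed.

Section PredicateClosure.
Context {X E : Type} {DX : Data X} {DE : Data E}.
Variables (b : X -> E -> bool) (l : X -> seq E).
Hypotheses (fp_b : FP (fun p : X * E => b p.1 p.2)) (fp_l : FP l).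

Lemma fp_filter : FP (fun x => filter (b x) (l x)).
Proof.
apply: (@fp_foldr_add _ _ _ _ _ _ (fun x e acc => if b x e then e :: acc else acc)
   (fun=> [::]) l (fun n => n + 1)); [by fp | by fp | by [] | by poly |].
by move=> x e acc; case: ifP => _; rewrite ?dsize_cons; lia.
Qed.

Lemma fp_all : FP (fun x => all (b x) (l x)).
Proof.
apply: (@fp_foldr_add _ _ _ _ _ _ (fun x e acc => b x e && acc)
   (fun=> true) l id); [by fp | by fp | by [] | by poly |].
by move=> x e acc; rewrite leq_addr.
Qed.

Lemma fp_has : FP (fun x => has (b x) (l x)).
Proof.
apply: (@fp_foldr_add _ _ _ _ _ _ (fun x e acc => b x e || acc)
   (fun=> false) l id); [by fp | by fp | by [] | by poly |].
by move=> x e acc; rewrite leq_addr.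
Qed.
End PredicateClosure.

Lemma fp_mem {X : Type} {DX : Data X} (f : X -> nat) (g : X -> seq nat) :
  FP f -> FP g -> FP (fun x => f x \in g x).
Proof.
move=> fp_f fp_g; apply: (@fp_ext _ _ _ _ (fun x => has (fun y => y == f x) (g x))).
  by move=> x; rewrite has_pred1.
by apply: (fp_has (b := fun x y => y == f x)) => //; fp.
Qed.

Ltac fp_higher_order ::=
  lazymatch goal with
  | |- FP (fun x => map (@?b x) (@?l x)) => refine (fp_map (b := b) (l := l) _ _); fp
  | |- FP (fun x => filter (@?b x) (@?l x)) =>
      refine (fp_filter (b := b) (l := l) _ _); fp
  | |- FP (fun x => all (@?b x) (@?l x)) => refine (fp_all (b := b) (l := l) _ _); fp
  | |- FP (fun x => has (@?b x) (@?l x)) => refine (fp_has (b := b) (l := l) _ _); fp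
  | |- FP (fun x => in_mem (@?f x) (mem (@?g x))) =>
      refine (fp_mem (f := f) (g := g) _ _); fp
  end.

Section ListFunctions.
Context {E : Type} {DE : Data E}.

Lemma fp_cat : FP (fun p : seq E * seq E => p.1 ++ p.2).
Proof.
apply: (@fp_ext _ _ _ _ (fun p : seq E * seq E => foldr (@cons E) p.2 p.1)).
  by move=> [s1 s2] /=; elim: s1 => //= e s ->.
apply: (fp_foldr_add (b := fun _ => @cons E) (R := fun n => n + 1));
  [by fp | by fp | by fp | by poly |].
by move=> x e acc; rewrite dsize_cons; lia.
Qed.

Lemma dsize_pred n : dsize (n - 1) <= dsize n.
Proof. by apply: leq_blen; rewrite leq_subr. Qed.

Lemma fp_take : FP (fun p : nat * seq E => take p.1 p.2).
Proof.
pose b (_ : nat * seq E) (st : nat * seq E) (e : E) :=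
  if st.1 == 0 then st else (st.1 - 1, e :: st.2).
apply: (@fp_ext _ _ _ _ (fun p => rev (foldl (b p) (p.1, [::]) p.2).2)).
  move=> [n s] /=; rewrite -[RHS](revK (take n s)); congr rev.
  rewrite -[RHS]cats0; elim: s n [::] => [|e s IH] n acc //=.
  rewrite /b /=; case: n => [|n] /=; first by have := IH 0 acc; rewrite take0.
  by rewrite subn1 /= IH rev_cons cat_rcons.
have fp_fold : FP (fun p : nat * seq E => foldl (b p) (p.1, [::]) p.2); last by fp.
apply: (fp_foldl_add _ _ _ (R := fun n => n + 1));
  [by rewrite /b; fp | by fp | by fp | by poly |].
move=> x [n acc] e; rewrite /b /=; case: ifP => _; rewrite !dsize_pair ?dsize_cons;
  first lia.
by have := dsize_pred n; lia.
Qed.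

Lemma fp_drop : FP (fun p : nat * seq E => drop p.1 p.2).
Proof.
pose b (_ : nat * seq E) (st : nat * seq E) (e : E) :=
  if st.1 == 0 then (0, e :: st.2) else (st.1 - 1, st.2).
apply: (@fp_ext _ _ _ _ (fun p => rev (foldl (b p) (p.1, [::]) p.2).2)).
  move=> [n s] /=; rewrite -[RHS](revK (drop n s)); congr rev.
  rewrite -[RHS]cats0; elim: s n [::] => [|e s IH] n acc //=.
  rewrite /b /=; case: n => [|n] /=.
    by have := IH 0 (e :: acc); rewrite drop0 => ->; rewrite rev_cons cat_rcons.
  by rewrite subn1 /= IH.
have fp_fold : FP (fun p : nat * seq E => foldl (b p) (p.1, [::]) p.2); last by fp.
apply: (fp_foldl_add _ _ _ (R := fun n => n + 1));
  [by rewrite /b; fp | by fp | by fp | by poly |].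
move=> x [n acc] e; rewrite /b /=; case: eqP => [->|_];
rewrite !dsize_pair ?dsize_cons; first lia.
by have := dsize_pred n; lia.
Qed.

Lemma fp_behead : FP (@behead E).
Proof.
apply: (fp_ext (f := drop 1)); first by move=> s; rewrite drop1.
exact: (fp_app2 (F := @drop E) fp_drop (fp_nat 1) fp_id).
Qed.

Lemma fp_head : FP (fun p : E * seq E => head p.1 p.2).
Proof.
apply: fp_ext (fp_case_seq (f := fun p => p.2.1) (g := id) _ _); [|by fp..].
by case=> x [].
Qed.
End ListFunctions.

#[global] Hint Resolve fp_cat fp_take fp_drop fp_behead fp_head : fpdb.

Lemma fp_flatten {E : Type} {DE : Data E} : FP (@flatten E).
Proof.
apply: (fp_foldr_add (b := fun _ => @cat E) (i := fun=> [::]) (R := id));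
  [by fp | by fp | by fp | by poly |].
by move=> x e acc; have := @dsize_cat E DE e acc; lia.
Qed.
#[global] Hint Resolve fp_flatten : fpdb.

Lemma fp_undup : FP (undup : seq nat -> seq nat).
Proof.
pose add_new (x : nat) (s : seq nat) := if x \in s then s else x :: s.
have fp_add_new : FP (fun p : nat * seq nat => add_new p.1 p.2) by rewrite /add_new; fp.
apply: (fp_ext (f := fun s : seq nat => foldr add_new [::] s)).
  by elim=> //= x s ->; rewrite /add_new mem_undup.
apply: (fp_foldr_add (b := fun _ => add_new) (R := fun n => n + 1));
  [by fp | by fp | by fp | by poly |].
by move=> x e acc; rewrite /add_new; case: ifP => _; rewrite ?dsize_cons; lia.
Qed.

Definition prodn (s : seq nat) : nat := foldr muln 1 s.

Lemma fp_sumn : FP sumn.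
Proof.
apply: (fp_foldr_add (b := fun _ => addn) (i := fun=> 0) (l := id) (R := id));
  [by fp | by fp | by fp | by poly |].
move=> x e acc; have : dsize (e + acc) <= dsize e + dsize acc by exact: blenD.
lia.
Qed.

Lemma fp_prodn : FP prodn.
Proof.
apply: (fp_foldr_add (b := fun _ => muln) (i := fun=> 1) (l := id) (R := id));
  [by fp | by fp | by fp | by poly |].
move=> x e acc; have : dsize (e * acc) <= dsize e + dsize acc by exact: blenM.
lia.
Qed.
#[global] Hint Resolve fp_undup fp_sumn fp_prodn : fpdb.

Lemma fp_size {E : Type} {DE : Data E} : FP (@size E).
Proof.
apply: (@fp_ext _ _ _ _ (fun s : seq E => sumn (map (fun=> 1) s))); last by fp.
by elim=> //= e s ->.
Qed.
#[global] Hint Resolve fp_size : fpdb.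

(** ** Greatest common divisors *)

Definition gcd_step (st : nat * nat) : nat * nat :=
  if st.2 == 0 then st else (st.2, st.1 %% st.2).

Definition gcd_loop (p : nat * nat) (l : seq nat) : nat * nat :=
  foldl (fun st (_ : nat) => gcd_step st) p l.

Lemma gcd_loopE p l : gcdn (gcd_loop p l).1 (gcd_loop p l).2 = gcdn p.1 p.2.
Proof.
rewrite /gcd_loop; elim: l p => //= _ l IH p; rewrite {}IH /gcd_step.
by case: eqP => //= _; rewrite gcdnC gcdn_modl.
Qed.

(* Each step at least halves the product of an ordered pair. *)
Lemma gcd_loop_ordered a b l : b <= a -> a * b < 2 ^ size l -> (gcd_loop (a, b) l).2 = 0.
Proof.
elim: l a b => [|e l IH] a b le_ba; first by rewrite expn0 /=; nia.
rewrite [size _]/= expnS -[gcd_loop _ _]/(gcd_loop (gcd_step (a, b)) l) => lt_ab.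
rewrite /gcd_step /=; case: eqP => [b0|/eqP b_neq0].
  by rewrite b0; apply: IH => //; rewrite muln0 expn_gt0.
have b_gt0 : 0 < b by rewrite lt0n.
apply: IH; first exact/ltnW/ltn_pmod.
have := divn_eq a b; have := ltn_pmod a b_gt0.
have : 0 < a %/ b by rewrite divn_gt0.
nia.
Qed.

Lemma gcd_loop_stops a b l : a * b < 2 ^ size l -> (gcd_loop (a, b) (0 :: l)).2 = 0.
Proof.
move=> lt_ab; rewrite -[gcd_loop _ _]/(gcd_loop (gcd_step (a, b)) l) /gcd_step /=.
case: eqP => [->|/eqP b_neq0]; first by apply: gcd_loop_ordered; rewrite ?muln0 ?expn_gt0.
have b_gt0 : 0 < b by rewrite lt0n.
apply: gcd_loop_ordered; first exact/ltnW/ltn_pmod.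
by apply: leq_ltn_trans lt_ab; rewrite mulnC leq_mul2r leq_mod orbT.
Qed.

Lemma ltn_halves n : n < 2 ^ size (halves n).
Proof. by rewrite size_map size_rev size_iota up_logP. Qed.

Lemma fp_gcdn : FP (fun p : nat * nat => gcdn p.1 p.2).
Proof.
apply: (@fp_ext _ _ _ _ (fun p => (gcd_loop p (0 :: halves (p.1 * p.2))).1)).
  move=> [a b]; have := gcd_loopE (a, b) (0 :: halves (a * b)).
  by rewrite gcd_loop_stops ?ltn_halves // gcdn0.
have fp_loop : FP (fun p : nat * nat => gcd_loop p (0 :: halves (p.1 * p.2))); last by fp.
apply: (fp_foldl (b := fun _ st (_ : nat) => gcd_step st) (i := id)
  _ _ _ (Inv := fun p _ st => st.1 <= maxn p.1 p.2 /\ st.2 <= maxn p.1 p.2)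
  (Q := fun n => n + n + 1)).
- by rewrite /gcd_step; fp.
- by fp.
- by fp.
- by poly.
- by move=> p /=; split; rewrite ?leq_maxl ?leq_maxr.
- move=> p j [u v] e _ [/= hu hv]; rewrite /gcd_step /=; case: eqP => //= _; split=> //.
  exact: leq_trans (leq_mod _ _) hu.
- move=> [a b] j [u v] _ [/= hu hv]; rewrite !dsize_pair.
  have le_max : blen (maxn a b) <= dsize a + dsize b.
    by case: (leqP a b) => _; [exact: leq_addl | exact: leq_addr].
  have size_u : dsize u <= dsize a + dsize b by exact: leq_trans (leq_blen hu) le_max.
  have size_v : dsize v <= dsize a + dsize b by exact: leq_trans (leq_blen hv) le_max.
  lia.
Qed.
#[global] Hint Resolve fp_gcdn : fpdb.

(** * Decoding the input *)

Definition bits (v : nat) : seq nat := [seq h %% 2 | h <- behead (halves v)].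

Lemma fp_bits : FP bits.
Proof. by rewrite /bits; fp. Qed.

Lemma halves_double v (b : bool) :
    0 < v -> halves (2 * v + b) = rcons (halves v) (2 * v + b).
Proof.
move=> v_gt0; rewrite /halves.
have -> : up_log 2 (2 * v + b).+1 = (up_log 2 v.+1).+1.
  rewrite up_log2S; last by case: v v_gt0.
  by rewrite mul2n addnC half_bit_double.
rewrite -[X in iota 0 X]add1n iotaD rev_cat map_cat cats1 /= divn1; congr rcons.
rewrite [iota 1 _](iotaDl 1 0) -map_rev -map_comp; apply: eq_map => i /=.
by rewrite expnS divnMA mulnC divnMDl // (divn_small (_ : b < 2)) ?addn0 //; case: b.
Qed.

Lemma bits_double v (b : bool) : 0 < v -> bits (2 * v + b) = rcons (bits v) b.
Proof.
move=> v_gt0; have nonempty : halves v != [::].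
  by rewrite -size_eq0 size_map size_rev size_iota up_log_eq0 -ltnNge.
rewrite /bits halves_double //; case: (halves v) nonempty => //= h s _.
by rewrite map_rcons mulnC modnMDl modn_small //; case: b.
Qed.

Definition append_bits (v : nat) (s : seq bool) : nat :=
  foldl (fun v (b : bool) => 2 * v + b) v s.

Lemma append_bits_rcons v s b : append_bits v (rcons s b) = 2 * append_bits v s + b.
Proof. exact: foldl_rcons. Qed.

Lemma append_bitsE v s : append_bits v s = v * 2 ^ size s + append_bits 0 s.
Proof.
elim/last_ind: s => [|s b IH]; first by rewrite muln1 addn0.
by rewrite !append_bits_rcons size_rcons expnS IH; nia.
Qed.

Lemma append_bits_lt s : append_bits 0 s < 2 ^ size s.
Proof.
elim/last_ind: s => // s b IH.
by rewrite append_bits_rcons size_rcons expnS; case: b; lia.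
Qed.

Definition number_of_bits (s : seq bool) : nat := append_bits 1 s.

Lemma bits_number s : bits (number_of_bits s) = map nat_of_bool s.
Proof.
elim/last_ind: s => [|s b IH]; first by [].
rewrite map_rcons -IH -bits_double; first by rewrite -append_bits_rcons.
by rewrite /number_of_bits append_bitsE mul1n addn_gt0 expn_gt0.
Qed.

(* The state [(data, (p, (v, out)))] tells whether a data bit follows, the weight
   of that bit, the value read so far, and the reversed list of the previous
   tokens. *)
Definition token_step (st : nat * (nat * (nat * seq nat))) (b : nat) :
    nat * (nat * (nat * seq nat)) :=
  if st.1 == 0 then
    if b == 0 then (0, (1, (0, st.2.2.1 :: st.2.2.2))) else (1, st.2)
  else (0, (2 * st.2.1,
         ((if b == 0 then st.2.2.1 else st.2.2.1 + st.2.1), st.2.2.2))).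

Definition tokens (s : seq nat) : seq nat :=
  rev (foldl token_step (0, (1, (0, [::]))) s).2.2.2.

Lemma fp_tokens : FP tokens.
Proof.
have fp_fold : FP (fun s : seq nat => foldl token_step (0, (1, (0, [::]))) s);
  last by rewrite /tokens; fp.
apply: (fp_foldl (b := fun _ => token_step) _ _ _
  (Inv := fun _ j st => [/\ st.1 <= 1, st.2.2.1 < st.2.1, st.2.1 <= 2 ^ j
                          & dsize st.2.2.2 <= 1 + j * (j + 2)])
  (Q := fun n => 10 + 10 * n + n * (n + 2))).
- by rewrite /token_step; fp.
- by fp.
- by fp.
- by poly.
- by [].
- move=> s j [data [p [v out]]] e _ [/= data_le1 lt_vp le_p size_out];
  rewrite /token_step /=.
  have size_v : dsize v <= j.+1 by have := @blen_ltn v j; rewrite /dsize /=; lia.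
  have pow_gt0 := expn_gt0 2 j.
  case: eqP => _; case: eqP => _; rewrite /= ?dsize_cons ?expnS; split; lia.
- move=> s j [data [p [v out]]] le_j [/= data_le1 lt_vp le_p size_out];
  rewrite !dsize_pair.
  have lt_s := @ltn_size_dsize nat Data_nat s.
  have size_data : dsize data <= 1 by apply: (@leq_blen data 1).
  have size_p : dsize p <= j.+2.
    have : p < 2 ^ j.+1 by rewrite expnS; have := expn_gt0 2 j; lia.
    by move/blen_ltn; rewrite /dsize /=; lia.
  have size_v : dsize v <= dsize p by apply: leq_blen; lia.
  have : j * (j + 2) <= dsize s * (dsize s + 2) by apply: leq_mul; lia.
  lia.
Qed.
#[global] Hint Resolve fp_bits fp_tokens : fpdb.

Definition encode (ts : seq nat) : seq bool := flatten (map enc_nat ts).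

Lemma encode_cat s t : encode (s ++ t) = encode s ++ encode t.
Proof. by rewrite /encode map_cat flatten_cat. Qed.

Fixpoint bits_value (l : seq bool) : nat :=
  if l is b :: l' then b + 2 * bits_value l' else 0.

Lemma bits_value_nbits f n : n <= f -> bits_value (nbits f n) = n.
Proof.
elim: f n => [|f IH] n le_nf /=; first by lia.
case: eqP => [-> //|nz] /=; rewrite IH; last by lia.
by rewrite mul2n odd_double_half.
Qed.

Lemma foldl_token_step_bits l p v out :
  foldl token_step (0, (p, (v, out)))
    (map nat_of_bool (flatten (map (fun b => [:: true; b]) l))) =
  (0, (2 ^ size l * p, (v + p * bits_value l, out))).
Proof.
elim: l p v => [|b l IH] p v /=; first by rewrite muln0 addn0 mul1n.
by case: b; rewrite /= IH expnS /=; congr (_, (_, (_, _))); nia.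
Qed.

Lemma foldl_token_step_encode ts out :
  foldl token_step (0, (1, (0, out))) (map nat_of_bool (encode ts)) =
  (0, (1, (0, rev ts ++ out))).
Proof.
elim: ts out => [|t ts IH] out //; rewrite /encode /= -/(encode ts) map_cat foldl_cat.
rewrite /enc_nat map_cat foldl_cat foldl_token_step_bits /= /token_step /= add0n mul1n.
by rewrite bits_value_nbits // -/token_step IH rev_cons cat_rcons.
Qed.

Lemma tokens_encode ts z :
  tokens (map nat_of_bool (encode ts ++ nseq z false)) = ts ++ nseq z 0.
Proof.
rewrite /tokens -[RHS]revK rev_cat rev_nseq; congr rev.
rewrite map_cat foldl_cat foldl_token_step_encode cats0 map_nseq.
elim: z (rev ts) => //= z IH out.
by rewrite IH; elim: (z) => //= z' ->.
Qed.

(** ** Parsers *)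

Definition parser (A : Type) : Type := seq nat -> A * seq nat.

Definition parse_nats : parser (seq nat) := fun ts =>
  (take (head 0 ts) (behead ts), drop (head 0 ts) (behead ts)).

(* A fraction [(n, k)] stands for n/k. *)
Notation fraction := (nat * nat)%type.

Definition parse_fraction : parser fraction := fun ts =>
  ((head 0 ts, head 0 (behead ts)), behead (behead ts)).

Definition parse_pair {A B : Type} (p : parser A) (q : parser B) : parser (A * B) :=
  fun ts => (((p ts).1, (q (p ts).2).1), (q (p ts).2).2).

Definition parse_item {A : Type} (p : parser A) (st : nat * (seq nat * seq A)) :
    nat * (seq nat * seq A) :=
  if st.1 == 0 then st
  else (st.1 - 1, ((p st.2.1).2, (p st.2.1).1 :: st.2.2)).

(* The token list itself serves as the clock of the loop. *)
Definition parse_items {A : Type} (p : parser A) (ts : seq nat) :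
    nat * (seq nat * seq A) :=
  foldl (fun st (_ : nat) => parse_item p st) (head 0 ts, (behead ts, [::])) ts.

Definition parse_list {A : Type} (p : parser A) : parser (seq A) := fun ts =>
  (rev (parse_items p ts).2.2, (parse_items p ts).2.1).

Section PolyParsers.
Context {A B : Type} {DA : Data A} {DB : Data B}.

Definition poly_parser {C : Type} {DC : Data C} (p : parser C) : Prop :=
  FP p /\ forall ts, dsize (p ts).2 <= dsize ts.

Lemma poly_parse_nats : poly_parser parse_nats.
Proof.
split; first by rewrite /parse_nats; fp.
by move=> ts; apply: leq_trans (dsize_drop _ _) (dsize_behead _).
Qed.

Lemma poly_parse_fraction : poly_parser parse_fraction.
Proof.
split; first by rewrite /parse_fraction; fp.
by move=> ts; apply: leq_trans (dsize_behead _) (dsize_behead _).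
Qed.

Lemma poly_parse_pair (p : parser A) (q : parser B) :
  poly_parser p -> poly_parser q -> poly_parser (parse_pair p q).
Proof.
move=> [fp_p size_p] [fp_q size_q]; split; first by rewrite /parse_pair; fp.
by move=> ts; apply: leq_trans (size_q _) (size_p _).
Qed.

Variable p : parser A.
Hypothesis poly_p : poly_parser p.

Lemma dsize_parse_items ts : dsize (parse_items p ts).2.1 <= dsize ts.
Proof.
have size_loop (l : seq nat) st :
    dsize (foldl (fun st (_ : nat) => parse_item p st) st l).2.1 <= dsize st.2.1.
  elim: l st => // e l IH st /=; apply: leq_trans (IH _) _; rewrite /parse_item.
  by case: ifP => _ //=; case: poly_p.
by rewrite /parse_items; apply: leq_trans (size_loop _ _) _; apply: dsize_behead.
Qed.

Lemma fp_parse_items : FP (parse_items p).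
Proof.
have [fp_p size_rest] := poly_p; have [P polyP size_p] := fp_size_bound fp_p.
apply: (fp_foldl (b := fun _ st (_ : nat) => parse_item p st)
  (i := fun ts => (head 0 ts, (behead ts, [::]))) _ _ _
  (Inv := fun ts j st => [/\ st.1 <= head 0 ts, dsize st.2.1 <= dsize ts
                           & dsize st.2.2 <= 1 + j * (P (dsize ts) + 1)])
  (Q := fun n => 10 + 3 * n + n * (P n + 1))).
- by rewrite /parse_item; fp.
- by fp.
- by fp.
- by poly.
- by move=> ts; split=> //=; exact: dsize_behead.
- move=> ts j [n [rest out]] e _ [/= le_n size_ts size_out]; rewrite /parse_item /=.
  case: ifP => _ /=; first by split=> //; lia.
  split; first lia; first exact: leq_trans (size_rest _) size_ts.
  have size_item : dsize (p rest).1 <= P (dsize ts).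
    apply: leq_trans (polyP.1 _ _ size_ts); apply: leq_trans (size_p rest).
    by rewrite [X in _ <= X]/dsize /=; lia.
  by rewrite dsize_cons mulSn; lia.
- move=> ts j [n [rest out]] le_j [/= le_n size_ts size_out]; rewrite !dsize_pair.
  have lt_ts := @ltn_size_dsize nat Data_nat ts.
  have size_n : dsize n <= dsize ts.
    apply: leq_trans (leq_blen le_n) _; case: (ts) => [|t ts'] //=.
    by rewrite dsize_cons [X in _ <= X + _ + _]/dsize /=; lia.
  have : j * (P (dsize ts) + 1) <= dsize ts * (P (dsize ts) + 1) by apply: leq_mul; lia.
  lia.
Qed.

Lemma poly_parse_list : poly_parser (parse_list p).
Proof.
have fp_items := fp_parse_items; split; last exact: dsize_parse_items.
by rewrite /parse_list; fp.
Qed.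
End PolyParsers.

Definition parses {A : Type} (p : parser A) (x : A) (s : seq nat) : Prop :=
  forall r, p (s ++ r) = (x, r).

Lemma parses_nats s : parses parse_nats s (size s :: s).
Proof. by move=> r; rewrite /parse_nats /= take_size_cat // drop_size_cat. Qed.

Lemma parses_fraction f : parses parse_fraction f [:: f.1; f.2].
Proof. by case: f. Qed.

Lemma parses_pair {A B : Type} (p : parser A) (q : parser B) x y s t :
  parses p x s -> parses q y t -> parses (parse_pair p q) (x, y) (s ++ t).
Proof. by move=> p_x q_y r; rewrite /parse_pair -catA p_x /= q_y. Qed.

Definition list_tokens {A : Type} (g : A -> seq nat) (l : seq A) : seq nat :=
  size l :: flatten (map g l).

Lemma parses_list {A : Type} (p : parser A) (g : A -> seq nat) l :
  (forall x, 0 < size (g x)) -> (forall x, parses p x (g x)) ->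
  parses (parse_list p) l (list_tokens g l).
Proof.
move=> g_gt0 p_g r; rewrite /parse_list /parse_items cat_cons [head _ _]/= [behead _]/=.
have items acc (c : seq nat) : size l <= size c ->
    foldl (fun st (_ : nat) => parse_item p st) (size l, (flatten (map g l) ++ r, acc)) c
    = (0, (r, catrev l acc)).
  elim: l acc c => [|x l IH] acc c /=; first by move=> _; elim: c.
  case: c => // e c /= le_c; rewrite {2}/parse_item /= subn1 -catA p_g /=.
  by rewrite IH.
rewrite items /=; first by rewrite catrevE cats0 revK.
rewrite size_cat; apply: leq_trans (leqnSn _); apply: leq_trans (leq_addr _ _).
by elim: (l) => //= x l' IH; rewrite size_cat; have := g_gt0 x; lia.
Qed.

(** ** The input *)

Notation parsed := (seq nat * seq (seq nat * fraction) * fraction)%type.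

Definition parse_constraint : parser parsed :=
  parse_pair (parse_pair parse_nats (parse_list (parse_pair parse_nats parse_fraction)))
    parse_fraction.

Definition parse_input : parser (seq nat * seq parsed) :=
  parse_pair parse_nats (parse_list parse_constraint).

Lemma fp_parse_input : FP parse_input.
Proof.
have poly_entry := poly_parse_pair poly_parse_nats poly_parse_fraction.
have poly_constraint := poly_parse_pair
  (poly_parse_pair poly_parse_nats (poly_parse_list poly_entry)) poly_parse_fraction.
by have [] := poly_parse_pair poly_parse_nats (poly_parse_list poly_constraint).
Qed.
#[global] Hint Resolve fp_parse_input : fpdb.

Definition fraction_of (q : rat) : fraction := (`|numq q|%N, `|denq q|%N).

Definition parsed_of (c : constraint) : parsed :=
  (cvars c, map (fun e : seq nat * rat => (e.1, fraction_of e.2)) (csupp c),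
   fraction_of (cdef c)).

Definition fraction_tokens (f : fraction) : seq nat := [:: f.1; f.2].

Definition entry_tokens (e : seq nat * fraction) : seq nat :=
  (size e.1 :: e.1) ++ fraction_tokens e.2.

Definition constraint_tokens (c : parsed) : seq nat :=
  ((size c.1.1 :: c.1.1) ++ list_tokens entry_tokens c.1.2) ++ fraction_tokens c.2.

Definition input_tokens (D : seq nat) (I : seq parsed) : seq nat :=
  (size D :: D) ++ list_tokens constraint_tokens I.

Lemma enc_list_encode {A : Type} (f : A -> seq bool) (g : A -> seq nat) l :
  (forall x, f x = encode (g x)) -> enc_list f l = encode (list_tokens g l).
Proof.
move=> fg; rewrite /enc_list /list_tokens /encode /=; congr (_ ++ _).
by elim: l => //= x l ->; rewrite fg map_cat flatten_cat.
Qed.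

Lemma enc_nats_encode s : enc_list enc_nat s = encode (size s :: s).
Proof. by []. Qed.

Lemma list_tokens_map {A B : Type} (h : A -> B) (g : B -> seq nat) l :
  list_tokens g (map h l) = list_tokens (fun x => g (h x)) l.
Proof. by rewrite /list_tokens size_map -map_comp. Qed.

Lemma enc_input_encode d I :
  enc_input d I = encode (input_tokens (iota 0 d) (map parsed_of I)).
Proof.
rewrite /enc_input /input_tokens encode_cat enc_nats_encode list_tokens_map.
congr (_ ++ _); apply: enc_list_encode => c.
rewrite /enc_constraint /constraint_tokens !encode_cat enc_nats_encode -catA.
congr (_ ++ (_ ++ _)); last by rewrite /enc_rat /encode /= cats0.
rewrite /= list_tokens_map; apply: enc_list_encode => e.
by rewrite /entry_tokens encode_cat enc_nats_encode /enc_rat {3}/encode /= cats0.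
Qed.

Lemma parses_input D I : parses parse_input (D, I) (input_tokens D I).
Proof.
apply: parses_pair; first exact: parses_nats.
apply: parses_list => [c|[[v es] w]]; first by [].
apply: parses_pair; last exact: parses_fraction.
apply: parses_pair; first exact: parses_nats.
apply: parses_list => [e|[t f]]; first by [].
by apply: parses_pair; [exact: parses_nats | exact: parses_fraction].
Qed.

Definition decode (v : nat) : seq nat * seq parsed := (parse_input (tokens (bits v))).1.

Lemma fp_decode : FP decode.
Proof. by rewrite /decode; fp. Qed.
#[global] Hint Resolve fp_decode : fpdb.

Lemma decode_enc_input d I z :
  decode (number_of_bits (enc_input d I ++ nseq z false)) =
  (iota 0 d, map parsed_of I).
Proof.
by rewrite /decode bits_number enc_input_encode tokens_encode parses_input.
Qed.

(** * From functions to programs *)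

Definition reaches (c : cmd) (m : memory) (t : nat) (Q : memory -> Prop) : Prop :=
  exists m' t', [/\ exec c m m' t', t' <= t & Q m'].

Lemma reaches_seq c1 c2 m t1 t2 (Q1 Q : memory -> Prop) :
  reaches c1 m t1 Q1 -> (forall m1, Q1 m1 -> reaches c2 m1 t2 Q) ->
  reaches (Cseq c1 c2) m (t1 + t2) Q.
Proof.
case=> m1 [u1 [ex1 time1 Q1m1]] reach2; have [m2 [u2 [ex2 time2 Qm2]]] := reach2 _ Q1m1.
by exists m2, (u1 + u2); split; [apply: Exec_seq ex1 ex2 | apply: leq_add |].
Qed.

Lemma reaches_block s m t (Q : memory -> Prop) : all basic s ->
  (block_effect s m).2 <= t -> Q (block_effect s m).1 -> reaches (block s) m t Q.
Proof. by move=> basic_s le_t Qm; do 2?eexists; split; first exact: exec_block. Qed.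

Lemma runs_reaches c k lo m h t (Q : memory -> Prop) : runs c k lo m h t Q ->
  reaches c m t (fun m' => m 0 <= m' 0 <= m 0 + h /\ Q m').
Proof.
by case=> m' [u [ex [_ _ le_heap] heap time Qm']]; exists m', u; rewrite le_heap heap.
Qed.

Lemma block_effect_cat s1 s2 m :
  block_effect (s1 ++ s2) m =
  ((block_effect s2 (block_effect s1 m).1).1,
   (block_effect s1 m).2 + (block_effect s2 (block_effect s1 m).1).2).
Proof.
elim: s1 m => [|i s1 IH] m /=; first by case: (block_effect s2 m).
by rewrite IH /= addnA.
Qed.

Definition spares (j : nat) (i : instr) : bool :=
  match i with
  | Iconst r _ | Iadd r _ _ | Isub r _ _ | Imul r _ _ | Idiv r _ _ | Iload r _ => r != j
  | _ => false
  end.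

Lemma block_effect_spared j s m : all (spares j) s -> (block_effect s m).1 j = m j.
Proof.
elim: s m => //= i s IH m /andP[spares_j /IH->].
by case: i spares_j => //= *; rewrite updE eq_sym ifN.
Qed.

Lemma blen_lt8 i : i < 8 -> blen i <= 3.
Proof. by move=> lt_i; apply: leq_trans (blen_ltn (b := 3) lt_i) _. Qed.

(* The input bits fill the registers from 1 on. The first [K] of them, which are
   needed as working registers, are packed into register 0 behind the length of
   the input; the other bits are then appended in register 5. *)
Section Loader.
Variables (K : nat) (x : seq bool).
Hypothesis K_ge8 : 8 <= K.
Local Notation m0 := (init_mem x).
Local Notation n := (size x).

Definition padded : seq bool := x ++ nseq (K - n) false.

Definition word_bound : nat := 2 * n + K + 4.

Local Notation W := word_bound.

Lemma size_padded : size padded = maxn n K.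
Proof. by rewrite size_cat size_nseq; lia. Qed.

Lemma init_mem_bit i : m0 i.+1 = nth false padded i.
Proof.
rewrite /init_mem /= nth_cat nth_nseq if_same.
case: (ltnP i n) => lt_i; first exact: nth_map.
by rewrite nth_default // size_map.
Qed.

Lemma append_padded v j : j < size padded ->
  append_bits v (take j.+1 padded) = 2 * append_bits v (take j padded) + m0 j.+1.
Proof. by move=> lt_j; rewrite (take_nth false) // append_bits_rcons init_mem_bit. Qed.

Lemma blen_append v j : v <= n.+1 -> j <= n + K ->
  blen (append_bits v (take j padded)) <= W.
Proof.
move=> le_v le_j; have lt_n : n < 2 ^ n by exact: ltn_expl.
suff lt_pow : append_bits v (take j padded) < 2 ^ (n + j + 2).
  by apply: leq_trans (blen_ltn lt_pow) _; rewrite /word_bound; lia.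
have le_size : 2 ^ size (take j padded) <= 2 ^ j
  by rewrite leq_exp2l // size_take_min geq_minl.
rewrite append_bitsE !expnD; have := append_bits_lt (take j padded).
by have := expn_gt0 2 j; nia.
Qed.

Fixpoint pack_code (j : nat) : seq instr :=
  if j is j'.+1 then pack_code j' ++ [:: Iadd 0 0 0; Iadd 0 0 j] else [::].

Lemma basic_pack_code j : all basic (pack_code j).
Proof. by elim: j => //= j IH; rewrite all_cat IH. Qed.

Lemma pack_codeP j : j <= K -> let r := block_effect (pack_code j) m0 in
  [/\ r.1 0 = append_bits n (take j padded), forall i, 0 < i -> r.1 i = m0 i
    & r.2 <= j * (10 + 8 * W)].
Proof.
elim: j => [|j IH] lt_j /=; first by rewrite take0.
have [val0 same time] := IH (ltnW lt_j); rewrite block_effect_cat.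
have lt_padded : j < size padded by rewrite size_padded; lia.
have := append_padded n lt_padded; set v := append_bits n (take j padded) in val0 *.
move=> val_next; split=> /=.
- by rewrite !updE /= val0 same // val_next; lia.
- by move=> i i_gt0; simpl_upd; rewrite same.
rewrite !updE /= val0 same // mulSn addnC; apply: leq_add time.
have blen_v : blen v <= W by apply: blen_append; lia.
have blen_2v : blen (v + v) <= W.
  apply: leq_trans (leq_blen (_ : v + v <= append_bits n (take j.+1 padded))) _.
    by rewrite val_next; lia.
  by apply: blen_append; lia.
have blen_bit : blen (m0 j.+1) <= 1 by rewrite init_mem_bit; case: nth.
have blen_j : blen j.+1 <= W by apply: leq_trans (blen_leS _) _; rewrite /word_bound; lia.
by rewrite blen0; lia.
Qed.

Definition setup_code : seq instr :=
  [:: Iconst 2 (2 ^ K); Idiv 3 0 2; Imul 4 3 2; Isub 5 0 4; Iadd 5 5 2;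
      Iconst 1 (K + 2); Iadd 0 3 1; Iconst 6 K.+1; Iconst 1 K; Isub 7 3 1].

(* State of the loop when the bits up to the [j]-th have been appended. *)
Definition loaded (j : nat) (m : memory) : Prop :=
  [/\ m 0 = n + K + 2, m 5 = append_bits 1 (take j padded), m 6 = j.+1, m 7 = n - j
    & forall i, K < i -> m i = m0 i].

Lemma setup_codeP m : m 0 = append_bits n (take K padded) ->
  (forall i, 0 < i -> m i = m0 i) ->
  let r := block_effect setup_code m in loaded K r.1 /\ r.2 <= 500 + 100 * W.
Proof.
move=> val0 same; have size_word : size (take K padded) = K.
  by rewrite size_takel // size_padded leq_maxr.
have := append_bits_lt (take K padded); rewrite size_word => lt_w.
have valE v : append_bits v (take K padded) = v * 2 ^ K + append_bits 0 (take K padded).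
  by rewrite append_bitsE size_word.
have div_val : m 0 %/ 2 ^ K = n.
  by rewrite val0 valE divnMDl ?expn_gt0 // divn_small // addn0.
split.
  split; last by move=> i lt_i; rewrite block_effect_spared ?same //=; lia.
  - by rewrite /= /upd /= div_val addnA.
  - by rewrite /= /upd /= div_val val0 (valE n) (valE 1) addKn mul1n addnC.
  - by rewrite /= /upd.
  - by rewrite /= /upd /= div_val.
have blen_val : blen (m 0) <= W.
  by rewrite val0; apply: blen_append; lia.
have blen_small v : v <= n + K + 3 -> blen v <= W.
  by move=> le_v; apply: leq_trans (blen_leS _) _; rewrite /word_bound; lia.
have blen_le_val v : v <= m 0 -> blen v <= W.
  by move=> le_v; apply: leq_trans (leq_blen le_v) blen_val.
have blen_pow : blen (2 ^ K) <= W by rewrite /blen trunc_expnK // /word_bound; lia.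
rewrite /= /upd /= div_val; have [le_mul le_sub] :
  n * 2 ^ K <= m 0 /\ m 0 - n * 2 ^ K <= m 0.
  by rewrite val0 valE; lia.
have bl i : i < 8 -> blen i <= 3 := @blen_lt8 i.
have := bl 2 isT; have := bl 3 isT; have := bl 4 isT; have := bl 5 isT.
have := bl 6 isT; have := bl 7 isT; have := blen_small n; have := blen_small K.
have := blen_small K.+1; have := blen_small (K + 2).
have := blen_le_val _ le_mul; have := blen_le_val _ le_sub; rewrite ?blen0 ?blen1; lia.
Qed.

Definition load_body : seq instr :=
  [:: Iload 4 6; Iadd 5 5 5; Iadd 5 5 4; Iconst 1 1; Iadd 6 6 1; Isub 7 7 1].

Lemma load_bodyP j m : K <= j < n -> loaded j m ->
  let r := block_effect load_body m in
  loaded j.+1 (upd r.1 1 0) /\ r.2 <= 100 + 20 * W.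
Proof.
move=> range_j [heap val addr count same].
have lt_padded : j < size padded by rewrite size_padded; lia.
have bit_j : m (m 6) = m0 j.+1 by rewrite addr same //; lia.
have val_next := append_padded 1 lt_padded.
split.
  split.
  - by rewrite updE block_effect_spared.
  - by rewrite val_next /= !updE /= bit_j val; lia.
  - by rewrite /= !updE /= addr addn1.
  - by rewrite /= !updE /= count; lia.
  - by move=> i lt_i; rewrite updE ifF ?block_effect_spared ?same //=; lia.
rewrite /= !updE /= bit_j addr val count.
set v := append_bits 1 (take j padded) in val_next *.
have blen_v : blen v <= W by apply: blen_append; lia.
have blen_2v : blen (v + v) <= W.
  apply: leq_trans (leq_blen (_ : v + v <= append_bits 1 (take j.+1 padded))) _.
    by rewrite val_next; lia.
  by apply: blen_append; lia.
have blen_bit : blen (m0 j.+1) <= 1 by rewrite init_mem_bit; case: nth.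
have blen_small u : u <= n + K + 3 -> blen u <= W.
  by move=> le_u; apply: leq_trans (blen_leS _) _; rewrite /word_bound; lia.
have bl i : i < 8 -> blen i <= 3 := @blen_lt8 i.
have := bl 4 isT; have := bl 5 isT; have := bl 6 isT; have := bl 7 isT.
have := blen_small j.+1; have := blen_small (n - j); rewrite ?blen0 ?blen1; lia.
Qed.

Lemma reaches_load d m : d + K <= maxn n K -> loaded (maxn n K - d) m ->
  reaches (Cwhile 7 (block load_body)) m (d.+1 * (200 + 30 * W)) (loaded (maxn n K)).
Proof.
elim: d m => [|d IH] m le_d loaded_m.
  rewrite subn0 in loaded_m; exists m, (1 + blen 7 + blen (m 7)).
  have m7 : m 7 = 0 by case: loaded_m => _ _ _ -> _; lia.
  by split=> //; [apply: Exec_stop | rewrite m7].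
have range_j : K <= maxn n K - d.+1 < n by lia.
have [loaded_next time] := load_bodyP range_j loaded_m.
have step_j : (maxn n K - d.+1).+1 = maxn n K - d by lia.
rewrite step_j in loaded_next; have [|m2 [t2 [ex2 time2 loaded2]]] := IH _ _ loaded_next.
  by lia.
have m7 : m 7 = n - (maxn n K - d.+1) by case: loaded_m.
eexists; eexists; split; last exact: loaded2.
  by apply: Exec_loop ex2; [rewrite m7; lia | apply: exec_block].
rewrite [X in _ <= X]mulSn; apply: leq_add time2.
have blen_m7 : blen (m 7) <= W by rewrite m7; apply: leq_trans (blen_leS _) _;
rewrite /word_bound; lia.
by have := @blen_lt8 7 isT; lia.
Qed.

Definition load_code : cmd :=
  Cseq (block (pack_code K)) (Cseq (block setup_code) (Cwhile 7 (block load_body))).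

Lemma reaches_load_code :
  reaches load_code m0 ((K + n + 2) * (700 + 150 * W))
    (fun m => m 0 = n + K + 2 /\ m 5 = number_of_bits padded).
Proof.
have [val0 same time1] := pack_codeP (leqnn K).
have [loaded2 time2] := setup_codeP val0 same.
have : reaches load_code m0
    (K * (10 + 8 * W) + (500 + 100 * W + (n - K).+1 * (200 + 30 * W)))
    (fun m => m 0 = n + K + 2 /\ m 5 = number_of_bits padded).
  apply: (reaches_seq (Q1 := eq (block_effect (pack_code K) m0).1)) => [|_ <-].
    by apply: reaches_block _ time1 _; first exact: basic_pack_code.
  apply: (reaches_seq (Q1 := loaded K)) => [|m loaded_m].
    by apply: reaches_block _ time2 _.
  have [||m' [t [ex time [heap val _ _ _]]]] := @reaches_load (n - K) m; first lia.
    by rewrite (_ : maxn n K - (n - K) = K) //; lia.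
  exists m', t; split=> //; split=> //.
  by rewrite val -size_padded take_size.
case=> m' [t [ex time post]]; exists m', t; split=> //.
by apply: leq_trans time _; nia.
Qed.
End Loader.

Definition return_code : seq instr :=
  [:: Iload 3 2; Iconst 1 1; Iadd 2 2 1; Iload 4 2; Iconst 1 0; Iadd 0 3 1; Iadd 1 4 1].

Lemma return_codeP lo m (y : nat * nat) n : 5 <= lo -> holds lo 2 y m ->
  dsize y + blen (m 0) <= n -> let r := block_effect return_code m in
  (r.1 0, r.1 1) = y /\ r.2 <= 200 + 20 * n.
Proof.
case: y => a b lo5 hy budget; have w2 := holds_word hy.
case: hy => lo_w w_hi; rewrite /represents /= => ra rb.
have size_y : dsize (a, b) = blen a + blen b + 1 by [].
split; first by rewrite /= !updE /= ?addn1; simpl_upd; rewrite ra rb !addn0.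
rewrite /= !updE /= !addn1; simpl_upd; rewrite ra rb.
have le1 : blen (m 2).+1 <= blen (m 0) by apply: leq_blen; lia.
have bl i : i < 8 -> blen i <= 3 := @blen_lt8 i.
have := bl 2 isT; have := bl 3 isT; have := bl 4 isT; rewrite ?blen0 ?blen1; lia.
Qed.

Lemma fp_program (f : nat -> nat * nat) : FP f ->
  exists (p : program) (c k : nat), forall x : seq bool,
  exists (z fuel : nat) (m : memory) (cost : nat),
    [/\ run p fuel 0 (init_mem x) = Some (m, cost),
        cost <= c * (size x).+1 ^ k
      & (m 0, m 1) = f (number_of_bits (x ++ nseq z false))].
Proof.
move=> [nr [code [P [polyP comp_f size_f]]]].
pose K := nr + 8; have K_ge8 : 8 <= K by rewrite /K; lia.
pose prog := Cseq (load_code K) (Cseq (copy 2 5) (Cseq (code 2) (block return_code))).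
pose T n := (K + n + 2) * (700 + 150 * (2 * n + K + 4)) +
  (10 + 3 * (3 * (2 * n + K + 4)) +
  (P (3 * (2 * n + K + 4)) + (200 +
      20 * (2 * P (3 * (2 * n + K + 4)) + (3 * (2 * n + K + 4)) + 1)))).
have [_ [b le_T]] : poly_bounded T by rewrite /T; poly.
exists (compile 0 prog), (slowdown (compile 0 prog) * 2 ^ b), b => x.
set n := size x; pose N := 3 * (2 * n + K + 4); exists (K - n).
suff [m' [t [ex time result]]] : reaches prog (init_mem x) (T n)
    (fun m' => (m' 0, m' 1) = f (number_of_bits (padded K x))).
  have [fuel [t' [run_p time_p]]] := run_compile ex.
  exists fuel, m', t'; split=> //; apply: leq_trans time_p _.
  rewrite -mulnA leq_mul2l; apply/orP; right;
  apply: leq_trans time (leq_trans (le_T _) _).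
  by rewrite -expnMn; case: (b) => // b'; rewrite leq_exp2r //; lia.
set v := number_of_bits _.
apply: reaches_seq (reaches_load_code x K_ge8) _ => m1 [heap1 val1].
have size_v : dsize v <= 2 * n + K + 4.
  rewrite /v /number_of_bits -[padded K x]take_size.
  by apply: blen_append; rewrite ?size_padded -/n; lia.
pose lo := n + K + 2; have blen1 := blen_leS (m1 0).
have hv1 : holds lo 5 v m1 by exact: val1.
have copy_v : runs (copy 2 5) 2 lo m1 0 (10 + 3 * N) (holds lo 2 v).
  by apply: runs_copy hv1 _; rewrite /lo /N; lia.
apply: reaches_seq (runs_reaches copy_v) _ => m2 [/andP[le2 heap2] hv2].
rewrite addn0 in heap2; have blen2 := leq_blen heap2.
have lom2 : lo <= m2 0 by rewrite /lo -heap1.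
have budget2 : dsize v + blen (m2 0) <= N by rewrite /N; lia.
have run_f : runs (code 2) 2 lo m2 (P (dsize v)) (P N) (holds lo 2 (f v)).
  by apply: comp_f hv2 budget2; rewrite /lo /K //; lia.
apply: reaches_seq (runs_reaches run_f) _ => m3 [/andP[le3 heap3] hv3].
have size_fv : dsize (f v) <= P (dsize v) := size_f v.
have le_P : P (dsize v) <= P N by apply: polyP.1; rewrite /N; lia.
have blen3 := blen_heap heap3.
have [||result time] := return_codeP (n := 2 * P N + N + 1) _ hv3;
  first by rewrite /lo; lia.
  by lia.
by apply: reaches_block _ time _.
Qed.

(** * The algorithm *)

(* Partial assignments are lists of (variable, value) pairs. *)
Notation assignment := (seq (nat * nat))%type.
Notation entry := (assignment * fraction)%type.
Notation table := (seq nat * seq entry * fraction)%type.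

Definition table_vars (c : table) : seq nat := c.1.1.
Definition table_entries (c : table) : seq entry := c.1.2.
Definition table_default (c : table) : fraction := c.2.
Definition parsed_vars (c : parsed) : seq nat := c.1.1.

Definition remove_all (r e : seq nat) : seq nat := filter (fun v => v \notin r) e.

Definition candidates (E : seq (seq nat)) (out : seq nat) : seq nat :=
  filter (fun x => (x \notin out) && nest_point (map (remove_all out) E) x)
    (hvertices E).

Definition elim_order (E : seq (seq nat)) : seq nat :=
  foldl (fun out (_ : nat) => out ++ take 1 (candidates E out)) [::] (hvertices E).

Definition radix_step (J : seq table) (x : nat) : seq table :=
  filter (fun c => x \notin table_vars c) J ++ filter (fun c => x \in table_vars c) J.

Definition radix_sort (J : seq table) (xs : seq nat) : seq table := foldl radix_step J xs.

Definition lookup (a : assignment) (y : nat) : nat :=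
  foldr (fun p r => if y == p.1 then p.2 else r) 0 a.

Definition matches (a : assignment) (s : nat -> nat) : bool :=
  all (fun p : nat * nat => s p.1 == p.2) a.

Definition select (es : seq entry) (default : fraction) (s : nat -> nat) : fraction :=
  foldr (fun (e : entry) (r : fraction) => if matches e.1 s then e.2 else r) default es.

Definition table_eval (c : table) (s : nat -> nat) : fraction :=
  select (table_entries c) (table_default c) s.

Definition frac_prod (l : seq fraction) : fraction :=
  (prodn (map fst l), prodn (map snd l)).

Definition frac_sum (l : seq fraction) : fraction :=
  (sumn (map (fun f : fraction => f.1 * (prodn (map snd l) %/ f.2)) l),
   prodn (map snd l)).

Definition chain_sum (D : seq nat) (x : nat) (chain : seq table) (a : assignment) :
    fraction :=
  frac_sum (map (fun b =>
    frac_prod (map (fun c => table_eval c (lookup ((x, b) :: a))) chain)) D).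

(* Clamping keeps the weights short on inputs that are not beta-acyclic; on the
   others it has no effect. *)
Definition clamp (M n : nat) : nat := maxn 1 (minn M n).

Definition frac_ratio (M : nat) (f g : fraction) : fraction :=
  (clamp M ((f.1 * g.2) %/ gcdn (f.1 * g.2) (f.2 * g.1)),
   clamp M ((f.2 * g.1) %/ gcdn (f.1 * g.2) (f.2 * g.1))).

Definition drop_var (x : nat) (a : assignment) : assignment :=
  filter (fun p : nat * nat => p.1 != x) a.

Definition elim_entry (D : seq nat) (M x : nat) (chain : seq table) (c : table)
    (e : entry) : entry :=
  (drop_var x e.1,
   frac_ratio M (chain_sum D x (chain ++ [:: c]) (drop_var x e.1))
     (chain_sum D x chain (drop_var x e.1))).

Definition elim_table (D : seq nat) (M x : nat) (chain : seq table) (c : table) : table :=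
  (filter (fun v => v != x) (table_vars c),
   map (elim_entry D M x chain c) (table_entries c), table_default c).

Definition elim_step (D : seq nat) (M x : nat) (pre : seq table) (c : table) : table :=
  if x \in table_vars c then
    elim_table D M x (filter (fun c' => x \in table_vars c') pre) c
  else c.

Definition splits {T : Type} (s : seq T) : seq (seq T * T) :=
  (foldl (fun (st : seq T * seq (seq T * T)) e =>
            (st.1 ++ [:: e], st.2 ++ [:: (st.1, e)])) ([::], [::]) s).2.

Definition elim_var (D : seq nat) (M : nat) (J : seq table) (x : nat) : seq table :=
  map (fun p : seq table * table => elim_step D M x p.1 p.2) (splits J).

Definition elim_all (D : seq nat) (M : nat) (J : seq table) (xs : seq nat) : seq table :=
  foldl (elim_var D M) J xs.

Definition pow_size {T : Type} (b : nat) (s : seq T) : nat := prodn (map (fun=> b) s).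

Definition weights (I : seq parsed) : seq fraction :=
  flatten (map (fun c : parsed => c.2 :: map snd c.1.2) I).

Definition denominator (I : seq parsed) : nat := prodn (map snd (weights I)).

Definition weight_bound (I : seq parsed) : nat :=
  1 + denominator I * sumn (map fst (weights I)).

Definition base (D xs : seq nat) (I : seq parsed) : nat :=
  pow_size (size D) xs * pow_size (weight_bound I) I + 1.

Definition clamp_bound (D xs : seq nat) (I : seq parsed) : nat :=
  pow_size (size D) xs * pow_size (weight_bound I * base D xs I) I + 1.

Definition positive_weight (d b : nat) (f : fraction) : fraction :=
  (f.1 * (d %/ f.2) * b + 1, 1).

Definition table_of (d b : nat) (c : parsed) : table :=
  (parsed_vars c,
   map (fun e : seq nat * fraction =>
       (zip (parsed_vars c) e.1, positive_weight d b e.2)) c.1.2,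
   positive_weight d b c.2).

Definition tables (D xs : seq nat) (I : seq parsed) : seq table :=
  map (table_of (denominator I) (base D xs I)) I.

Definition final_tables (D xs : seq nat) (I : seq parsed) : seq table :=
  elim_all D (clamp_bound D xs I) (radix_sort (tables D xs I) xs) xs.

Definition final_value (J : seq table) : fraction :=
  frac_prod (map (fun c => table_eval c (lookup [::])) J).

Definition round_value (D xs : seq nat) (I : seq parsed) (f : fraction) : fraction :=
  ((f.1 * pow_size (size D) xs) %/ (f.2 * pow_size (base D xs I) I),
   pow_size (denominator I) I).

Definition solve_ordered (D xs : seq nat) (I : seq parsed) : fraction :=
  round_value D xs I (final_value (final_tables D xs I)).

Definition solve (D : seq nat) (I : seq parsed) : fraction :=
  solve_ordered D (elim_order (map parsed_vars I)) I.

Definition algorithm (v : nat) : fraction := solve (decode v).1 (decode v).2.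

(** ** Running time *)

Lemma fp_table_vars : FP table_vars. Proof. by rewrite /table_vars; fp. Qed.
Lemma fp_table_entries : FP table_entries. Proof. by rewrite /table_entries; fp. Qed.
Lemma fp_table_default : FP table_default. Proof. by rewrite /table_default; fp. Qed.
Lemma fp_parsed_vars : FP parsed_vars. Proof. by rewrite /parsed_vars; fp. Qed.
Lemma fp_hvertices : FP hvertices. Proof. by rewrite /hvertices; fp. Qed.
#[global] Hint Resolve fp_table_vars fp_table_entries fp_table_default fp_parsed_vars
  fp_hvertices : fpdb.

Lemma fp_candidates : FP (fun p : seq (seq nat) * seq nat => candidates p.1 p.2).
Proof. by rewrite /candidates /nest_point /subedge /remove_all; fp. Qed.
#[global] Hint Resolve fp_candidates : fpdb.

Lemma fp_elim_order : FP elim_order.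
Proof.
have [P polyP size_vertices] := fp_size_bound fp_hvertices.
apply: (fp_foldl_add (b := fun E out (_ : nat) => out ++ take 1 (candidates E out))
  (i := fun=> [::]) (l := hvertices) _ _ _ (R := P)); [by fp | by fp | by fp | by poly |].
move=> E out e; apply: leq_trans (leqnSn _) _; rewrite dsize_cat leq_add2l.
apply: leq_trans (dsize_take _ _) (leq_trans (dsize_filter _ _) _).
by apply: leq_trans (size_vertices E) _; apply: polyP.1; rewrite leq_addr.
Qed.

Lemma fp_radix_sort : FP (fun p : seq table * seq nat => radix_sort p.1 p.2).
Proof.
apply: (fp_foldl_add (b := fun _ => radix_step) _ _ _ (R := fun=> 0));
  [|by fp|by fp|by poly|].
  by rewrite /radix_step; fp.
by move=> p J x; rewrite /radix_step dsize_filterC addn0.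
Qed.

Lemma fp_lookup : FP (fun p : assignment * nat => lookup p.1 p.2).
Proof.
apply: (fp_foldr_add (b := fun (x : assignment * nat) (p : nat * nat) (r : nat) =>
   if x.2 == p.1 then p.2 else r) (R := id)); [by fp | by fp | by fp | by poly |].
by move=> x p r; case: ifP => _; [rewrite [dsize p]/dsize /= | ]; lia.
Qed.
#[global] Hint Resolve fp_elim_order fp_radix_sort fp_lookup : fpdb.

Lemma fp_table_eval {X : Type} {DX : Data X} (f : X -> table) (g : X -> assignment) :
  FP f -> FP g -> FP (fun x => table_eval (f x) (lookup (g x))).
Proof.
move=> fp_f fp_g.
have fp_eval : FP (fun p : table * assignment => table_eval p.1 (lookup p.2)).
  apply: (fp_foldr_add (b := fun (x : table * assignment) (e : entry) (r : fraction) =>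
     if matches e.1 (lookup x.2) then e.2 else r) (R := id));
    [by rewrite /matches; fp | by fp | by fp | by poly |].
  by move=> x e r; case: ifP => _; [rewrite [dsize e]/dsize /= | ]; lia.
exact: (fp_app2 (F := fun c a => table_eval c (lookup a)) fp_eval fp_f fp_g).
Qed.

Ltac fp_higher_order ::=
  lazymatch goal with
  | |- FP (fun x => map (@?b x) (@?l x)) => refine (fp_map (b := b) (l := l) _ _); fp
  | |- FP (fun x => filter (@?b x) (@?l x)) =>
      refine (fp_filter (b := b) (l := l) _ _); fp
  | |- FP (fun x => all (@?b x) (@?l x)) => refine (fp_all (b := b) (l := l) _ _); fp
  | |- FP (fun x => has (@?b x) (@?l x)) => refine (fp_has (b := b) (l := l) _ _); fp
  | |- FP (fun x => in_mem (@?f x) (mem (@?g x))) =>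
      refine (fp_mem (f := f) (g := g) _ _); fp
  | |- FP (fun x => table_eval (@?f x) (lookup (@?g x))) =>
      refine (fp_table_eval (f := f) (g := g) _ _); fp
  end.

Lemma fp_frac_prod : FP frac_prod.
Proof. by rewrite /frac_prod; fp. Qed.

Lemma fp_frac_sum : FP frac_sum.
Proof. by rewrite /frac_sum; fp. Qed.
#[global] Hint Resolve fp_frac_prod fp_frac_sum : fpdb.

Lemma fp_chain_sum : FP (fun p : seq nat * (nat * (seq table * assignment)) =>
  chain_sum p.1 p.2.1 p.2.2.1 p.2.2.2).
Proof. by rewrite /chain_sum; fp. Qed.

Lemma fp_clamp : FP (fun p : nat * nat => clamp p.1 p.2).
Proof. by rewrite /clamp; fp. Qed.
#[global] Hint Resolve fp_chain_sum fp_clamp : fpdb.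

Lemma fp_frac_ratio : FP (fun p : nat * (fraction * fraction) =>
    frac_ratio p.1 p.2.1 p.2.2).
Proof. by rewrite /frac_ratio; fp. Qed.

Lemma fp_drop_var : FP (fun p : nat * assignment => drop_var p.1 p.2).
Proof. by rewrite /drop_var; fp. Qed.
#[global] Hint Resolve fp_frac_ratio fp_drop_var : fpdb.

Lemma fp_elim_table : FP (fun p : seq nat * (nat * (nat * (seq table * table))) =>
  elim_table p.1 p.2.1 p.2.2.1 p.2.2.2.1 p.2.2.2.2).
Proof. by rewrite /elim_table /elim_entry; fp. Qed.
#[global] Hint Resolve fp_elim_table : fpdb.

Lemma fp_elim_step : FP (fun p : seq nat * (nat * (nat * (seq table * table))) =>
  elim_step p.1 p.2.1 p.2.2.1 p.2.2.2.1 p.2.2.2.2).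
Proof. by rewrite /elim_step; fp. Qed.
#[global] Hint Resolve fp_elim_step : fpdb.

Lemma foldl_splits {T : Type} (s : seq T) :
  foldl (fun (st : seq T * seq (seq T * T)) e =>
           (st.1 ++ [:: e], st.2 ++ [:: (st.1, e)])) ([::], [::]) s = (s, splits s).
Proof.
rewrite /splits; elim/last_ind: s => // s e.
by rewrite -cats1 foldl_cat /= => ->.
Qed.

Lemma splits_rcons {T : Type} (s : seq T) e :
  splits (rcons s e) = rcons (splits s) (s, e).
Proof. by rewrite {1}/splits -cats1 foldl_cat foldl_splits /= cats1. Qed.

Lemma map_snd_splits {T : Type} (s : seq T) : map snd (splits s) = s.
Proof. by elim/last_ind: s => // s e IH; rewrite splits_rcons map_rcons IH. Qed.

Lemma fp_splits {E : Type} {DE : Data E} : FP (@splits E).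
Proof.
have fp_fold : FP (fun s : seq E => foldl (fun (st : seq E * seq (seq E * E)) e =>
   (st.1 ++ [:: e], st.2 ++ [:: (st.1, e)])) ([::], [::]) s); last by rewrite /splits; fp.
apply: (fp_foldl (b := fun _ (st : seq E * seq (seq E * E)) e =>
   (st.1 ++ [:: e], st.2 ++ [:: (st.1, e)])) _ _ _
   (Inv := fun s j st => dsize st.1 <= 1 + j * (dsize s + 1) /\
      dsize st.2 <= 1 + j * (3 + dsize s + j * (dsize s + 1)))
   (Q := fun n => 10 + n * (n + 1) + n * (3 + n + n * (n + 1)))).
- by fp.
- by fp.
- by fp.
- by poly.
- by [].
- move=> s j [u v] e size_e [/= size_u size_v].
  have size_u' : (dsize (u ++ [:: e])).+1 = dsize u + dsize [:: e] by exact: dsize_cat.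
  have size_v' : (dsize (v ++ [:: (u, e)])).+1 = dsize v + dsize [:: (u, e)].
    exact: dsize_cat.
  rewrite !dsize_cons !dsize_nil dsize_pair in size_u' size_v'.
  by split; nia.
- move=> s j [u v] le_j [/= size_u size_v]; rewrite dsize_pair.
  have lt_s := @ltn_size_dsize E DE s.
  have le_u : j * (dsize s + 1) <= dsize s * (dsize s + 1) by apply: leq_mul; lia.
  have : j * (3 + dsize s + j * (dsize s + 1)) <=
     dsize s * (3 + dsize s + dsize s * (dsize s + 1)) by apply: leq_mul; lia.
  lia.
Qed.
#[global] Hint Resolve fp_splits : fpdb.

Lemma fp_elim_var : FP (fun p : seq nat * (nat * (seq table * nat)) =>
  elim_var p.1 p.2.1 p.2.2.1 p.2.2.2).
Proof. by rewrite /elim_var; fp. Qed.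
#[global] Hint Resolve fp_elim_var : fpdb.

(* An upper bound for the size of a table whose weights have size at most [C];
   unlike the size, it does not grow under variable elimination. *)
Definition size_bound (C : nat) (c : table) : nat :=
  dsize (table_vars c) + sumn (map (fun e : entry => dsize e.1 + C + 2) (table_entries c))
  + C + 3.

Definition size_bounds (C : nat) (J : seq table) : nat :=
  1 + sumn (map (fun c => size_bound C c + 1) J).

Definition light (C : nat) (c : table) : bool :=
  (dsize (table_default c) <= C) &&
  all (fun e : entry => dsize e.2 <= C) (table_entries c).

Lemma dsize_le_size_bound C c : light C c -> dsize c <= size_bound C c.
Proof.
case: c => [[v s] w] /andP[/= size_w size_s].
rewrite /size_bound /table_vars /table_entries /= !dsize_pair.
have size_entries :
    dsize s <= 1 + sumn (map (fun e : entry => dsize e.1 + C + 2) s); last by lia.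
elim: s size_s => // -[e f] s IH /andP[/= size_f size_s]; rewrite dsize_cons dsize_pair.
by have := IH size_s; lia.
Qed.

Lemma size_bound_le C c : size_bound C c <= dsize c * C.+1.
Proof.
case: c => [[v s] w]; rewrite /size_bound /table_vars /table_entries /= !dsize_pair.
have size_entries :
    sumn (map (fun e : entry => dsize e.1 + C + 2) s) + C + 1 <= dsize s * C.+1.
  elim: s => [|[e f] s IH] /=; first by rewrite dsize_nil; lia.
  rewrite dsize_cons dsize_pair; have f_gt0 : 0 < dsize f by exact: dsize_gt0.
  nia.
have w_gt0 : 0 < dsize w by exact: dsize_gt0.
nia.
Qed.

Lemma dsize_le_size_bounds C J : all (light C) J -> dsize J <= size_bounds C J.
Proof.
elim: J => // c J IH /andP[light_c light_J]; rewrite dsize_cons /size_bounds /=.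
by have := IH light_J; have := dsize_le_size_bound light_c; rewrite /size_bounds; lia.
Qed.

Lemma size_bounds_le C J : size_bounds C J <= dsize J * C.+1.
Proof.
elim: J => [|c J IH]; first by rewrite /size_bounds /= dsize_nil; lia.
by rewrite dsize_cons; have := size_bound_le C c; move: IH; rewrite /size_bounds /=; nia.
Qed.

Lemma light_dsize C c : dsize c <= C -> light C c.
Proof.
case: c => [[v s] w]; rewrite !dsize_pair /light /= => le_C.
apply/andP; split; first lia.
have {le_C} : dsize s <= C by lia.
elim: s => // -[e f] s IH; rewrite dsize_cons dsize_pair /= => le_C.
by rewrite IH ?andbT; lia.
Qed.

Lemma all_light_dsize C J : dsize J <= C -> all (light C) J.
Proof.
by elim: J => // c J IH; rewrite dsize_cons => le_C /=; rewrite light_dsize ?IH; lia.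
Qed.

Section EliminationSize.
Variables (D : seq nat) (M x C : nat).
Hypothesis C_large : 2 * dsize M + 5 <= C.

Lemma size_bound_elim_step pre c : size_bound C (elim_step D M x pre c) <= size_bound C c.
Proof.
rewrite /elim_step; case: ifP => // _; case: c => [[v s] w].
rewrite /size_bound /table_vars /table_entries /= !leq_add2r; apply: leq_add.
  exact: dsize_filter.
rewrite -map_comp (eq_map (g := fun e => dsize (drop_var x e.1) + C + 2)) //.
by elim: s => //= e s IH; apply: leq_add IH; rewrite !leq_add2r dsize_filter.
Qed.

Lemma light_elim_step pre c : light C c -> light C (elim_step D M x pre c).
Proof.
rewrite /elim_step; case: ifP => // _; rewrite /light.
case/andP=> -> _ /=; apply/allP => e /mapP[e' _ ->] /=.
have size_clamp n : dsize (clamp M n) <= dsize M + 1.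
  have le_M : clamp M n <= M + 1 by rewrite /clamp; lia.
  by apply: leq_trans (leq_blen le_M) (leq_trans (blenD _ _) _).
have size_pair a b : dsize (clamp M a, clamp M b) <= C.
  by rewrite dsize_pair; have := size_clamp a; have := size_clamp b; lia.
exact: size_pair.
Qed.

Lemma size_bounds_elim_var J : size_bounds C (elim_var D M J x) <= size_bounds C J.
Proof.
rewrite /size_bounds leq_add2l /elim_var -map_comp -[in X in _ <= X](map_snd_splits J).
rewrite -map_comp; elim: (splits J) => //= -[pre c] s IH; apply: leq_add IH.
by rewrite leq_add2r size_bound_elim_step.
Qed.

Lemma light_elim_var J : all (light C) J -> all (light C) (elim_var D M J x).
Proof.
move=> light_J; apply/allP => c' /mapP[[pre c] split_c ->] /=; apply: light_elim_step.
have : c \in map snd (splits J) by apply/mapP; exists (pre, c).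
by rewrite map_snd_splits => /(allP light_J).
Qed.
End EliminationSize.

Definition weight_size (M : nat) (J : seq table) : nat := dsize J + 2 * dsize M + 5.

Lemma fp_elim_all : FP (fun p : seq nat * (nat * (seq table * seq nat)) =>
  elim_all p.1 p.2.1 p.2.2.1 p.2.2.2).
Proof.
pose C (p : seq nat * (nat * (seq table * seq nat))) := weight_size p.2.1 p.2.2.1.
apply: (fp_foldl (b := fun p J x => elim_var p.1 p.2.1 J x)
   (i := fun p => p.2.2.1) (l := fun p => p.2.2.2) _ _ _
   (Inv := fun p _ J => all (light (C p)) J /\
                        size_bounds (C p) J <= size_bounds (C p) p.2.2.1)
   (Q := fun n => n * (3 * n + 6))).
- by fp.
- by fp.
- by fp.
- by poly.
- by move=> p; split=> //; apply: all_light_dsize; rewrite /C /weight_size; lia.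
- move=> p j J x _ [light_J bound_J].
  have C_large : 2 * dsize p.2.1 + 5 <= C p by rewrite /C /weight_size; lia.
  split; first exact: light_elim_var.
  by apply: leq_trans bound_J; apply: size_bounds_elim_var.
- move=> p j J _ [light_J bound_J].
  apply: leq_trans (leq_trans (dsize_le_size_bounds light_J) bound_J) _.
  apply: leq_trans (size_bounds_le (C p) p.2.2.1) _.
  case: p {light_J bound_J} => D [M [J0 xs]]; rewrite /C /weight_size /= !dsize_pair.
  by apply: leq_mul; lia.
Qed.

Lemma fp_zip {A B : Type} {DA : Data A} {DB : Data B} :
  FP (fun p : seq A * seq B => zip p.1 p.2).
Proof.
pose step (st : seq A * seq (A * B)) (b : B) :=
  (behead st.1, st.2 ++ map (fun a => (a, b)) (take 1 st.1)).
have zipE s t acc : (foldl step (s, acc) t).2 = acc ++ zip s t.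
  elim: t s acc => [|b t IH] s acc /=; first by case: s => *; rewrite cats0.
  rewrite [step _ _]/step IH; case: s => [|a s] /=; last by rewrite take0 -catA.
  by case: (t); rewrite /= !cats0.
apply: (fp_ext (f := fun p => (foldl step (p.1, [::]) p.2).2)).
  by move=> p; rewrite zipE.
have fp_fold : FP (fun p : seq A * seq B => foldl step (p.1, [::]) p.2); last by fp.
apply: (fp_foldl_add (b := fun _ => step) (i := fun p => (p.1, [::])) _ _ _
  (R := fun n => n + 2)); [by rewrite /step; fp | by fp | by fp | by poly |].
move=> p [s t] b /=; rewrite !dsize_pair.
have size_cat : (dsize (t ++ map (fun a => (a, b)) (take 1 s))).+1 =
   dsize t + dsize (map (fun a => (a, b)) (take 1 s)) by exact: dsize_cat.
case: s size_cat => [|a s] /=; rewrite ?take0 /= ?dsize_cons ?dsize_nil ?dsize_pair; lia.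
Qed.

Lemma fp_pow_size {T : Type} {DT : Data T} : FP (fun p : nat * seq T => pow_size p.1 p.2).
Proof. by rewrite /pow_size; fp. Qed.

Lemma fp_weights : FP weights.
Proof. by rewrite /weights; fp. Qed.
#[global] Hint Resolve fp_elim_all fp_zip fp_pow_size fp_weights : fpdb.

Lemma fp_denominator : FP denominator.
Proof. by rewrite /denominator; fp. Qed.
#[global] Hint Resolve fp_denominator : fpdb.

Lemma fp_weight_bound : FP weight_bound.
Proof. by rewrite /weight_bound; fp. Qed.
#[global] Hint Resolve fp_weight_bound : fpdb.

Lemma fp_base : FP (fun p : seq nat * (seq nat * seq parsed) => base p.1 p.2.1 p.2.2).
Proof. by rewrite /base; fp. Qed.
#[global] Hint Resolve fp_base : fpdb.

Lemma fp_clamp_bound :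
  FP (fun p : seq nat * (seq nat * seq parsed) => clamp_bound p.1 p.2.1 p.2.2).
Proof. by rewrite /clamp_bound; fp. Qed.

Lemma fp_tables : FP (fun p : seq nat * (seq nat * seq parsed) => tables p.1 p.2.1 p.2.2).
Proof. by rewrite /tables /table_of /positive_weight; fp. Qed.
#[global] Hint Resolve fp_clamp_bound fp_tables : fpdb.

Lemma fp_final_tables :
  FP (fun p : seq nat * (seq nat * seq parsed) => final_tables p.1 p.2.1 p.2.2).
Proof. by rewrite /final_tables; fp. Qed.

Lemma fp_final_value : FP final_value.
Proof. by rewrite /final_value; fp. Qed.

Lemma fp_round_value : FP (fun p : seq nat * (seq nat * (seq parsed * fraction)) =>
  round_value p.1 p.2.1 p.2.2.1 p.2.2.2).
Proof. by rewrite /round_value; fp. Qed.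
#[global] Hint Resolve fp_final_tables fp_final_value fp_round_value : fpdb.

Lemma fp_solve_ordered :
  FP (fun p : seq nat * (seq nat * seq parsed) => solve_ordered p.1 p.2.1 p.2.2).
Proof. by rewrite /solve_ordered; fp. Qed.
#[global] Hint Resolve fp_solve_ordered : fpdb.

Lemma fp_solve : FP (fun p : seq nat * seq parsed => solve p.1 p.2).
Proof. by rewrite /solve; fp. Qed.
#[global] Hint Resolve fp_solve : fpdb.

Lemma fp_algorithm : FP algorithm.
Proof. by rewrite /algorithm; fp. Qed.

(** * Fractions *)

Definition frac_val (f : fraction) : rat := (f.1%:R / f.2%:R)%R.

Definition frac_pos (f : fraction) : bool := (0 < f.1) && (0 < f.2).

Lemma natr_neq0 n : 0 < n -> (n%:R != 0 :> rat)%R.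
Proof. by rewrite pnatr_eq0 -lt0n. Qed.

Lemma frac_val_gt0 f : frac_pos f -> (0 < frac_val f)%R.
Proof. by case/andP=> f1 f2; rewrite divr_gt0 ?ltr0n. Qed.

Lemma prodn_pos s : all (fun n => 0 < n) s -> 0 < prodn s.
Proof. by elim: s => //= n s IH /andP[n_gt0 /IH s_gt0]; rewrite muln_gt0 n_gt0. Qed.

Lemma dvdn_prodn n s : n \in s -> n %| prodn s.
Proof.
elim: s => //= m s IH; rewrite inE => /orP[/eqP->|/IH dvd_n]; first exact: dvdn_mulr.
exact: dvdn_mull.
Qed.

Lemma leq_sumn n s : n \in s -> n <= sumn s.
Proof.
elim: s => //= m s IH; rewrite inE => /orP[/eqP->|/IH le_n]; first exact: leq_addr.
exact: leq_trans le_n (leq_addl _ _).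
Qed.

Lemma pow_sizeE {T : Type} b (s : seq T) : pow_size b s = b ^ size s.
Proof. by elim: s => //= x s IH; rewrite expnS -IH. Qed.

Section FractionLists.
Implicit Type l : seq fraction.

Lemma frac_val_prod l : all frac_pos l ->
  frac_val (frac_prod l) = (\prod_(f <- l) frac_val f)%R.
Proof.
elim: l => [|f l IH] /=; first by rewrite big_nil /frac_val /frac_prod /= divr1.
case/andP=> _ /IH{}IH; rewrite big_cons -IH.
by rewrite /frac_val /frac_prod /= !natrM invfM mulrACA.
Qed.

Lemma frac_pos_prod l : all frac_pos l -> frac_pos (frac_prod l).
Proof.
move=> pos_l; rewrite /frac_pos !prodn_pos //= all_map;
  by apply: sub_all pos_l => f /andP[].
Qed.

Lemma dens_gt0 l : all frac_pos l -> 0 < prodn (map snd l).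
Proof. by move/frac_pos_prod/andP => []. Qed.

Lemma frac_val_sum l : all frac_pos l ->
  frac_val (frac_sum l) = (\sum_(f <- l) frac_val f)%R.
Proof.
move=> pos_l; have := dens_gt0 pos_l; rewrite /frac_val /=; set P := prodn _ => P_gt0.
have sub_l : {subset l <= l} by [].
elim: {1 3 4}l sub_l => [|f l' IH] sub_l; first by rewrite big_nil mul0r.
have l_f : f \in l by apply: sub_l; rewrite mem_head.
have /andP[_ f2_gt0] := allP pos_l _ l_f.
have dvd_f : f.2 %| P by apply/dvdn_prodn/map_f.
rewrite big_cons -IH => [|g l'_g]; last by apply: sub_l; rewrite inE l'_g orbT.
rewrite /= natrD mulrDl; congr (_ + _)%R; apply/eqP.
by rewrite eqr_div ?natr_neq0 // -!natrM -mulnA divnK.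
Qed.

Lemma frac_pos_sum l : 0 < size l -> all frac_pos l -> frac_pos (frac_sum l).
Proof.
move=> l_gt0 pos_l; have P_gt0 := dens_gt0 pos_l; rewrite /frac_pos /= P_gt0 andbT.
case: l l_gt0 pos_l P_gt0 => // f l _ /= /andP[/andP[f1 f2] _] P_gt0.
by rewrite addn_gt0 muln_gt0 f1 divn_gt0 // dvdn_leq // dvdn_mulr.
Qed.
End FractionLists.

Lemma leq_reduced n k u v : 0 < u -> 0 < n -> n * v = k * u -> n %/ gcdn n k <= u.
Proof.
move=> u_gt0 n_gt0 eq_nk; have g_gt0 : 0 < gcdn n k by rewrite gcdn_gt0 n_gt0.
have coprime_nk : coprime (n %/ gcdn n k) (k %/ gcdn n k).
  by rewrite /coprime -(eqn_pmul2r g_gt0) mul1n muln_gcdl !divnK ?dvdn_gcdl ?dvdn_gcdr.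
apply: dvdn_leq => //; rewrite -(Gauss_dvdr _ coprime_nk).
suff <- : n %/ gcdn n k * v = k %/ gcdn n k * u by rewrite dvdn_mulr.
apply/eqP; rewrite -(eqn_pmul2r g_gt0) mulnAC divnK ?dvdn_gcdl //.
by rewrite mulnAC divnK ?dvdn_gcdr // eq_nk.
Qed.

Definition short_ratio (M : nat) (q : rat) : Prop :=
  exists u v, [/\ 0 < u <= M, 0 < v <= M & q = (u%:R / v%:R)%R].

Lemma clamp_id M n : 0 < n <= M -> clamp M n = n.
Proof. by rewrite /clamp; lia. Qed.

Lemma frac_pos_ratio M f g : frac_pos (frac_ratio M f g).
Proof. by rewrite /frac_pos /frac_ratio /clamp /= !leq_maxl. Qed.

Lemma frac_val_ratio M f g : frac_pos f -> frac_pos g ->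
  short_ratio M (frac_val f / frac_val g) ->
  frac_val (frac_ratio M f g) = (frac_val f / frac_val g)%R.
Proof.
case/andP=> f1 f2 /andP[g1 g2] [u [v [/andP[u_gt0 u_M] /andP[v_gt0 v_M] ratio]]].
rewrite /frac_ratio; set n := f.1 * g.2; set k := f.2 * g.1.
have n_gt0 : 0 < n by rewrite muln_gt0 f1.
have k_gt0 : 0 < k by rewrite muln_gt0 f2.
have ratio_nk : (frac_val f / frac_val g = n%:R / k%:R)%R.
  by rewrite /frac_val /n /k !natrM invf_div mulrACA [in RHS]invfM.
have eq_nk : n * v = k * u.
  move/eqP: ratio; rewrite ratio_nk eqr_div ?natr_neq0 // -!natrM eqr_nat => /eqP ->.
  exact: mulnC.
have g_gt0 : 0 < gcdn n k by rewrite gcdn_gt0 n_gt0.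
have le_u := leq_reduced u_gt0 n_gt0 eq_nk.
have le_v := leq_reduced v_gt0 k_gt0 (esym eq_nk); rewrite gcdnC in le_v.
have red_n : 0 < n %/ gcdn n k <= M.
  by rewrite divn_gt0 // dvdn_leq ?dvdn_gcdl //= (leq_trans le_u).
have red_k : 0 < k %/ gcdn n k <= M.
  by rewrite divn_gt0 // dvdn_leq ?dvdn_gcdr //= (leq_trans le_v).
rewrite (clamp_id red_n) (clamp_id red_k) ratio_nk; apply/eqP.
case/andP: red_k => red_k_gt0 _; rewrite eqr_div ?natr_neq0 // -!natrM eqr_nat /=.
by rewrite divn_mulAC ?dvdn_gcdl // muln_divA ?dvdn_gcdr.
Qed.

(** * Tables *)

Definition table_pos (c : table) : bool :=
  frac_pos (table_default c) && all (fun e : entry => frac_pos e.2) (table_entries c).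

Definition table_wf (c : table) : bool :=
  uniq (table_vars c) &&
  all (fun e : entry => unzip1 e.1 == table_vars c) (table_entries c).

Lemma select_pred (P : pred fraction) es w s :
  P w -> all (fun e : entry => P e.2) es -> P (select es w s).
Proof. by move=> P_w; elim: es => //= e es IH /andP[P_e /IH]; case: ifP. Qed.

Lemma table_eval_pos c s : table_pos c -> frac_pos (table_eval c s).
Proof. by case/andP; apply: select_pred. Qed.

Lemma select_const es w s q :
  {in es, forall e : entry, matches e.1 s -> frac_val e.2 = q} ->
  frac_val (select es w s) =
  if has (fun e : entry => matches e.1 s) es then q else frac_val w.
Proof.
elim: es => //= e es IH val_q; case: ifP => [match_e|_] /=.
  by apply: val_q; rewrite ?mem_head.
by apply: IH => e' es_e'; apply: val_q; rewrite inE es_e' orbT.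
Qed.

Lemma select_default es w s :
  ~~ has (fun e : entry => matches e.1 s) es -> select es w s = w.
Proof. by elim: es => //= e es IH; rewrite negb_or => /andP[/negbTE-> /IH]. Qed.

Lemma matches_agree a s s' : {in unzip1 a, s =1 s'} -> matches a s = matches a s'.
Proof.
by move=> agree; apply: eq_in_all => p a_p; rewrite agree //; apply: map_f.
Qed.

Lemma table_eval_agree c s s' : table_wf c -> {in table_vars c, s =1 s'} ->
  table_eval c s = table_eval c s'.
Proof.
case/andP=> _; rewrite /table_eval => wf_es agree.
elim: (table_entries c) wf_es => //= e es IH /andP[/eqP vars_e /IH ->].
by rewrite (@matches_agree _ s s') // vars_e.
Qed.

Lemma lookup_mem a p : uniq (unzip1 a) -> p \in a -> lookup a p.1 = p.2.
Proof.
elim: a => //= q a IH /andP[nq uniq_a]; rewrite inE => /orP[/eqP->|a_p].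
  by rewrite eqxx.
case: eqP => [eq_pq|_]; last exact: IH.
by case/negP: nq; rewrite -eq_pq; apply: map_f.
Qed.

Lemma matches_lookup a s : uniq (unzip1 a) -> matches a s ->
  {in unzip1 a, lookup a =1 s}.
Proof.
move=> uniq_a /allP match_a y /mapP[p a_p ->]; rewrite lookup_mem //.
exact/esym/eqP/match_a.
Qed.

Lemma unzip1_drop_var x a : unzip1 (drop_var x a) = filter (fun v => v != x) (unzip1 a).
Proof. by rewrite /unzip1 filter_map. Qed.

Lemma matches_upd x a s b : matches a (upd s x b) -> matches (drop_var x a) s.
Proof.
move=> /allP match_a; apply/allP => p; rewrite mem_filter => /andP[p_x a_p].
by have := match_a _ a_p; rewrite updE (negbTE p_x).
Qed.

(** * Elimination of a variable *)

Lemma remove_all_nil e : remove_all [::] e = e.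
Proof. exact: filter_predT. Qed.

Lemma remove_all_cons x r e :
  remove_all (x :: r) e = filter (fun v => v != x) (remove_all r e).
Proof.
by rewrite /remove_all -filter_predI; apply: eq_filter => v /=; rewrite inE negb_or.
Qed.

Lemma elim_var_rcons D M J c x :
  elim_var D M (rcons J c) x = rcons (elim_var D M J x) (elim_step D M x J c).
Proof. by rewrite /elim_var splits_rcons map_rcons. Qed.

Lemma size_elim_var D M J x : size (elim_var D M J x) = size J.
Proof. by rewrite size_map -(size_map snd) map_snd_splits. Qed.

Lemma take_elim_var D M J x i : take i (elim_var D M J x) = elim_var D M (take i J) x.
Proof.
elim/last_ind: J => [|J c IH]; first by case: i.
rewrite elim_var_rcons; have [le_i|lt_i] := leqP i (size J).
  by rewrite -!cats1 !takel_cat ?size_elim_var.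
by rewrite !take_oversize ?size_rcons ?size_elim_var // elim_var_rcons.
Qed.

Lemma mem_elim_var D M J x c' : c' \in elim_var D M J x ->
  exists pre c, c \in J /\ c' = elim_step D M x pre c.
Proof.
case/mapP=> [[pre c] split_c ->]; exists pre, c; split=> //.
by rewrite -(map_snd_splits J); apply/mapP; exists (pre, c).
Qed.

Lemma table_vars_elim_step D M x pre c :
  table_vars (elim_step D M x pre c) = filter (fun v => v != x) (table_vars c).
Proof.
rewrite /elim_step; case: ifP => // /negbT nx.
by apply/esym/all_filterP/allP => v c_v; apply: contra nx => /eqP <-.
Qed.

Lemma table_vars_elim_var D M J x :
  map table_vars (elim_var D M J x) = map (filter (fun v => v != x)) (map table_vars J).
Proof.
elim/last_ind: J => // J c IH.
by rewrite elim_var_rcons !map_rcons IH table_vars_elim_step.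
Qed.

Lemma table_pos_elim_step D M x pre c : table_pos c -> table_pos (elim_step D M x pre c).
Proof.
move=> pos_c; rewrite /elim_step; case: ifP => // _; case/andP: pos_c => pos_w _.
by apply/andP; split=> //; apply/allP => e /mapP[e' _ ->]; apply: frac_pos_ratio.
Qed.

Lemma table_wf_elim_step D M x pre c : table_wf c -> table_wf (elim_step D M x pre c).
Proof.
move=> wf_c; rewrite /elim_step; case: ifP => // _;
case/andP: wf_c => uniq_c /allP vars_c.
apply/andP; split; first exact: filter_uniq.
apply/allP => e /mapP[e' c_e' ->] /=.
by rewrite unzip1_drop_var (eqP (vars_c _ c_e')).
Qed.

Lemma all_elim_var (P : pred table) D M J x :
  (forall pre c, P c -> P (elim_step D M x pre c)) -> all P J -> all P (elim_var D M J x).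
Proof.
move=> P_step P_J; apply/allP => c' /mem_elim_var[pre [c [J_c ->]]].
exact/P_step/(allP P_J).
Qed.

Definition below (r : seq nat) (x : nat) (e e' : seq nat) : bool :=
  (x \in e) ==> (x \in e') ==> subedge (remove_all r e) (remove_all r e').

Lemma all_filtered (T : Type) (P Q : pred T) t : all P t -> all P (filter Q t).
Proof. by rewrite all_filter; apply: sub_all => y /= ->; rewrite implybT. Qed.

Section ElimVar.
Variables (d x M : nat).
Hypothesis d_gt0 : 0 < d.
Local Notation D := (iota 0 d).
Local Notation hasx := (fun c => x \in table_vars c).
Implicit Types (J chain : seq table) (c : table) (s : nat -> nat).

Definition tables_prod J s : rat := (\prod_(c <- J) frac_val (table_eval c s))%R.

Definition sum_out J s : rat := (\sum_(b < d) tables_prod J (upd s x b))%R.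

Lemma tables_prod_rcons J c s :
  tables_prod (rcons J c) s = (tables_prod J s * frac_val (table_eval c s))%R.
Proof. by rewrite /tables_prod -cats1 big_cat big_seq1. Qed.

Lemma tables_prod_gt0 J s : all table_pos J -> (0 < tables_prod J s)%R.
Proof.
move=> pos_J; rewrite /tables_prod big_seq; apply: prodr_gt0 => c J_c.
exact/frac_val_gt0/table_eval_pos/(allP pos_J).
Qed.

Lemma sum_out_gt0 J s : all table_pos J -> (0 < sum_out J s)%R.
Proof.
move=> pos_J; rewrite /sum_out; case: d d_gt0 => // d' _.
rewrite big_ord_recl ltr_wpDr ?tables_prod_gt0 //.
by apply: sumr_ge0 => b _; apply/ltW/tables_prod_gt0.
Qed.

Lemma sum_out_filter J s : all table_wf J ->
  sum_out J s = (sum_out (filter hasx J) s * tables_prod (filter (predC hasx) J) s)%R.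
Proof.
move=> wf_J; rewrite /sum_out mulr_suml; apply: eq_bigr => b _.
rewrite /tables_prod !big_filter (bigID hasx) /=; congr (_ * _)%R.
rewrite big_seq_cond [RHS]big_seq_cond; apply: eq_bigr => c /andP[J_c nx].
rewrite (table_eval_agree (s' := s)) ?(allP wf_J) // => y c_y.
by rewrite updE; case: eqP => // eq_yx; rewrite -eq_yx c_y in nx.
Qed.

Lemma sum_out_agree J (v : seq nat) s s' : all table_wf J ->
  {in J, forall c, {subset table_vars c <= v}} ->
  {in v, forall y, y != x -> s y = s' y} -> sum_out J s = sum_out J s'.
Proof.
move=> wf_J sub agree; apply: eq_bigr => b _; apply: eq_big_seq => c J_c.
rewrite (table_eval_agree (s' := upd s' x b)) ?(allP wf_J) // => y c_y.
by rewrite !updE; case: eqP => // /eqP y_x; apply: agree => //; apply: sub c_y.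
Qed.

Lemma chain_sumE chain a : all table_pos chain ->
  frac_val (chain_sum D x chain a) = sum_out chain (lookup a).
Proof.
move=> pos_c; have pos_eval s : all frac_pos (map (fun c => table_eval c s) chain).
  by rewrite all_map; apply: sub_all pos_c => c; apply: table_eval_pos.
rewrite /chain_sum frac_val_sum; last first.
  by rewrite all_map; apply/allP => b _; apply: frac_pos_prod.
rewrite big_map /sum_out (_ : D = index_iota 0 d); last by rewrite /index_iota subn0.
rewrite big_mkord; apply: eq_bigr => b _.
by rewrite frac_val_prod // big_map.
Qed.

Lemma chain_sum_pos chain a : all table_pos chain -> frac_pos (chain_sum D x chain a).
Proof.
move=> pos_c; apply: frac_pos_sum; first by rewrite size_map size_iota.
rewrite all_map; apply/allP => b _; apply: frac_pos_prod.
by rewrite all_map; apply: sub_all pos_c => c; apply: table_eval_pos.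
Qed.

Definition elim_ratio chain c s : rat := (sum_out (rcons chain c) s / sum_out chain s)%R.

Section ElimTable.
Variables (chain : seq table) (c : table).
Hypotheses (c_x : x \in table_vars c) (wf_c : table_wf c) (pos_c : table_pos c)
  (wf_chain : all table_wf chain) (pos_chain : all table_pos chain)
  (sub_c : {in chain, forall c', {subset table_vars c' <= table_vars c}})
  (short : forall s, short_ratio M (elim_ratio chain c s)).

Lemma elim_ratio_agree s s' :
  {in table_vars c, forall y, y != x -> s y = s' y} ->
  elim_ratio chain c s = elim_ratio chain c s'.
Proof.
move=> agree; have wf_rcons : all table_wf (rcons chain c) by rewrite all_rcons wf_c.
rewrite /elim_ratio (sum_out_agree wf_chain sub_c agree).
rewrite (sum_out_agree (s' := s') wf_rcons _ agree) // => c'.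
by rewrite mem_rcons inE => /orP[/eqP->|/sub_c].
Qed.

Lemma elim_entryE e s : e \in table_entries c -> matches (drop_var x e.1) s ->
  frac_val (elim_entry D M x chain c e).2 = elim_ratio chain c s.
Proof.
move=> c_e match_e; have pos_rcons : all table_pos (rcons chain c)
  by rewrite all_rcons pos_c.
have ratioE : (frac_val (chain_sum D x (rcons chain c) (drop_var x e.1)) /
    frac_val (chain_sum D x chain (drop_var x e.1)))%R =
    elim_ratio chain c (lookup (drop_var x e.1)) by rewrite !chain_sumE.
rewrite /elim_entry cats1 frac_val_ratio ?chain_sum_pos // ratioE //.
have [uniq_c /allP/(_ _ c_e)/eqP vars_e] := andP wf_c.
apply: elim_ratio_agree => y c_y y_x; apply: matches_lookup => //.
  by rewrite unzip1_drop_var vars_e filter_uniq.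
by rewrite unzip1_drop_var vars_e mem_filter y_x.
Qed.

(* If no extension of [s] is in the support then the default value of [c] is a
   factor of all summands. *)
Lemma elim_ratio_default s :
  ~~ has (fun e : entry => matches (drop_var x e.1) s) (table_entries c) ->
  elim_ratio chain c s = frac_val (table_default c).
Proof.
move=> /hasPn no_match; have sum_neq0 : (sum_out chain s != 0)%R
  by rewrite gt_eqF ?sum_out_gt0.
apply/(canLR (mulfK sum_neq0)); rewrite /sum_out mulr_sumr; apply: eq_bigr => b _.
rewrite tables_prod_rcons mulrC; congr (frac_val _ * _)%R.
apply: select_default; apply/hasPn => e c_e.
by apply: contra (no_match _ c_e); apply: matches_upd.
Qed.

Lemma elim_tableE s :
  frac_val (table_eval (elim_table D M x chain c) s) = elim_ratio chain c s.
Proof.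
rewrite /table_eval (@select_const _ _ _ (elim_ratio chain c s)) => [|e' /mapP[e c_e ->]].
  by rewrite has_map; case: ifP => // /negbT/elim_ratio_default.
exact: elim_entryE.
Qed.
End ElimTable.

(* The tables that do not contain [x] contribute the same factor to the numerator
   and to the denominator. *)
Lemma elim_ratio_filter J c s : all table_wf (rcons J c) -> all table_pos J ->
  x \in table_vars c ->
  elim_ratio (filter hasx J) c s = elim_ratio J c s.
Proof.
move=> wf_rcons pos_J c_x; have wf_J : all table_wf J
  by move: wf_rcons; rewrite all_rcons => /andP[].
rewrite /elim_ratio [sum_out (rcons J c) s]sum_out_filter // [sum_out J s]sum_out_filter //.
rewrite !filter_rcons /= c_x -mulf_div divff ?mulr1 // gt_eqF // tables_prod_gt0 //.
exact: all_filtered.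
Qed.

Lemma elim_stepE J c s : all table_wf (rcons J c) -> all table_pos (rcons J c) ->
  {in J, forall c', below [::] x (table_vars c') (table_vars c)} ->
  (forall s, short_ratio M (elim_ratio J c s)) ->
  frac_val (table_eval (elim_step D M x J c) s) = elim_ratio J c s.
Proof.
move=> wf_rcons; rewrite /elim_step all_rcons => /andP[pos_c pos_J] below_c short.
have := wf_rcons; rewrite all_rcons => /andP[wf_c wf_J].
case: ifP => c_x; last first.
  rewrite /elim_ratio [sum_out (rcons J c) s]sum_out_filter // [sum_out J s]sum_out_filter //.
  rewrite !filter_rcons /= c_x tables_prod_rcons.
  rewrite mulrA mulrAC divff ?mul1r // mulf_neq0 // gt_eqF //.
    exact/sum_out_gt0/all_filtered.
  exact/tables_prod_gt0/all_filtered.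
rewrite elim_tableE ?elim_ratio_filter //.
- exact: all_filtered.
- exact: all_filtered.
- move=> c'; rewrite mem_filter => /andP[/= c'_x J_c'].
  by have := below_c _ J_c'; rewrite /below c'_x c_x !remove_all_nil => /allP.
- by move=> s'; rewrite elim_ratio_filter.
Qed.

Lemma elim_varE J s : all table_wf J -> all table_pos J ->
  pairwise (below [::] x) (map table_vars J) ->
  (forall i s, i < size J ->
     short_ratio M (sum_out (take i.+1 J) s / sum_out (take i J) s)%R) ->
  (tables_prod (elim_var D M J x) s * d%:R = sum_out J s)%R.
Proof.
elim/last_ind: J => [|J c IH].
  move=> _ _ _ _; rewrite /tables_prod /sum_out big_nil mul1r.
  under eq_bigr do rewrite /tables_prod big_nil.
  by rewrite sumr_const card_ord.
move=> wf_rcons pos_rcons; rewrite map_rcons pairwise_rcons =>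
  /andP[below_c below_J] short.
have /andP[pos_c pos_J] : table_pos c && all table_pos J by rewrite -all_rcons.
have /andP[wf_c wf_J] : table_wf c && all table_wf J by rewrite -all_rcons.
have {}IH : (tables_prod (elim_var D M J x) s * d%:R = sum_out J s)%R.
  apply: IH => // i s' lt_i; have le_i := ltnW lt_i; have := short i s'.
  by rewrite size_rcons ltnS -cats1 !takel_cat // => /(_ le_i).
rewrite elim_var_rcons tables_prod_rcons mulrAC IH elim_stepE //.
- by rewrite /elim_ratio mulrC divfK // gt_eqF // sum_out_gt0.
- by move=> c' J_c'; apply: (allP below_c); apply: map_f.
- move=> s'; have := short (size J) s'.
  have -> : take (size J) (rcons J c) = J by rewrite -cats1 take_size_cat.
  by rewrite take_oversize size_rcons // leqnn => /(_ isT).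
Qed.
End ElimVar.

(** * Sums over assignments *)

Definition sum_over (d : nat) : seq nat -> ((nat -> nat) -> nat) -> (nat -> nat) -> nat :=
  fix sum_over xs G s :=
    if xs is x :: xs' then \sum_(b < d) sum_over xs' G (upd s x b) else G s.

Definition extensional (G : (nat -> nat) -> nat) : Prop :=
  forall s s', s =1 s' -> G s = G s'.

Definition ffun_cons {T : Type} n (b : T) (a : {ffun 'I_n -> T}) : {ffun 'I_n.+1 -> T} :=
  [ffun i => oapp a b (unlift ord0 i)].

Lemma ffun_cons0 T n (b : T) (a : {ffun 'I_n -> T}) : ffun_cons b a ord0 = b.
Proof. by rewrite ffunE unlift_none. Qed.

Lemma ffun_consS T n (b : T) (a : {ffun 'I_n -> T}) j : ffun_cons b a (lift ord0 j) = a j.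
Proof. by rewrite ffunE liftK. Qed.

Lemma sum_ffun_cons (T : finType) n (F : {ffun 'I_n.+1 -> T} -> nat) :
  \sum_a F a = \sum_b \sum_a F (ffun_cons b a).
Proof.
rewrite pair_bigA (reindex (fun p : T * {ffun 'I_n -> T} => ffun_cons p.1 p.2)) //.
pose uncons (a : {ffun 'I_n.+1 -> T}) := (a ord0, [ffun j => a (lift ord0 j)]).
apply: onW_bij; exists uncons => [[b a]|a].
  by rewrite /uncons ffun_cons0; congr (_, _); apply/ffunP => j; rewrite ffunE ffun_consS.
by apply/ffunP => i; case: (unliftP ord0 i) => [j|] ->;
  rewrite ?ffun_consS ?ffun_cons0 ?ffunE.
Qed.

Section SumOver.
Variable d : nat.
Implicit Types (xs : seq nat) (G : (nat -> nat) -> nat) (s : nat -> nat).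

Lemma sum_over_ext xs G : extensional G -> extensional (sum_over d xs G).
Proof.
move=> ext_G; elim: xs => [|x xs IH] s s' eq_s /=; first exact: ext_G.
by apply: eq_bigr => b _; apply: IH => y; rewrite !updE eq_s.
Qed.

Lemma eq_sum_over xs G G' s : G =1 G' -> sum_over d xs G s = sum_over d xs G' s.
Proof. by move=> eq_G; elim: xs s => //= x xs IH s; apply: eq_bigr => b _. Qed.

Lemma leq_sum_over xs G G' s :
  (forall s, G s <= G' s) -> sum_over d xs G s <= sum_over d xs G' s.
Proof. by move=> le_G; elim: xs s => //= x xs IH s; apply: leq_sum => b _. Qed.

Lemma sum_over_split xs G G' s :
  sum_over d xs (fun s => G s + G' s) s = sum_over d xs G s + sum_over d xs G' s.
Proof.
elim: xs s => //= x xs IH s; rewrite -big_split /=; apply: eq_bigr => b _; exact: IH.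
Qed.

Lemma sum_over_distrr xs k G s :
    sum_over d xs (fun s => k * G s) s = k * sum_over d xs G s.
Proof.
elim: xs s => //= x xs IH s; rewrite big_distrr /=; apply: eq_bigr => b _; exact: IH.
Qed.

Lemma sum_over_leq xs G s h :
    (forall s, G s <= h) -> sum_over d xs G s <= d ^ size xs * h.
Proof.
move=> le_G; elim: xs s => [|x xs IH] s /=; first by rewrite mul1n.
rewrite expnS -mulnA -[X in _ <= X * _]card_ord -sum_nat_const.
by apply: leq_sum => b _; apply: IH.
Qed.

Lemma sum_over_gt0 xs G s : 0 < d -> (forall s, 0 < G s) -> 0 < sum_over d xs G s.
Proof.
move=> d_gt0 G_gt0; elim: xs s => [|x xs IH] s; [exact: G_gt0 | rewrite /=].
by case: d d_gt0 IH => // d' _ IH; rewrite big_ord_recl addn_gt0 IH.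
Qed.

Lemma sum_over_domain0 xs G s : d = 0 -> xs != [::] -> sum_over d xs G s = 0.
Proof.
by move=> d0; case: xs => //= x xs _; rewrite big1 // => b; have := ltn_ord b; lia.
Qed.

Lemma sum_over_rem xs x G s : extensional G -> x \in xs ->
  sum_over d xs G s = sum_over d (x :: rem x xs) G s.
Proof.
move=> ext_G; elim: xs s => //= y xs IH s; rewrite inE.
case: (eqVneq y x) => [-> //|y_x] /= xs_x.
under eq_bigr do rewrite IH //=.
rewrite exchange_big /=; apply: eq_bigr => b _; apply: eq_bigr => b' _.
apply: sum_over_ext => // z; rewrite !updE.
by case: (eqVneq z x) => // ->; rewrite eq_sym (negbTE y_x).
Qed.

Lemma perm_sum_over xs ys G s : extensional G -> perm_eq xs ys ->
  sum_over d xs G s = sum_over d ys G s.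
Proof.
move=> ext_G; elim: xs ys s => [|x xs IH] ys s perm_xs.
  by move: perm_xs; rewrite perm_sym => /perm_nilP ->.
have ys_x : x \in ys by rewrite -(perm_mem perm_xs) mem_head.
rewrite (sum_over_rem _ ext_G ys_x) /=; apply: eq_bigr => b _; apply: IH.
by rewrite -(perm_cons x); apply: perm_trans perm_xs (perm_to_rem ys_x).
Qed.

(* The ordinal [index y V] does not exist if [y] is not in [V]: such a [y] has the
   value prescribed by [s]. *)
Lemma sum_over_ffun V G s : extensional G -> uniq V ->
  \sum_(a : {ffun 'I_(size V) -> 'I_d})
     G (fun y => if insub (index y V) is Some i then nat_of_ord (a i) else s y) =
  sum_over d V G s.
Proof.
move=> ext_G; elim: V s => [|x V IH] s /=.
  move=> _; rewrite (eq_bigr (fun=> G s)); last first.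
    by move=> a _; apply: ext_G => y; rewrite insubF.
  by rewrite sum_nat_const card_ffun !card_ord expn0 mul1n.
case/andP=> xV uniq_V; rewrite sum_ffun_cons; apply: eq_bigr => b _.
rewrite -IH //; apply: eq_bigr => a _; apply: ext_G => y.
rewrite updE eq_sym; case: eqP => [->|/eqP y_x].
  rewrite insubT /= insubF ?index_mem ?(negbTE xV) //.
  by rewrite (_ : Sub 0 _ = ord0) ?ffun_cons0 //; apply/val_inj.
case: (ltnP (index y V) (size V)) => lt_y; last by rewrite !insubF // ltnNge ?ltnS ?lt_y.
rewrite !insubT /=.
by rewrite (_ : Sub _ _ = lift ord0 (Ordinal lt_y)) ?ffun_consS //; apply/val_inj.
Qed.
End SumOver.

(** * The invariant of the elimination *)

Definition int_weight (X : nat) (f : fraction) : bool := (f.2 == 1) && (0 < f.1 <= X).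

Definition table_int (X : nat) (c : table) : bool :=
  int_weight X (table_default c) &&
  all (fun e : entry => int_weight X e.2) (table_entries c).

Lemma table_eval_int X c s : table_int X c -> int_weight X (table_eval c s).
Proof. by case/andP; apply: select_pred. Qed.

Lemma int_weight_pos X f : int_weight X f -> frac_pos f.
Proof. by case/andP=> /eqP f2 /andP[f1 _]; rewrite /frac_pos f2 f1. Qed.

Lemma table_int_pos X c : table_int X c -> table_pos c.
Proof.
case/andP=> int_w int_es; rewrite /table_pos (int_weight_pos int_w) /=.
by apply: sub_all int_es => e; apply: int_weight_pos.
Qed.

Lemma prod_table_eval_int X J s : all (table_int X) J ->
  0 < \prod_(c <- J) (table_eval c s).1 <= X ^ size J.
Proof.
elim: J => [|c J IH] /=; first by rewrite big_nil.
case/andP=> /(@table_eval_int _ _ s)/andP[_ /andP[c_gt0 c_X]] /IH/andP[J_gt0 J_X].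
by rewrite big_cons muln_gt0 c_gt0 J_gt0 expnS leq_mul.
Qed.

Lemma below_remove_all r x e e' :
  below r x e e' -> below [::] x (remove_all r e) (remove_all r e').
Proof.
rewrite /below !remove_all_nil !mem_filter => /implyP below_e.
by apply/implyP => /andP[_ /below_e/implyP below_e']; apply/implyP => /andP[_ /below_e'].
Qed.

Section Invariant.
Variables (d M X : nat) (J0 : seq table).
Hypotheses (d_gt0 : 0 < d) (X_gt0 : 0 < X)
  (wf_J0 : all table_wf J0) (int_J0 : all (table_int X) J0).
Local Notation D := (iota 0 d).

Definition partial_sum (r : seq nat) (i : nat) (s : nat -> nat) : nat :=
  sum_over d r (fun s => \prod_(c <- take i J0) (table_eval c s).1) s.

Lemma partial_sum_bound r i s :
  0 < partial_sum r i s <= d ^ size r * X ^ size J0.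
Proof.
have int_take : all (table_int X) (take i J0).
  by apply/allP => c /mem_take J0_c; apply: (allP int_J0).
apply/andP; split.
  by apply: sum_over_gt0 => // s'; case/andP: (prod_table_eval_int s' int_take).
apply: sum_over_leq => s'; case/andP: (prod_table_eval_int s' int_take) => _ le_prod.
by apply: leq_trans le_prod _; rewrite leq_pexp2l // size_take_min geq_minr.
Qed.

(* The last clause holds for all prefixes, not only for the whole list: hence each
   weight is a quotient of two partial sums, which bounds its size. *)
Definition elim_invariant (r : seq nat) (J : seq table) : Prop :=
  [/\ map table_vars J = map (remove_all r) (map table_vars J0),
      all table_wf J, all table_pos J
    & forall i s, (tables_prod (take i J) s * d%:R ^+ size r = (partial_sum r i s)%:R)%R].

Lemma elim_invariant_nil : elim_invariant [::] J0.
Proof.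
split=> //.
- by rewrite -[LHS]map_id; apply: eq_map => e; rewrite remove_all_nil.
- by apply: sub_all int_J0 => c; apply: table_int_pos.
move=> i s; rewrite expr0 mulr1 /partial_sum /= natr_prod.
apply: eq_big_seq => c /mem_take J0_c.
by have /andP[/eqP c2 _] := table_eval_int s (allP int_J0 _ J0_c);
  rewrite /frac_val c2 divr1.
Qed.

Section InvariantStep.
Variables (r : seq nat) (J : seq table) (x : nat).
Hypothesis inv : elim_invariant r J.

Lemma sum_out_take i s :
  (sum_out d x (take i J) s * d%:R ^+ size r = (partial_sum (x :: r) i s)%:R)%R.
Proof.
have [_ _ _ prodE] := inv; rewrite /sum_out mulr_suml /partial_sum /= natr_sum.
by apply: eq_bigr => b _; apply: prodE.
Qed.

Lemma short_ratio_take i s : d ^ (size r).+1 * X ^ size J0 <= M ->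
  short_ratio M (sum_out d x (take i.+1 J) s / sum_out d x (take i J) s)%R.
Proof.
move=> le_M; exists (partial_sum (x :: r) i.+1 s), (partial_sum (x :: r) i s).
have bound j : 0 < partial_sum (x :: r) j s <= M.
  by have /andP[-> /leq_trans->] := partial_sum_bound (x :: r) j s.
split=> //; have dr_neq0 : (d%:R ^+ size r != 0 :> rat)%R
  by rewrite expf_neq0 // natr_neq0.
by rewrite -!sum_out_take -mulf_div divff // mulr1.
Qed.

Lemma pairwise_below_take i : pairwise (below r x) (map table_vars J0) ->
  pairwise (below [::] x) (map table_vars (take i J)).
Proof.
have [varsE _ _ _] := inv => below_J0.
apply: subseq_pairwise (map_subseq _ (take_subseq J i)) _; rewrite varsE pairwise_map.
by apply: sub_pairwise below_J0 => e e'; apply: below_remove_all.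
Qed.

Lemma elim_invariant_cons : d ^ (size r).+1 * X ^ size J0 <= M ->
  pairwise (below r x) (map table_vars J0) ->
  elim_invariant (x :: r) (elim_var D M J x).
Proof.
move=> le_M below_J0; have [varsE wf_J pos_J _] := inv.
split.
- rewrite table_vars_elim_var varsE -[LHS]map_comp.
  by apply: eq_map => e; rewrite remove_all_cons.
- by apply: all_elim_var wf_J => pre c; apply: table_wf_elim_step.
- by apply: all_elim_var pos_J => pre c; apply: table_pos_elim_step.
move=> i s; rewrite take_elim_var exprS mulrA elim_varE ?sum_out_take //.
- by apply/allP => c /mem_take J_c; apply: (allP wf_J).
- by apply/allP => c /mem_take J_c; apply: (allP pos_J).
- exact: pairwise_below_take.
move=> j s'; rewrite size_take_min => lt_j.
by rewrite !take_takel; [apply: short_ratio_take | lia | lia].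
Qed.
End InvariantStep.

Lemma elim_invariant_all xs : d ^ size xs * X ^ size J0 <= M ->
  (forall r x rest, xs = rev r ++ x :: rest ->
      pairwise (below r x) (map table_vars J0)) ->
  elim_invariant (rev xs) (elim_all D M J0 xs).
Proof.
rewrite /elim_all; elim/last_ind: xs => [|xs x IH] le_M below_J0.
  exact: elim_invariant_nil.
rewrite rev_rcons foldl_rcons; apply: elim_invariant_cons.
- apply: IH => [|r y rest eq_xs]; last by apply: (below_J0 r y (rcons rest x));
    rewrite eq_xs rcons_cat.
  by apply: leq_trans le_M; rewrite leq_mul2r size_rcons leq_pexp2l ?orbT.
- by rewrite size_rev; rewrite size_rcons in le_M.
- by apply: (below_J0 (rev xs) x [::]); rewrite revK cats1.
Qed.
End Invariant.

(** * Elimination orders *)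

Lemma nest_pointP (E : seq (seq nat)) x :
  reflect {in E &, forall e1 e2, x \in e1 -> x \in e2 -> subedge e1 e2 || subedge e2 e1}
    (nest_point E x).
Proof.
apply: (iffP allP) => [nest e1 e2 E_e1 E_e2 e1_x e2_x|nest e1 E_e1].
  by have /allP/(_ _ E_e2) := nest _ E_e1; rewrite e1_x e2_x.
by apply/allP => e2 E_e2; apply/implyP => e1_x; apply/implyP; apply: nest.
Qed.

Lemma sub_nest_point (E E' : seq (seq nat)) x :
  {in E', forall e, x \in e -> e \in E} -> nest_point E x -> nest_point E' x.
Proof.
move=> sub_E /nest_pointP nest; apply/nest_pointP => e1 e2 E_e1 E_e2 e1_x e2_x.
by apply: nest; rewrite ?sub_E.
Qed.

Lemma mem_hvertices (E : seq (seq nat)) y :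
    (y \in hvertices E) = has (fun e => y \in e) E.
Proof. by rewrite mem_undup; apply/flattenP/hasP => -[e E_e e_y]; exists e. Qed.

Lemma mem_remove_all r e v : (v \in remove_all r e) = (v \notin r) && (v \in e).
Proof. exact: mem_filter. Qed.

Lemma mem_del_vertex z (E : seq (seq nat)) e y :
  e \in E -> y \in e -> y != z -> filter (fun v => v != z) e \in del_vertex z E.
Proof.
move=> E_e e_y y_z; have y_del : y \in filter (fun v => v != z) e
  by rewrite mem_filter y_z.
rewrite mem_filter map_f // andbT.
by apply/negP => /nilP del_nil; rewrite del_nil in y_del.
Qed.

Lemma nest_point_del_vertex r z (E : seq (seq nat)) x :
  nest_point (map (remove_all r) (del_vertex z E)) x ->
  nest_point (map (remove_all (z :: r)) E) x.
Proof.
apply: sub_nest_point => _ /mapP[e E_e ->]; rewrite mem_remove_all inE negb_or.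
case/andP=> /andP[x_z _] e_x; apply/mapP; exists (filter (fun v => v != z) e).
  exact: mem_del_vertex e_x x_z.
rewrite /remove_all -filter_predI; apply: eq_filter => v /=.
by rewrite inE negb_or andbC.
Qed.

Lemma beta_elim_order_subset (E : seq (seq nat)) s :
  beta_elim_order E s -> {subset hvertices E <= s}.
Proof.
elim: s E => [|z s IH] E /=; first by move=> /nilP ->.
case/and3P=> _ _ /IH sub_s y; rewrite inE; case: eqVneq => //= y_z.
rewrite mem_hvertices => /hasP[e E_e e_y]; apply: sub_s; rewrite mem_hvertices.
by apply/hasP; exists (filter (fun v => v != z) e);
  [apply: mem_del_vertex e_y y_z | rewrite mem_filter y_z].
Qed.

Lemma beta_elim_order_nest_point (E : seq (seq nat)) s1 x s2 :
  beta_elim_order E (s1 ++ x :: s2) -> nest_point (map (remove_all s1) E) x.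
Proof.
elim: s1 E => [|z s1 IH] E /=; case/and3P=> _ nest order_del; last first.
  exact/nest_point_del_vertex/IH.
by rewrite (eq_map remove_all_nil) map_id.
Qed.

Lemma subedge_remove_all (r r' e1 e2 : seq nat) :
  {in e1, forall y, y \in r -> y \in r'} ->
  subedge (remove_all r e1) (remove_all r e2) ->
  subedge (remove_all r' e1) (remove_all r' e2).
Proof.
move=> sub_r /allP sub_e; apply/allP => y; rewrite !mem_remove_all => /andP[nr'_y e1_y].
have nr_y : y \notin r by apply: contra nr'_y; apply: sub_r.
by have := sub_e y; rewrite !mem_remove_all nr'_y nr_y e1_y => /(_ isT).
Qed.

Lemma nest_point_remove_sub (E : seq (seq nat)) r r' x : x \notin r ->
  {in hvertices E, forall y, y \in r -> y \in r'} ->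
  nest_point (map (remove_all r) E) x -> nest_point (map (remove_all r') E) x.
Proof.
move=> nr_x sub_r /nest_pointP nest;
apply/nest_pointP => _ _ /mapP[e1 E_e1 ->] /mapP[e2 E_e2 ->].
rewrite !mem_remove_all => /andP[_ e1_x] /andP[_ e2_x].
have sub_e e : e \in E -> {in e, forall y, y \in r -> y \in r'}.
  by move=> E_e y e_y; apply: sub_r; rewrite mem_hvertices; apply/hasP; exists e.
have := nest _ _ (map_f _ E_e1) (map_f _ E_e2); rewrite !mem_remove_all nr_x e1_x e2_x.
case/(_ isT isT)/orP => /subedge_remove_all sub_edge; apply/orP; [left | right];
  by apply: sub_edge; apply: sub_e.
Qed.

Definition partial_elim_order (E : seq (seq nat)) (out : seq nat) : Prop :=
  [/\ uniq out, {subset out <= hvertices E}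
    & forall s1 x s2, out = s1 ++ x :: s2 -> nest_point (map (remove_all s1) E) x].

Section ElimOrder.
Variable E : seq (seq nat).
Local Notation V := (hvertices E).

Lemma partial_elim_order_rcons out x :
  partial_elim_order E out -> x \in candidates E out ->
  partial_elim_order E (rcons out x).
Proof.
case=> uniq_out sub_out nest_out; rewrite mem_filter => /andP[/andP[out_x nest_x] V_x].
split; first by rewrite rcons_uniq out_x.
- by move=> v; rewrite mem_rcons inE => /orP[/eqP->|/sub_out].
move=> s1 v s2; case/lastP: s2 => [|s2 u]; first by rewrite cats1 => /rcons_inj[<- <-].
by rewrite -rcons_cons -rcons_cat => /rcons_inj[eq_out _]; apply: nest_out eq_out.
Qed.

(* The first vertex of any elimination order that has not been removed yet is a
   nest point, whatever the order of the removed ones. *)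
Lemma candidates_neq_nil out : beta_acyclic E -> size out < size V ->
  candidates E out != [::].
Proof.
case=> s order_s lt_size; pose left y := (y \in V) && (y \notin out).
have left_s : has left s.
  have [V_out|/allPn[y V_y out_y]] := boolP (all (mem out) V).
    by move: lt_size; rewrite ltnNge uniq_leq_size ?undup_uniq //; apply/allP.
  apply/hasP; exists y; last by rewrite /left V_y.
  exact: beta_elim_order_subset order_s _ V_y.
case: (split_find left_s) order_s => z s1 s2 /andP[V_z out_z] /hasPn removed_s1.
rewrite cat_rcons => /beta_elim_order_nest_point nest_z.
suff cand_z : z \in candidates E out by apply: contraTneq cand_z => ->.
rewrite mem_filter V_z andbT out_z /=; apply: nest_point_remove_sub nest_z.
  by apply/negP => /removed_s1; rewrite /left V_z out_z.
by move=> y V_y /removed_s1; rewrite /left V_y negbK.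
Qed.

Lemma elim_orderP : beta_acyclic E ->
  partial_elim_order E (elim_order E) /\ elim_order E =i V.
Proof.
move=> acyclic_E; pose greedy (l : seq nat) :=
  foldl (fun out (_ : nat) => out ++ take 1 (candidates E out)) [::] l.
have greedyP l : size l <= size V ->
    partial_elim_order E (greedy l) /\ size (greedy l) = size l.
  elim/last_ind: l => [_|l e IH]; first by split=> //; split=> // -[].
  rewrite size_rcons => lt_l; have [partial_l size_l] := IH (ltnW lt_l).
  have := @candidates_neq_nil (greedy l) acyclic_E; rewrite size_l => /(_ lt_l).
  rewrite /greedy foldl_rcons -/(greedy l).
  case cand: (candidates E (greedy l)) => [|w cs] // _;
  rewrite /= take0 cats1 size_rcons size_l.
  by split=> //; apply: partial_elim_order_rcons; rewrite // cand mem_head.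
have [partial_V size_V] := greedyP V (leqnn _); split=> //.
have [uniq_out sub_out _] := partial_V.
by apply: (uniq_min_size uniq_out sub_out _).2; rewrite size_V.
Qed.
End ElimOrder.

(** * Radix sort *)

(* Lexicographic comparison of characteristic functions, the head of [r] being the
   most significant position. *)
Fixpoint lexle (r e e' : seq nat) : bool :=
  if r is y :: r' then
    if (y \in e) == (y \in e') then lexle r' e e' else y \in e'
  else true.

Lemma radix_sort_perm J xs : perm_eq (radix_sort J xs) J.
Proof.
rewrite /radix_sort; elim: xs J => //= x xs IH J; apply: perm_trans (IH _) _.
by rewrite perm_catC; apply/permEl/perm_filterC.
Qed.

Lemma pairwise_filter_in (T : Type) (R R' : rel T) (p : pred T) s :
  {in p &, forall a b, R a b -> R' a b} -> pairwise R s -> pairwise R' (filter p s).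
Proof.
move=> sub_R pair_s; apply: (sub_in_pairwise sub_R); first exact: filter_all.
exact: pairwise_filter.
Qed.

Lemma radix_sort_sorted J xs :
  pairwise (lexle (rev xs)) (map table_vars (radix_sort J xs)).
Proof.
rewrite pairwise_map; elim/last_ind: xs => [|xs x IH].
  by elim: J => //= c J ->; rewrite andbT; apply/allP.
rewrite /radix_sort rev_rcons foldl_rcons -/(radix_sort J xs) /radix_step pairwise_cat.
apply/and3P; split.
- apply/allrelP => c c'; rewrite !mem_filter => /andP[/negbTE nx _] /andP[c'_x _].
  by rewrite /= nx c'_x.
- by apply: pairwise_filter_in IH => c c' /negbTE nx /negbTE nx' /=; rewrite nx nx'.
- apply: pairwise_filter_in IH => c c' c_x c'_x.
  by rewrite /= (c_x : x \in table_vars c) (c'_x : x \in table_vars c').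
Qed.

Lemma lexle_cat s r (e e' : seq nat) : lexle (s ++ r) e e' ->
  {in s, forall y, y \in e' -> y \in e} -> {in s, forall y, y \in e -> y \in e'}.
Proof.
elim: s => //= z s IH; case: eqP => [eq_z lex sub|neq_z e'_z sub]; last first.
  by case: neq_z; rewrite e'_z sub // mem_head.
move=> y; rewrite inE => /orP[/eqP->|s_y]; first by rewrite eq_z.
by apply: IH => // w s_w; apply: sub; rewrite inE s_w orbT.
Qed.

Section Chains.
Variables (E : seq (seq nat)) (xs : seq nat).
Hypotheses (uniq_xs : uniq xs) (vertices_xs : xs =i hvertices E).

Lemma lexle_below r x rest e e' : xs = rev r ++ x :: rest ->
  nest_point (map (remove_all (rev r)) E) x -> e \in E -> e' \in E ->
  lexle (rev xs) e e' -> below r x e e'.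
Proof.
move=> eq_xs /nest_pointP nest E_e E_e' lex; apply/implyP => e_x; apply/implyP => e'_x.
have uniq_cat : uniq (rev r ++ x :: rest) by rewrite -eq_xs.
have nr_x : x \notin r.
  by move: uniq_cat; rewrite uniq_catC /= mem_cat mem_rev negb_or => /andP[/andP[]].
have remove_rev f : remove_all (rev r) f = remove_all r f.
  by apply: eq_filter => v; rewrite mem_rev.
have := nest _ _ (map_f _ E_e) (map_f _ E_e').
rewrite !remove_rev !mem_remove_all nr_x e_x e'_x => /(_ isT isT)/orP[//|/allP sub_e'].
apply/allP => y; rewrite !mem_remove_all => /andP[nr_y e_y]; rewrite nr_y /=.
move: lex; rewrite eq_xs rev_cat revK => /lexle_cat; apply=> //.
  move=> z rest_z e'_z; have := sub_e' z; rewrite !mem_remove_all e'_z andbT.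
  case/(_ _)/andP=> //; move: uniq_cat; rewrite cat_uniq => /and3P[_ /hasPn disj _].
  by have := disj z; rewrite -mem_rev rest_z mem_rev => /(_ isT).
have : y \in xs by rewrite vertices_xs mem_hvertices; apply/hasP; exists e.
by rewrite eq_xs mem_cat !mem_rev (negbTE nr_y).
Qed.

Lemma radix_sort_below J r x rest : {in J, forall c, table_vars c \in E} ->
  xs = rev r ++ x :: rest -> nest_point (map (remove_all (rev r)) E) x ->
  pairwise (below r x) (map table_vars (radix_sort J xs)).
Proof.
move=> edges_J eq_xs nest.
apply: (sub_in_pairwise (P := mem E)) (radix_sort_sorted J xs).
  by move=> e e' E_e E_e'; apply: lexle_below eq_xs nest E_e E_e'.
by rewrite all_map; apply/allP => c;
  rewrite (perm_mem (radix_sort_perm J xs)) => /edges_J.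
Qed.
End Chains.

(** * Rounding *)

Lemma prod_perturb_lower B (l : seq nat) :
  B ^ size l * \prod_(n <- l) n <= \prod_(n <- l) (n * B + 1).
Proof.
elim: l => [|n l IH]; first by rewrite !big_nil.
rewrite !big_cons /= expnS mulnACA; apply: leq_mul IH; lia.
Qed.

(* As a polynomial in [B], the product of the [n * B + 1] has the same coefficients
   as the product of the [n + 1] in which only the terms below the leading one are
   divided by powers of [B]. *)
Lemma prod_perturb_upper B (l : seq nat) : 0 < B ->
  B * \prod_(n <- l) (n * B + 1) + B ^ size l * \prod_(n <- l) n <=
  B ^ size l * (B * \prod_(n <- l) n + \prod_(n <- l) (n + 1)).
Proof.
move=> B_gt0; elim: l => [|n l IH]; first by rewrite !big_nil /= expn0; lia.
have le_prod : \prod_(m <- l) m <= \prod_(m <- l) (m + 1).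
  by apply: leq_prod => m _; rewrite leq_addr.
rewrite !big_cons /= expnS; move: IH le_prod.
set T := \prod_(m <- l) (m * B + 1); set P := \prod_(m <- l) m.
set R := \prod_(m <- l) (m + 1); set Bl := B ^ size l => IH le_PR.
have [q RE] : exists q, R = P + q by exists (R - P); lia.
rewrite RE in IH *.
have le_T : B * T <= Bl * (B * P + q) by nia.
have le_nT : (n * B + 1) * (B * T) <= (n * B + 1) * (Bl * (B * P + q)).
  by rewrite leq_mul2l le_T orbT.
have le_q : Bl * q <= Bl * (B * q) by rewrite leq_mul2l leq_pmull ?orbT.
nia.
Qed.

Lemma round_sum_over d xs (L : (nat -> nat) -> seq nat) m B s : 0 < B ->
  (forall s, size (L s) = m) ->
  sum_over d xs (fun s => \prod_(n <- L s) (n + 1)) s < B ->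
  sum_over d xs (fun s => \prod_(n <- L s) (n * B + 1)) s %/ B ^ m =
  sum_over d xs (fun s => \prod_(n <- L s) n) s.
Proof.
move=> B_gt0 size_L lt_B.
set perturbed := sum_over _ _ (fun s => \prod_(n <- L s) (n * B + 1)) s.
set exact_sum := sum_over _ _ (fun s => \prod_(n <- L s) n) s.
set plus_one := sum_over _ _ _ _ in lt_B.
have lower : B ^ m * exact_sum <= perturbed.
  rewrite -sum_over_distrr; apply: leq_sum_over => s'; rewrite -(size_L s').
  exact: prod_perturb_lower.
have upper : B * perturbed + B ^ m * exact_sum <= B ^ m * (B * exact_sum + plus_one).
  rewrite /perturbed /exact_sum /plus_one -!sum_over_distrr -!sum_over_split -sum_over_distrr.
  by apply: leq_sum_over => s'; rewrite -(size_L s'); apply: prod_perturb_upper.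
have Bm_gt0 : 0 < B ^ m by rewrite expn_gt0 B_gt0.
apply/eqP; rewrite eqn_leq leq_divRL // [exact_sum * _]mulnC lower andbT.
by rewrite -ltnS ltn_divLR // -(ltn_pmul2l B_gt0); nia.
Qed.

(** * Correctness *)

Lemma fraction_of_gt0 q : 0 < (fraction_of q).2.
Proof. by rewrite absz_gt0 denq_neq0. Qed.

Lemma frac_val_fraction_of q : (0 <= q)%R -> frac_val (fraction_of q) = q.
Proof.
move=> q_ge0; rewrite -[RHS]divq_num_den /frac_val /fraction_of /= !natr_absz.
by rewrite !ger0_norm ?numq_ge0 // ltW.
Qed.

Lemma eval_constraint_foldr c s : eval_constraint c s =
  foldr (fun (p : seq nat * rat) r => if p.1 == map s (cvars c) then p.2 else r)
    (cdef c) (csupp c).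
Proof.
rewrite /eval_constraint; elim: (csupp c) => //= p l IH.
by case: (p.1 == _) => //=; rewrite -IH ?ltnS.
Qed.

Lemma eval_constraint_ext c s s' : s =1 s' -> eval_constraint c s = eval_constraint c s'.
Proof. by move=> eq_s; rewrite /eval_constraint (eq_map eq_s). Qed.

Definition values (c : constraint) : seq rat := cdef c :: map snd (csupp c).

Lemma mem_eval_constraint c s : eval_constraint c s \in values c.
Proof.
rewrite eval_constraint_foldr /values.
elim: (csupp c) => [|p l IH] /=; first by rewrite mem_head.
case: ifP => _; first by rewrite !inE eqxx orbT.
by move: IH; rewrite !inE => /orP[->|->]; rewrite ?orbT.
Qed.

Lemma matches_zip e t s : size e = size t -> matches (zip e t) s = (t == map s e).
Proof.
elim: e t => [|y e IH] [|v t] //= [eq_size].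
by rewrite /matches /= eqseq_cons eq_sym -IH.
Qed.

Section Correctness.
Variables (d : nat) (I : instance).
Hypotheses (wf_I : wf_instance d I) (acyclic_I : beta_acyclic (hypergraph_of I)).
Local Notation Ip := (map parsed_of I).
Local Notation dn := (denominator Ip).
Local Notation D := (iota 0 d).
Local Notation xs := (elim_order (map parsed_vars Ip)).
Local Notation B := (base D xs Ip).
Local Notation bound := (weight_bound Ip * B).
Local Notation J0 := (radix_sort (tables D xs Ip) xs).
Local Notation J := (final_tables D xs Ip).
Implicit Types (c : constraint) (q : rat) (s : nat -> nat).

Lemma map_parsed_vars : map parsed_vars Ip = hypergraph_of I.
Proof. by rewrite -map_comp. Qed.

Lemma base_gt0 : 0 < B.
Proof. by rewrite /base addn1. Qed.

Definition scaled q : nat := (fraction_of q).1 * (dn %/ (fraction_of q).2).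

Lemma mem_weights c q : c \in I -> q \in values c -> fraction_of q \in weights Ip.
Proof.
move=> I_c c_q; apply/flattenP; exists (map fraction_of (values c)); last exact: map_f.
by apply/mapP; exists (parsed_of c); rewrite ?map_f //= -!map_comp.
Qed.

Lemma values_ge0 c q : c \in I -> q \in values c -> (0 <= q)%R.
Proof.
move=> I_c; have /and4P[_ /allP supp_ge0 _ def_ge0] := allP wf_I _ I_c.
by rewrite inE => /orP[/eqP->|/mapP[e /supp_ge0/and3P[_ _ e_ge0] ->]].
Qed.

Lemma denominator_gt0 : 0 < dn.
Proof.
apply: prodn_pos; apply/allP => n /mapP[f /flattenP[l /mapP[p /mapP[c _ ->] ->]]].
by rewrite inE => /orP[/eqP->|/mapP[e /mapP[e' _ ->] ->]] ->; apply: fraction_of_gt0.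
Qed.

Lemma scaledE c q : c \in I -> q \in values c -> (q = (scaled q)%:R / dn%:R)%R.
Proof.
move=> I_c c_q; rewrite -[LHS](frac_val_fraction_of (values_ge0 I_c c_q)); apply/eqP.
have dvd_q : (fraction_of q).2 %| dn by apply/dvdn_prodn/map_f;
  apply: mem_weights I_c c_q.
rewrite /frac_val eqr_div ?natr_neq0 ?fraction_of_gt0 ?denominator_gt0 // -!natrM /scaled.
by rewrite -mulnA divnK.
Qed.

Lemma scaled_lt c q : c \in I -> q \in values c -> scaled q < weight_bound Ip.
Proof.
move=> I_c c_q; rewrite /weight_bound add1n ltnS mulnC; apply: leq_mul;
  last exact: leq_div.
exact/leq_sumn/map_f/(mem_weights I_c).
Qed.

Lemma table_eval_table_of c s : c \in I ->
  table_eval (table_of dn B (parsed_of c)) s = (scaled (eval_constraint c s) * B + 1, 1).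
Proof.
move=> I_c; have /and4P[_ /allP wf_supp _ _] := allP wf_I _ I_c.
rewrite eval_constraint_foldr /table_eval /table_entries /table_default /=.
elim: (csupp c) wf_supp => //= e l IH wf_supp.
have /and3P[/eqP size_e _ _] := wf_supp e (mem_head _ _).
rewrite matches_zip ?size_e //; case: ifP => // _; apply: IH => e' l_e'.
by apply: wf_supp; rewrite inE l_e' orbT.
Qed.

Lemma table_wf_table_of c : c \in I -> table_wf (table_of dn B (parsed_of c)).
Proof.
move=> I_c; have /and4P[uniq_c /allP wf_supp _ _] := allP wf_I _ I_c.
apply/andP; split; first exact: uniq_c.
apply/allP => e /mapP[e' /mapP[e'' supp_e ->] ->] /=.
have /and3P[/eqP size_e _ _] := wf_supp _ supp_e.
by rewrite unzip1_zip // size_e.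
Qed.

Lemma int_positive_weight c q : c \in I -> q \in values c ->
  int_weight bound (positive_weight dn B (fraction_of q)).
Proof.
move=> I_c c_q; rewrite /int_weight /= addn1 /=.
have le_bound : (scaled q).+1 * B <= bound by rewrite leq_mul2r (scaled_lt I_c c_q) orbT.
by apply: leq_trans le_bound; rewrite mulSn -[X in X < _]add0n ltn_add2r base_gt0.
Qed.

Lemma table_int_table_of c : c \in I -> table_int bound (table_of dn B (parsed_of c)).
Proof.
move=> I_c; apply/andP; split; first by apply: (int_positive_weight I_c);
  rewrite mem_head.
apply/allP => e /mapP[e' /mapP[e'' supp_e ->] ->].
by apply: (int_positive_weight I_c); rewrite inE map_f ?orbT.
Qed.

Lemma perm_sorted_tables : perm_eq J0 (map (fun c => table_of dn B (parsed_of c)) I).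
Proof. by apply: perm_trans (radix_sort_perm _ _) _; rewrite /tables -map_comp. Qed.

Lemma all_sorted_tables (P : pred table) :
  {in I, forall c, P (table_of dn B (parsed_of c))} -> all P J0.
Proof.
by move=> P_I; apply/allP => t; rewrite (perm_mem perm_sorted_tables) =>
  /mapP[c /P_I P_c ->].
Qed.

Lemma size_sorted_tables : size J0 = size I.
Proof. by rewrite (perm_size perm_sorted_tables) size_map. Qed.

Definition scaled_values s : seq nat := map (fun c => scaled (eval_constraint c s)) I.

Lemma partition_fn_sum_over :
  (partition_fn d I = (sum_over d (rev xs) (fun s => \prod_(n <- scaled_values s) n)
                         (lookup [::]))%:R / dn%:R ^+ size I)%R.
Proof.
have ext_prod : extensional (fun s => \prod_(n <- scaled_values s) n).
  move=> s s' eq_s; congr (\prod_(n <- _) n).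
  by apply: eq_map => c; rewrite (eval_constraint_ext c eq_s).
have [[uniq_xs _ _] vertices_xs] := elim_orderP acyclic_I.
have perm_xs : perm_eq (ivars I) (rev xs).
  rewrite map_parsed_vars; apply: uniq_perm; rewrite ?rev_uniq ?undup_uniq //.
  by move=> y; rewrite mem_rev vertices_xs.
rewrite -(perm_sum_over _ _ ext_prod perm_xs) -sum_over_ffun ?undup_uniq //.
rewrite natr_sum mulr_suml; apply: eq_bigr => a _.
rewrite big_map natr_prod -[size I]count_predT -iter_mulr_1 -big_const_seq -prodf_div.
by apply: eq_big_seq => c I_c; apply: (scaledE I_c); apply: mem_eval_constraint.
Qed.

Lemma final_invariant : 0 < d \/ xs = [::] -> elim_invariant d J0 (rev xs) J.
Proof.
have wf_J0 : all table_wf J0 by apply: all_sorted_tables => c; apply: table_wf_table_of.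
have int_J0 : all (table_int bound) J0.
  by apply: all_sorted_tables => c; apply: table_int_table_of.
case=> [d_gt0|xs_nil]; last first.
  by move: wf_J0 int_J0; rewrite /final_tables xs_nil; apply: elim_invariant_nil.
have bound_gt0 : 0 < bound by rewrite muln_gt0 base_gt0 andbT.
apply: (elim_invariant_all d_gt0 bound_gt0 wf_J0 int_J0) => [|r x rest eq_xs].
  by rewrite /clamp_bound !pow_sizeE size_iota size_map size_sorted_tables leq_addr.
have [[uniq_xs _ nest_xs] vertices_xs] := elim_orderP acyclic_I.
rewrite -map_parsed_vars in uniq_xs nest_xs vertices_xs.
apply: (radix_sort_below uniq_xs vertices_xs _ eq_xs (nest_xs _ _ _ eq_xs)).
by move=> t /mapP[p Ip_p ->]; apply: map_f.
Qed.

Lemma final_value_sum_over : 0 < d \/ xs = [::] -> let F := final_value J in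
  0 < F.2 /\ F.1 * d ^ size xs =
    sum_over d (rev xs) (fun s => \prod_(n <- scaled_values s) (n * B + 1))
      (lookup [::]) * F.2.
Proof.
move=> nonempty F; have [_ _ pos_J prodE] := final_invariant nonempty.
have := prodE (size J0 + size J) (lookup [::]).
rewrite /partial_sum !take_oversize ?leq_addl ?leq_addr // size_rev => eq_W.
have pos_F : all frac_pos (map (fun t => table_eval t (lookup [::])) J).
  by rewrite all_map; apply: sub_all pos_J => t; apply: table_eval_pos.
have /andP[_ F2_gt0] := frac_pos_prod pos_F; split=> //.
have val_F : frac_val F = tables_prod J (lookup [::]) by rewrite frac_val_prod // big_map.
rewrite -val_F in eq_W.
rewrite -(@eq_sum_over d _ (fun s => \prod_(t <- J0) (table_eval t s).1)); last first.
  move=> s; rewrite (perm_big _ perm_sorted_tables) /= /scaled_values !big_map.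
  by apply: eq_big_seq => c I_c; rewrite table_eval_table_of.
apply/eqP; rewrite -(eqr_nat rat) !natrM natrX -eq_W.
by rewrite /frac_val mulrAC divfK // natr_neq0.
Qed.

Lemma sum_over_succ_lt_base :
  sum_over d (rev xs) (fun s => \prod_(n <- scaled_values s) (n + 1)) (lookup [::]) < B.
Proof.
rewrite /base addn1 ltnS !pow_sizeE size_iota size_map -(size_rev xs).
apply: sum_over_leq => s; rewrite -(size_map (fun c => scaled (eval_constraint c s))).
have : all (fun n => n < weight_bound Ip) (scaled_values s).
  by rewrite all_map; apply/allP => c I_c; apply: (scaled_lt I_c);
    apply: mem_eval_constraint.
rewrite -/(scaled_values s).
elim: (scaled_values s) => [|n l IH] /=; first by rewrite big_nil.
by case/andP=> lt_n /IH le_l; rewrite big_cons expnS leq_mul // addn1.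
Qed.

Lemma round_final_value : let F := final_value J in
  F.1 * d ^ size xs %/ (F.2 * B ^ size I) =
  sum_over d (rev xs) (fun s => \prod_(n <- scaled_values s) n) (lookup [::]).
Proof.
move=> F; have [nonempty|] : (0 < d \/ xs = [::]) \/ (d = 0 /\ rev xs != [::]).
- case: (posnP d) => [d0|]; last by left; left.
  by case: (eqVneq xs [::]) => [|xs_neq0];
    [left; right | right; rewrite -size_eq0 size_rev size_eq0].
- have [F2_gt0 eq_F] := final_value_sum_over nonempty.
  rewrite eq_F mulnC divnMl //; apply: round_sum_over; first exact: base_gt0.
    by move=> s; rewrite size_map.
  exact: sum_over_succ_lt_base.
case=> d0 xs_neq0; rewrite sum_over_domain0 // d0 exp0n ?muln0 ?div0n //.
by rewrite -size_rev lt0n size_eq0.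
Qed.

Lemma solveE : 0 < (solve D Ip).2 /\ frac_val (solve D Ip) = partition_fn d I.
Proof.
rewrite /solve /solve_ordered /round_value /frac_val /= !pow_sizeE size_iota size_map.
split; first by rewrite expn_gt0 denominator_gt0.
by rewrite round_final_value partition_fn_sum_over natrX.
Qed.
End Correctness.

Theorem theorem5 :
  exists (p : program) (c k : nat),
    forall (d : nat) (I : instance),
      wf_instance d I ->
      beta_acyclic (hypergraph_of I) ->
      exists (fuel : nat) (m : memory) (cost : nat),
        run p fuel 0 (init_mem (enc_input d I)) = Some (m, cost) /\
        (cost <= c * (size (enc_input d I)).+1 ^ k)%N /\
        (0 < m 1%N)%N /\
        (((m 0%N)%:R / (m 1%N)%:R)%R = partition_fn d I :> rat).
Proof.
have [p [c [k run_algorithm]]] := fp_program fp_algorithm.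
exists p, c, k => d I wf_I acyclic_I.
have [z [fuel [m [cost [run_p cost_p]]]]] := run_algorithm (enc_input d I).
have [den_gt0 value] := solveE wf_I acyclic_I.
rewrite /algorithm decode_enc_input => result; exists fuel, m, cost.
by move: den_gt0 value; rewrite -result.
Qed.
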